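(* Let $G$ be a finitely generated group which is not virtually cyclic, and let $Y$ be a Cayley graph of $G$ with respect to a finite generating set. Let $T_3$ denote the infinite $3$-regular tree. If, for all integers $k\geq 1$, \[ \mathrm{wir}^k_{T_3\to Y}(n)\not\simeq n, \] then $G$ is amenable but not elementary amenable.
   Context: Graphs are regarded as topological spaces ($1$-dimensional complexes); $|\Gamma|$ is the number of vertices of $\Gamma$, and $V\Gamma$, $E\Gamma$ are its vertex and edge sets. Wiring: a wiring of a graph $\Gamma$ into a graph $\Gamma'$ is a continuous map $f:\Gamma\to\Gamma'$ which maps vertices to vertices and edges to unions of edges. It is a coarse $k$-wiring if (1) the restriction of $f$ to $V\Gamma$ is at most $k$-to-$1$, i.e. $|\{v\in V\Gamma : f(v)=w\}|\leq k$ for all $w\in V\Gamma'$; and (2) each edge $e\in E\Gamma'$ is contained in at most $k$ of the image paths of $f$ (images of edges of $\Gamma$). The volume $\mathrm{vol}(f)$ is the number of vertices in the image of $f$. Wiring profile: for a finite graph $\Gamma$ and a graph $Y$, $\mathrm{wir}^k(\Gamma\to Y)$ is the minimal volume of a coarse $k$-wiring of $\Gamma$ into $Y$, or $\infty$ if none exists. For graphs $X,Y$, $\mathrm{wir}^k_{X\to Y}(n)=\max\{\mathrm{wir}^k(\Gamma\to Y) : \Gamma\leq X,\ |\Gamma|\leq n\}$, where $\Gamma\leq X$ means $\Gamma$ is a subgraph of $X$. Comparison: for functions $f,g$ on $\mathbb{N}$ (values in $\mathbb{N}\cup\{\infty\}$), $f\lesssim g$ means there is a (finite) constant $C$ such that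 $f(n)\leq Cg(Cn)+C$ for all $n$; $f\simeq g$ means $f\lesssim g$ and $g\lesssim f$. In ''$\simeq n$'' the right-hand side is the function $n\mapsto n$. Elementary amenable groups form the smallest class of groups containing all finite and all abelian groups and closed under subgroups, quotients, extensions and directed unions. *)

(* Defs.v *)
From HB Require Import structures.
From mathcomp Require Import all_boot all_order all_algebra.
From mathcomp Require Import all_classical all_reals all_analysis.

Set Implicit Arguments.
Unset Strict Implicit.
Unset Printing Implicit Defensive.

Import Order.TTheory GRing.Theory Num.Theory.
Import numFieldNormedType.Exports.

Local Open Scope classical_set_scope.
Local Open Scope card_scope.
Local Open Scope ring_scope.

(** * Graphs *)

Record graph := Graph {
  vertex : choiceType;
  adj : rel vertex;
  adj_sym : symmetric adj;
  adj_irr : irreflexive adj }.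

Definition edges (X : graph) : set (set (vertex X)) :=
  [set e | exists u v, adj u v /\ e = [set u; v]].
Arguments edges : clear implicits.

(* Subgraphs need not be induced. *)
Record subgraph (X : graph) := Subgraph {
  sub_vertex : set (vertex X);
  sub_adj : rel (vertex X);
  sub_adj_sym : symmetric sub_adj;
  sub_adjP : forall u v, sub_adj u v ->
    [/\ adj u v, sub_vertex u & sub_vertex v] }.

Section GraphOfSubgraph.
Context (X : graph) (H : subgraph X).
Let V := set_type (sub_vertex H).
Let e : rel V := fun u v => sub_adj H (val u) (val v).

Fact graph_of_subgraph_sym : symmetric e.
Proof. by move=> u v; apply: sub_adj_sym. Qed.

Fact graph_of_subgraph_irr : irreflexive e.
Proof.
move=> u; apply/negP => /(@sub_adjP _ H)[].
by rewrite adj_irr.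
Qed.

Definition graph_of_subgraph : graph :=
  Graph graph_of_subgraph_sym graph_of_subgraph_irr.
End GraphOfSubgraph.

Coercion graph_of_subgraph : subgraph >-> graph.

Definition graph_connected (X : graph) : Prop :=
  forall u v : vertex X, exists p, path (@adj X) u p /\ last u p = v.

(* In a simple graph, a closed walk without repeated vertices is a genuine
   cycle exactly when it has at least 3 vertices. *)
Definition graph_acyclic (X : graph) : Prop :=
  forall c : seq (vertex X), ucycle (@adj X) c -> (size c < 3)%N.

Definition regular_graph (d : nat) (X : graph) : Prop :=
  forall v : vertex X, [set w | adj v w] #= `I_d.

Definition infinite_regular_tree (d : nat) (X : graph) : Prop :=
  [/\ infinite_set [set: vertex X], graph_connected X, graph_acyclic X
    & regular_graph d X].

(** * Geometric realization of a graph *)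

(* A point of the realization is recorded by its barycentric coordinates:
   [barycenter u v t] is the point at parameter t of the segment from u to v. *)
Definition barycenter (R : realType) (V : choiceType) (u v : V) (t : R)
    : V -> R :=
  fun w => (1 - t) * (w == u)%:R + t * (w == v)%:R.

Record realization (R : realType) (X : graph) := RealizationPoint {
  bary_coord :> vertex X -> R;
  bary_coordP : exists u v t, [/\ (u == v) || adj u v, 0 <= t <= 1
                                & bary_coord = barycenter u v t] }.

HB.instance Definition _ (R : realType) (X : graph) :=
  gen_eqMixin (realization R X).
HB.instance Definition _ (R : realType) (X : graph) :=
  gen_choiceMixin (realization R X).

Section RealizationTopology.
Context (R : realType) (X : graph).
Implicit Types U : set (realization R X).

Definition on_segment (u v : vertex X) (t : R) (p : realization R X) : Prop :=
  0 <= t <= 1 /\ bary_coord p = barycenter u v t.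

(* Topology of the 1-dimensional CW complex: U is open iff its trace on each
   edge, parametrized by [0,1], is relatively open in [0,1]. *)
Definition realization_open U : Prop :=
  forall u v, adj u v -> exists O : set R, open O /\
    forall t p, on_segment u v t p -> (O t <-> U p).

Fact realization_openT : realization_open setT.
Proof. by move=> u v _; exists setT; split => //; exact: openT. Qed.

Fact realization_openI U V :
  realization_open U -> realization_open V -> realization_open (U `&` V).
Proof.
move=> oU oV u v uv.
case: (oU u v uv) => O [oO OU]; case: (oV u v uv) => O1 [oO1 OV].
exists (O `&` O1); split; first exact: openI.
move=> t p tp; have := OU t p tp; have := OV t p tp.
by rewrite /setI /=; tauto.
Qed.

Fact realization_open_bigU (I : Type) (F : I -> set (realization R X)) :
  (forall i, realization_open (F i)) -> realization_open (\bigcup_i F i).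
Proof.
move=> oF u v uv.
have /choice[W WF] := fun i => oF i u v uv.
exists (\bigcup_i W i); split; first by apply: bigcup_open => i _; case: (WF i).
move=> t p tp; split=> -[i _ h]; exists i => //;
  by have [_ /(_ t p tp)[h1 h2]] := WF i; auto.
Qed.

HB.instance Definition _ := isOpenTopological.Build (realization R X)
  realization_openT realization_openI realization_open_bigU.

Fact node_subproof (v : vertex X) : exists u w t,
  [/\ (u == w) || adj u w, 0 <= t <= 1
    & (fun x => (x == v)%:R) = barycenter u w t :> (vertex X -> R)].
Proof.
exists v, v, 0; split; rewrite ?eqxx ?lexx ?ler01 //.
by apply/funext => x; rewrite /barycenter subr0 mul1r mul0r addr0.
Qed.

Definition node (v : vertex X) : realization R X :=
  RealizationPoint (node_subproof v).

(* For an edge e = {u, v}, the points with support in e form the closed edge. *)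
Definition closed_edge (e : set (vertex X)) : set (realization R X) :=
  [set p | forall w, ~ e w -> p w = 0].

End RealizationTopology.
Arguments node R {X} v.
Arguments closed_edge R {X} e.

(** * Wirings and wiring profiles *)

(* The image of an edge is a nondegenerate union of closed edges: an edge is
   never collapsed to a vertex. *)
Definition wiring (R : realType) (X Y : graph)
    (f : realization R X -> realization R Y) : Prop :=
  [/\ continuous f,
      forall v : vertex X, exists w : vertex Y, f (node R v) = node R w
    & forall e, edges X e -> exists2 E : set (set (vertex Y)),
        E `<=` edges Y &
        f @` closed_edge R e = \bigcup_(e' in E) closed_edge R e'].

Definition coarse_wiring (R : realType) (k : nat) (X Y : graph)
    (f : realization R X -> realization R Y) : Prop :=
  [/\ wiring f,
      forall w : vertex Y,
        [set v : vertex X | f (node R v) = node R w] #<= `I_k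
    & forall e', edges Y e' ->
        [set e | edges X e /\ closed_edge R e' `<=` f @` closed_edge R e]
          #<= `I_k].

Definition has_volume (R : realType) (X Y : graph)
    (f : realization R X -> realization R Y) (m : nat) : Prop :=
  [set w : vertex Y | range f (node R w)] #= `I_m.

Definition min_volume (R : realType) (k : nat) (X Y : graph) : \bar R :=
  ereal_inf [set (m%:R%:E : \bar R) | m in
    [set m | exists f : realization R X -> realization R Y,
       coarse_wiring k f /\ has_volume f m]].

(* The supremum is a maximum: up to isomorphism, there are finitely many graphs
   with at most n vertices. *)
Definition wiring_profile (R : realType) (k : nat) (X Y : graph) (n : nat)
    : \bar R :=
  ereal_sup [set min_volume R k H Y | H in
    [set H : subgraph X | sub_vertex H #<= `I_n]].

Definition lesssim (R : realType) (f g : nat -> \bar R) : Prop :=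
  exists C : nat, forall n, (f n <= C%:R%:E * g (C * n)%N + C%:R%:E)%E.

Definition simeq (R : realType) (f g : nat -> \bar R) : Prop :=
  lesssim f g /\ lesssim g f.

(** * Groups *)

Local Open Scope group_scope.

Definition is_subgroup (G : groupType) (H : set G) : Prop :=
  group_closed (mem H).

Definition generates (G : groupType) (S : set G) : Prop :=
  forall H : set G, is_subgroup H -> S `<=` H -> H = setT.

Definition cyclic_subgroup (G : groupType) (H : set G) : Prop :=
  exists x : G, H = [set y | exists n : nat, y = x ^+ n \/ y = x ^- n].

Definition finite_index (G : groupType) (H : set G) : Prop :=
  finite_set [set [set x * h | h in H] | x in [set: G]].

Definition virtually_cyclic (G : groupType) : Prop :=
  exists H : set G, [/\ is_subgroup H, cyclic_subgroup H & finite_index H].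

Section CayleyGraph.
Context (G : groupType) (S : set G).

Definition cayley_adj : rel G :=
  fun g h => (g != h) && `[< S (g^-1 * h) \/ S (h^-1 * g) >].

Fact cayley_adj_sym : symmetric cayley_adj.
Proof.
move=> g h; rewrite /cayley_adj eq_sym; congr (_ && _).
by apply/asbool_equiv_eq; tauto.
Qed.

Fact cayley_adj_irr : irreflexive cayley_adj.
Proof. by move=> g; rewrite /cayley_adj eqxx. Qed.

Definition cayley_graph : graph := Graph cayley_adj_sym cayley_adj_irr.
End CayleyGraph.

(* Existence of a left-invariant, finitely additive probability measure defined
   on all subsets of G. *)
Definition amenable (R : realType) (G : groupType) : Prop :=
  exists mu : set G -> R,
    [/\ forall A, (0 <= mu A)%R, mu setT = 1%R,
        forall A B, A `&` B = set0 -> mu (A `|` B) = (mu A + mu B)%R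
      & forall (g : G) A, mu [set g * a | a in A] = mu A].

(* Subgroups, quotients and extensions are given by homomorphisms, so the class
   is closed under isomorphism. In [EA_directed_union], the subgroups of the
   directed union are the ranges of the injections [i j]. *)
Inductive elementary_amenable : groupType -> Prop :=
| EA_finite (G : groupType) :
    finite_set [set: G] -> elementary_amenable G
| EA_abelian (G : groupType) :
    (forall x y : G, commute x y) -> elementary_amenable G
| EA_subgroup (G H : groupType) (i : {multiplicative H -> G}) :
    injective i -> elementary_amenable G -> elementary_amenable H
| EA_quotient (G Q : groupType) (q : {multiplicative G -> Q}) :
    range q = setT -> elementary_amenable G -> elementary_amenable Q
| EA_extension (N G Q : groupType)
    (i : {multiplicative N -> G}) (q : {multiplicative G -> Q}) :
    injective i -> range q = setT -> range i = q @^-1` [set 1] ->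
    elementary_amenable N -> elementary_amenable Q -> elementary_amenable G
| EA_directed_union (G : groupType) (J : Type) (H : J -> groupType)
    (i : forall j, {multiplicative H j -> G}) :
    (forall j, injective (i j)) ->
    (forall j j', exists l, range (i j) `|` range (i j') `<=` range (i l)) ->
    \bigcup_j range (i j) = setT ->
    (forall j, elementary_amenable (H j)) -> elementary_amenable G.

(* Main.v *)
(** If G is not amenable, Folner's condition fails, so some finite set K
    satisfies 4|F| <= |FK| for all finite F, and Hall's theorem plants ternary
    trees in G with bounded displacement.  If G is elementary amenable, then
    every finitely generated section of G either contains a free semigroup of
    rank 2 or is poly-(finite or cyclic): this passes to subgroups, quotients
    and directed unions, and for extensions one uses Milnor's argument that
    the kernel of a map onto a poly-(finite or cyclic) group is finitely
    generated unless a free semigroup appears.  A poly-(finite or cyclic) group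
    which is not virtually cyclic contains Z^2.  So G contains, up to bounded
    displacement, either a ternary tree or the grid N^2.  A tree carries T_3
    itself.  In the grid, a forest with n vertices is laid out recursively: a
    region with at most two boundary edges is cut by few vertices into smaller
    regions of the same kind, which are placed in disjoint boxes joined by
    channels; the boxes shrink more slowly than the regions, so that the total
    wire length stays linear.  Each case gives a coarse wiring of volume O(n),
    and the bound n <= k vol(f) is immediate. *)

Require Import Defs.
From HB Require Import structures.
From mathcomp Require Import all_boot all_order all_algebra.
From mathcomp Require Import all_classical all_reals all_analysis.
From mathcomp Require Import finmap zify lra.

Set Implicit Arguments.
Unset Strict Implicit.
Unset Printing Implicit Defensive.

(** * Laying out forests in the grid *)

(** In the grid the obstacle is congestion. All wires that leave a box pass through its corner, so a
    region must have boundedly many boundary edges, whereas cutting a tree into light pieces alone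
    allows pieces with many. Hence a vertex is also cut when two cut points would touch the same
    piece from below; this at most doubles the number of cuts. Congestion then does not add up over
    the levels: a wire of a higher level meets a smaller box only at its corner, and only if its
    edge crosses the boundary of the region in that box, where the inner layout has already counted
    it. A wire is stored as a list of vertices that contains a walk, so wires of several levels are
    simply concatenated.

    For elementary amenable groups the obstacle is that the kernel in an extension need not be
    finitely generated. Working with sections H / M, finite generation is required only modulo M,
    and it is pushed into the kernel along the series of the quotient.

    In a nonamenable group only finitely many levels of the tree are built, as many as the given
    forest needs, so Hall's theorem for finite sets is enough. *)

Definition conn (T : eqType) (e : rel T) (S : seq T) (a b : T) : Prop :=
  exists s, [/\ path e a s, last a s = b & {subset a :: s <= S}].

Lemma conn_refl (T : eqType) (e : rel T) (S : seq T) a : a \in S -> conn e S a a.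
Proof. by move=> aS; exists [::]; split=> // b; rewrite inE => /eqP->. Qed.

Lemma conn_mem (T : eqType) (e : rel T) (S : seq T) a b :
  conn e S a b -> a \in S /\ b \in S.
Proof.
move=> [s [_ <- sS]]; split; apply: sS; first exact: mem_head.
exact: mem_last.
Qed.

Lemma conn_sub (T : eqType) (e : rel T) (S S' : seq T) a b :
  {subset S <= S'} -> conn e S a b -> conn e S' a b.
Proof. by move=> SS' [s [ps ls sS]]; exists s; split=> // x /sS /SS'. Qed.

Lemma conn_trans (T : eqType) (e : rel T) (S : seq T) a b c :
  conn e S a b -> conn e S b c -> conn e S a c.
Proof.
move=> [s [ps ls sS]] [s' [ps' ls' sS']]; exists (s ++ s'); split.
- by rewrite cat_path ps ls.
- by rewrite last_cat ls.
- move=> x; rewrite -cat_cons mem_cat => /orP[/sS//|xs'].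
  by apply: sS'; rewrite inE xs' orbT.
Qed.

Lemma conn_sym (T : eqType) (e : rel T) (S : seq T) a b :
  symmetric e -> conn e S a b -> conn e S b a.
Proof.
move=> se [s [ps <- sS]]; exists (rev (belast a s)); split.
- by rewrite rev_path; rewrite (eq_path (e' := e)) // => x y; rewrite se.
- by case: s {ps sS} => //= b' s; rewrite rev_cons last_rcons.
- move=> x; rewrite -rev_rcons mem_rev -lastI; exact: sS.
Qed.

Lemma conn_step (T : eqType) (e : rel T) (S : seq T) a b :
  e a b -> a \in S -> b \in S -> conn e S a b.
Proof.
move=> eab aS bS; exists [:: b]; split=> //=; first by rewrite eab.
by move=> x; rewrite !inE => /orP[]/eqP->.
Qed.

(* The address of a vertex of the rooted ternary tree lists the branches taken
   from the vertex up to the root: the parent of [i :: v] is [v]. *)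
Definition addr := seq 'I_3.

(* [W (i :: v)] contains a path that realizes the edge between [i :: v] and its
   parent [v]; congestion is counted at vertices. *)
Definition routable (T : eqType) (e : rel T) (k C : nat) : Prop :=
  forall U : seq addr, uniq U -> exists (phi : addr -> T) (W : addr -> seq T),
  [/\ forall i v, i :: v \in U -> v \in U ->
        conn e (W (i :: v)) (phi (i :: v)) (phi v),
      forall g, count (fun v => phi v == g) U <= k,
      forall g, count (fun v => g \in W v) U <= k
    & \sum_(v <- U) size (W v) <= C * size U].

(* [(x, Some y)] stands for the vertices below x that are not below y. Only the
   edges above x and above y leave it. *)
Definition region := (addr * option addr)%type.

Definition in_region (R : region) (v : addr) : bool :=
  suffix R.1 v && ~~ (if R.2 is Some y then suffix y v else false).

Definition valid_region (R : region) : Prop :=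
  if R.2 is Some y then suffix y R.1 -> R.1 = y else True.

(** An identity between numbers rather than a disjunction, so that summation over a list turns it
    into a recursion for counts. *)
Lemma suffix_child (v u : addr) :
  suffix v u = (u == v) + \sum_(i < 3) suffix (i :: v) u :> nat.
Proof.
case: (boolP (suffix v u)) => [/suffixP[s ->{u}]|nvu]; last first.
  rewrite big1 => [|i _]; first by case: eqP nvu => // ->; rewrite suffix_refl.
  by apply/eqP; rewrite eqb0; apply: contra nvu; apply: (@catl_suffix _ [:: i]).
case/lastP: s => [|s j].
  rewrite eqxx big1 // => i _; apply/eqP; rewrite eqb0.
  by apply/negP => /size_suffix /=; rewrite ltnn.
have -> : (rcons s j ++ v == v) = false.
  apply/eqP => /(congr1 size); rewrite size_cat size_rcons; lia.
have E (i : 'I_3) : suffix (i :: v) (rcons s j ++ v) = (i == j).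
  by rewrite -cat1s suffix_catl // eqxx (suffix_rcons [::]) suffix0s andbT.
by rewrite (bigD1 j) //= E eqxx big1 // => i /negPf; rewrite E => ->.
Qed.

Lemma in_region_child (v u : addr) oe :
  is_true (if oe is Some e then ~~ suffix e v else true) ->
  in_region (v, oe) u = (u == v) + \sum_(i < 3) in_region (i :: v, oe) u :> nat.
Proof.
rewrite /in_region /=; case: oe => [e|] ev; last first.
  under eq_bigr => i _ do rewrite andbT.
  by rewrite andbT suffix_child.
case: (boolP (suffix e u)) => eu /=.
  rewrite andbF big1 => [|i _]; last by rewrite andbF.
  by case: eqP eu ev => // -> ->.
under eq_bigr => i _ do rewrite andbT.
by rewrite andbT suffix_child.
Qed.

Lemma count_sum (T : Type) (I : Type) (r : seq I) (P : I -> pred T) (U : seq T) :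
  \sum_(u <- U) \sum_(i <- r) P i u = \sum_(i <- r) count (P i) U.
Proof. by rewrite exchange_big /=; apply: eq_bigr => i _; rewrite -sumn_count sumnE big_map. Qed.

Lemma countE (T : Type) (P : pred T) (U : seq T) :
  count P U = \sum_(u <- U) P u.
Proof. by rewrite -sumn_count sumnE big_map. Qed.

Lemma suffix_consr (y v : addr) i : suffix y (i :: v) -> y = i :: v \/ suffix y v.
Proof.
by case/suffixP => -[|x t] /= e; [left | right; case: e => _ ->; apply: suffix_suffix].
Qed.

Lemma suffix_total (a b u : addr) :
  suffix a u -> suffix b u -> suffix a b || suffix b a.
Proof.
move=> /suffixP[s ->{u}]; elim: s => [|x s IH] /=; first by move=> ->; rewrite orbT.
by case/suffix_consr => [->|/IH//]; rewrite -[x :: _]/((x :: s) ++ a) suffix_suffix.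
Qed.

Lemma suffix_anti (a b : addr) : suffix a b -> suffix b a -> a = b.
Proof.
move=> /suffixP[s ->] /size_suffix; rewrite size_cat.
by case: s => //= x s; lia.
Qed.

(** Both cones that define a region are closed under passing to children, so a step to the parent
    can leave the region only at its top; dually, by [region_bot], it can enter only at the lower
    vertex. *)
Lemma region_top (L : region) v :
  v != [::] -> in_region L v -> ~~ in_region L (behead v) -> v = L.1.
Proof.
move=> v0; rewrite /in_region => /andP[Lv nLv].
rewrite negb_and => /orP[nLb|]; last first.
  rewrite negbK; case: L.2 nLv => // y nyv ybv.
  by case/negP: nyv; case: v ybv {v0 Lv} => //= i v yv; apply: suffix_trans yv (suffix_cons _ _).
case: v v0 Lv nLb {nLv} => // i v _ /=.
by case/suffix_consr => [//|->].
Qed.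

Lemma region_bot (L : region) v :
  ~~ in_region L v -> in_region L (behead v) -> L.2 = Some v.
Proof.
move=> nLv /andP[Lb nLb].
have Lv : suffix L.1 v.
  by case: v Lb {nLv nLb} => //= i v Lv; apply: suffix_trans Lv (suffix_cons _ _).
move: nLv; rewrite /in_region Lv /= negbK.
case: L.2 nLb => [y|] // nyb yv; congr Some.
case: v yv nyb {Lb Lv} => [|i v] /= yv; first by move: yv; rewrite suffixs0 => /eqP->.
by case/suffix_consr: yv => [->|->].
Qed.

(** * Cutting a region at few vertices into light regions *)

Section Split.
Variables (U : seq addr) (tau : nat) (tau_gt0 : 0 < tau).
Variable oy : option addr.

Let cnt R := count (in_region R) U.

Let below v := if oy is Some y then suffix v y else false.

(* Greedy cutting from the leaves up. The region [(v, oe)] is the piece still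
   growing at v, and [oe] the only cut point adjacent to it from below; v itself
   is cut when that piece reaches weight [tau] or touches two cut points. *)
Lemma split_cone d v :
  valid_region (v, oy) ->
  (forall u, u \in U -> suffix v u -> size u < size v + d) ->
  exists X : seq addr * seq region * option addr,
  let M := X.1.1 in let Ls := X.1.2 in let oe := X.2 in
  [/\ (if oe is Some e then (e \in M \/ oy = Some e) /\ suffix v e else True)
      /\ (forall L, L \in Ls -> [/\ exists i w, L.1 = i :: w /\ w \in M,
          if L.2 is Some e then e \in M \/ oy = Some e else True,
          valid_region L & cnt L < tau]),
    (forall u, count_mem u M + in_region (v, oe) u
       + count (in_region^~ u) Ls = in_region (v, oy) u),
    cnt (v, oe) < tau,
    tau * (size M + (oe != None)) + 2 * cnt (v, oe)
      <= 2 * cnt (v, oy) + tau * below v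
  & size Ls <= 3 * size M].
Proof.
elim: d v => [|d IH] v vv hd.
  have U0 oe : cnt (v, oe) = 0.
    apply/eqP; rewrite -leqn0 leqNgt -has_count; apply/hasPn => u uU'.
    apply/negP => /andP[vu _]; have := hd _ uU' vu.
    by have := size_suffix vu; rewrite addn0 /=; lia.
  (* No vertex of [U] is left below [v]. The inherited lower vertex stays open only if it lies below
     [v], which the term [tau * below v] pays for. *)
  exists ([::], [::], if below v then oy else None) => /=.
  rewrite !U0; split=> //.
  - split=> //=; rewrite /below; case: (oy) => [y|] //=.
    by case: ifP => // vy; split=> //; right.
  - move=> u; rewrite addn0 add0n /in_region /= /below.
    case E: (suffix v u) => //=; move: vv; rewrite /valid_region /=.
    case: (oy) => [y|] //= vv; case: ifP => // vy.
    case yu: (suffix y u) => //=; have := suffix_total E yu.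
    by rewrite vy /= => /vv e; move: vy; rewrite e suffix_refl.
  - by rewrite /below; case: (oy) => [y|] /=; rewrite ?U0; [case: (suffix v y) => /=|]; lia.
have [ev|nev] := eqVneq oy (Some v).
  have c0 : cnt (v, Some v) = 0.
    by apply/eqP; rewrite -leqn0 leqNgt -has_count; apply/hasPn => u _ /=; rewrite /in_region /= andbN.
  exists ([::], [::], Some v) => /=; rewrite /below ev suffix_refl c0; split=> //.
  - by split=> //; split; [right|].
  - by move=> u; rewrite addn0.
  - lia.
have nyv : is_true (if oy is Some y then ~~ suffix y v else true).
  move: vv nev; rewrite /valid_region /=; case: (oy) => [y|] //= vv.
  by apply: contra => /vv ->.
have vi i : valid_region (i :: v, oy).
  move: nyv; rewrite /valid_region /=; case: (oy) => [y|] //= nyv yv.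
  by case/suffix_consr: yv => [->//|]; rewrite (negPf nyv).
have di i u : u \in U -> suffix (i :: v) u -> size u < size (i :: v) + d.
  move=> uU iu; have := hd u uU (suffix_trans (suffix_cons v i) iu).
  by rewrite addSnnS.
have /fin_all_exists[X HX] := fun i => IH (i :: v) (vi i) (di i).
pose M i := (X i).1.1; pose Ls i := (X i).1.2; pose o i := (X i).2.
have {HX} HX i : [/\ (if o i is Some e then (e \in M i \/ oy = Some e) /\ suffix (i :: v) e else True)
      /\ (forall L, L \in Ls i -> [/\ exists j w, L.1 = j :: w /\ w \in M i,
          if L.2 is Some e then e \in M i \/ oy = Some e else True,
          valid_region L & cnt L < tau]),
    (forall u, count_mem u (M i) + in_region (i :: v, o i) u
       + count (in_region^~ u) (Ls i) = in_region (i :: v, oy) u),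
    cnt (i :: v, o i) < tau,
    tau * (size (M i) + (o i != None)) + 2 * cnt (i :: v, o i)
      <= 2 * cnt (i :: v, oy) + tau * below (i :: v)
  & size (Ls i) <= 3 * size (M i)] by exact: HX.
move: M Ls o HX => {X} M Ls o HX.
pose e3 := enum 'I_3.
have cntE oe : is_true (if oe is Some e then ~~ suffix e v else true) ->
  cnt (v, oe) = count_mem v U + \sum_(i < 3) cnt (i :: v, oe).
  move=> /in_region_child E; rewrite /cnt countE.
  under eq_bigr => u _ do rewrite E.
  by rewrite big_split /= count_sum -countE.
have le_below : \sum_(i < 3) below (i :: v) <= below v.
  rewrite /below; case: (oy) => [y|]; last by rewrite big1.
  by rewrite suffix_child leq_addl.
pose r := count_mem v U + \sum_(i < 3) cnt (i :: v, o i).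
have sumM : tau * \sum_(i < 3) size (M i) + tau * \sum_(i < 3) (o i != None)
   + 2 * r <= 2 * cnt (v, oy) + tau * below v.
  have : \sum_(i < 3) (tau * (size (M i) + (o i != None)) + 2 * cnt (i :: v, o i))
     <= \sum_(i < 3) (2 * cnt (i :: v, oy) + tau * below (i :: v)).
    by apply: leq_sum => i _; case: (HX i).
  have := leq_mul (leqnn tau) le_below.
  have E (a b c : 'I_3 -> nat) : \sum_(i < 3) (tau * (a i + b i) + 2 * c i) =
      tau * \sum_(i < 3) a i + tau * \sum_(i < 3) b i + 2 * \sum_(i < 3) c i.
    by rewrite !big_distrr -!big_split; apply: eq_bigr => i _; rewrite mulnDr.
  have E' (a b : 'I_3 -> nat) : \sum_(i < 3) (2 * a i + tau * b i) =
      2 * \sum_(i < 3) a i + tau * \sum_(i < 3) b i.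
    by rewrite !big_distrr -!big_split.
  rewrite (cntE _ nyv) /r E E'.
  set a := \sum_(i < 3) size (M i); set b := \sum_(i < 3) (o i != None).
  set c := \sum_(i < 3) cnt (i :: v, o i); set c' := \sum_(i < 3) cnt (i :: v, oy).
  set w := \sum_(i < 3) below (i :: v); move: (tau * a) (tau * b) (tau * w) (tau * below v).
  move: c c' (count_mem v U) => c c' n A B W W'; lia.
have sumL : \sum_(i < 3) size (Ls i) <= 3 * \sum_(i < 3) size (M i).
  by rewrite big_distrr; apply: leq_sum => i _; case: (HX i).
have sfl (T : Type) (F : 'I_3 -> seq T) : size (flatten [seq F i | i <- e3]) = \sum_(i < 3) size (F i).
  by rewrite size_flatten /shape -map_comp sumnE big_map big_enum.
have cfl (T : Type) (P : pred T) (F : 'I_3 -> seq T) :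
    count P (flatten [seq F i | i <- e3]) = \sum_(i < 3) count P (F i).
  by rewrite count_flatten -map_comp sumnE big_map big_enum.
have sumE u : \sum_(i < 3) count_mem u (M i) + \sum_(i < 3) in_region (i :: v, o i) u
    + \sum_(i < 3) count (in_region^~ u) (Ls i) = \sum_(i < 3) in_region (i :: v, oy) u.
  by rewrite -!big_split; apply: eq_bigr => i _; case: (HX i) => _ /(_ u).
have Mfl i w : w \in M i -> w \in flatten [seq M i | i <- e3].
  by move=> wM; apply/flatten_mapP; exists i; rewrite ?mem_enum.
have HL (M' : seq addr) L : {subset flatten [seq M i | i <- e3] <= M'} ->
    L \in flatten [seq Ls i | i <- e3] ->
    [/\ exists j w, L.1 = j :: w /\ w \in M',
          if L.2 is Some e then e \in M' \/ oy = Some e else True,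
          valid_region L & cnt L < tau].
  move=> sM /flatten_mapP[i _ Li]; case: (HX i) => -[_ /(_ _ Li)].
  case=> -[j [w [Lw wM]]] L2 vL cL _ _ _ _; split=> //.
    by exists j, w; split=> //; apply/sM/Mfl/wM.
  by case: L.2 L2 => // e [eM|eM]; [left; apply/sM/Mfl/eM | right].
(* The left side of the inequality is a potential. Cutting at [v] costs [2 * tau], once for [v] in
   the list of cuts and once for the new open cut point [Some v]. It is paid by two open cut points
   that get closed, or by the open weight [r >= tau], which counts twice. *)
case: (boolP ((1 < \sum_(i < 3) (o i != None)) || (tau <= r))) => [b|].
  have c0 u : in_region (v, Some v) u = false by rewrite /in_region /= andbN.
  exists (v :: flatten [seq M i | i <- e3],
     [seq (i :: v, o i) | i <- e3] ++ flatten [seq Ls i | i <- e3], Some v) => /=.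
  split.
  - split; first by split; [left; rewrite mem_head | rewrite suffix_refl].
    move=> L; rewrite mem_cat => /orP[/mapP[i _ ->]|]; last first.
      by apply: HL => x xM; rewrite inE xM orbT.
    case: (HX i) => -[oi _] _ ci _ _; split=> //=.
    + by exists i, v; rewrite mem_head.
    + by case: (o i) oi => // e [[eM|eM] _]; [left; rewrite inE (Mfl _ _ eM) orbT | right].
    + by rewrite /valid_region /=; case: (o i) oi => // e [_ ie] ei; apply: suffix_anti.
  - move=> u; rewrite c0 addn0 count_cat count_map cfl cfl (in_region_child u nyv).
    rewrite -(sumE u) eq_sym countE /e3 big_enum /=.
    move: (\sum_(i < 3) count_mem u _) (\sum_(i < 3) count _ (Ls i)).
    by move=> x y; rewrite !addnA -!addnA; congr (_ + (_ + _)); exact: addnC.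
  - by rewrite /cnt (eq_count c0) count_pred0.
  - have -> : cnt (v, Some v) = 0 by rewrite /cnt (eq_count c0) count_pred0.
    rewrite sfl.
    move: sumM b; move: (\sum_(i < 3) size (M i)) (\sum_(i < 3) (o i != None)).
    move=> x y sumM /orP[y2|rt]; last by rewrite /= !(mulnDr, mulnS) !muln0; lia.
    by have := leq_mul (leqnn tau) y2; rewrite /= !(mulnDr, mulnS) !muln0; lia.
  - rewrite size_cat size_map sfl sfl size_enum_ord; lia.
rewrite negb_or -leqNgt -ltnNge => /andP[os1 rt].
(* At most one child has an open cut point. It serves as lower vertex for all three branches at
   once, since removing the cone below it does not affect the other two. *)
have [oe [oeM oev oeE oele]] : exists oe : option addr,
   [/\ if oe is Some e then exists2 i, o i = Some e & suffix (i :: v) e else True,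
      is_true (if oe is Some e then ~~ suffix e v else true),
      forall i u, in_region (i :: v, o i) u = in_region (i :: v, oe) u
     & (oe != None) <= \sum_(i < 3) (o i != None)].
  case: (pickP (fun i => o i != None)) => [i0 oi0|o0]; last first.
    by exists None; split=> // i u; move/negbT: (o0 i); rewrite negbK => /eqP->.
  have o0 i : i != i0 -> o i = None.
    move=> ii0; move: os1; rewrite (bigD1 i0) //= oi0 (bigD1 i) //=.
    by case: (o i).
  case E: (o i0) oi0 => [e|] // _.
  have [[]] := HX i0; rewrite E => -[_ ie] _ _ _ _ _.
  exists (Some e); split.
  - by exists i0.
  - apply/negP => ev; have := suffix_trans ie ev => /size_suffix /=; lia.
  - move=> i u; have [->|ii0] := eqVneq i i0; first by rewrite E.
    rewrite o0 // /in_region /= andbT; case iu: suffix => //=.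
    apply/esym/negP => eu; have i0u := suffix_trans ie eu.
    have : i :: v = i0 :: v.
      have := suffix_total iu i0u.
      by rewrite !suffixE /= !subnn !drop0 orbC eq_sym => /orP[]/eqP.
    by case=> /eqP; rewrite (negPf ii0).
  - by rewrite (bigD1 i0) //= E.
exists (flatten [seq M i | i <- e3], flatten [seq Ls i | i <- e3], oe) => /=.
have rE : cnt (v, oe) = r.
  rewrite cntE // /r; congr (_ + _); apply: eq_bigr => i _.
  by apply: eq_count => u; rewrite oeE.
split.
- split; last by move=> L; apply: HL.
  case: (oe) oeM => // e [i oi ie]; split; last exact: suffix_trans (suffix_cons _ _) ie.
  by have [[]] := HX i; rewrite oi => -[[eM|eM] _]; [left; apply: Mfl eM | right].
- move=> u; rewrite !cfl (in_region_child u oev) (in_region_child u nyv) -(sumE u).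
  have -> : \sum_(i < 3) in_region (i :: v, o i) u = \sum_(i < 3) in_region (i :: v, oe) u.
    by apply: eq_bigr => i _; rewrite oeE.
  by rewrite !addnA; congr (_ + _ + _); exact: addnC.
- by rewrite rE.
- rewrite rE sfl mulnDr; apply: leq_trans sumM.
  by rewrite leq_add2r leq_add2l leq_mul2l oele orbT.
- by rewrite sfl sfl.
Qed.

(** [split_cone] at the top, where the piece still open at [x] becomes one more region. The
    partition identity bounds every multiplicity by 1, hence the cut vertices are distinct. *)
Lemma split_region x :
  valid_region (x, oy) ->
  exists (M : seq addr) (Ls : seq region),
  [/\ [/\ uniq M, size M * tau <= 2 * cnt (x, oy) + tau & size Ls <= 3 * size M + 1],
    (forall L, L \in Ls -> valid_region L /\ cnt L < tau),
    (forall u, (u \in M) + count (in_region^~ u) Ls = in_region (x, oy) u)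
  & (forall L v, L \in Ls -> v != [::] -> in_region L v ->
        ~~ in_region L (behead v) -> v = x \/ behead v \in M)].
Proof.
move=> vx.
have hU u : u \in U -> suffix x u -> size u < size x + (\max_(u <- U) size u).+1.
  by move=> uU _; rewrite addnS ltnS (leq_trans (leq_bigmax_seq _ uU isT)) ?leq_addl.
have [[[M Ls] oe] /= [[oeP LsP] E cx cM sL]] := split_cone vx hU.
have uM : uniq M.
  apply/count_mem_uniq => u; have := E u.
  case: (boolP (u \in M)) => [|/count_memPn //].
  rewrite -has_pred1 has_count; case: (in_region _ _) => /=; lia.
exists M, ((x, oe) :: Ls); split.
- split=> //; last by rewrite /= addn1 ltnS.
  move: cM; rewrite /below; case: (oy) => [y|]; first by case: suffix; lia.
  lia.
- move=> L; rewrite inE => /orP[/eqP->|/LsP[]//]; split=> //.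
  by move: oeP; rewrite /valid_region /=; case: oe {E cx cM} => // e [_ xe] ex; apply: suffix_anti.
- by move=> u; rewrite -(E u) /= addnA (count_uniq_mem u uM).
- move=> L v LM v0 Lv nLb; rewrite (region_top v0 Lv nLb).
  move: LM; rewrite inE => /orP[/eqP->|/LsP[[i [w [-> wM]]] _ _ _]]; first by left.
  by right.
Qed.
End Split.

(** * Boxes, cells and channels in the grid *)

Definition grid_adj : rel (nat * nat) := fun p q =>
  ((p.1 == q.1) && ((p.2 == q.2.+1) || (q.2 == p.2.+1)))
  || ((p.2 == q.2) && ((p.1 == q.1.+1) || (q.1 == p.1.+1))).

Lemma grid_adj_sym : symmetric grid_adj.
Proof.
move=> p q; rewrite /grid_adj ![q.1 == p.1]eq_sym ![q.2 == p.2]eq_sym.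
by congr (_ && _ || _ && _); rewrite orbC.
Qed.

Lemma conn_vline a b c (S : seq (nat * nat)) :
  b <= c -> {subset [seq (a, y) | y <- iota b (c - b).+1] <= S} ->
  conn grid_adj S (a, c) (a, b).
Proof.
move=> bc; have -> : c = b + (c - b) by rewrite subnKC.
rewrite addKn; elim: (c - b) S => [|n IH] S sS.
  by rewrite addn0; apply: conn_refl; apply: sS; rewrite mem_head.
have mS y : b <= y <= b + n.+1 -> (a, y) \in S.
  by move=> yb; apply/sS/map_f; rewrite mem_iota; lia.
apply: conn_trans (IH S _).
  by apply: conn_step; rewrite ?mS //; rewrite /grid_adj /=; lia.
by move=> p /mapP[y]; rewrite mem_iota => yb ->; apply: mS; lia.
Qed.

Lemma conn_hline a b c (S : seq (nat * nat)) :
  b <= c -> {subset [seq (x, a) | x <- iota b (c - b).+1] <= S} ->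
  conn grid_adj S (c, a) (b, a).
Proof.
move=> bc; have -> : c = b + (c - b) by rewrite subnKC.
rewrite addKn; elim: (c - b) S => [|n IH] S sS.
  by rewrite addn0; apply: conn_refl; apply: sS; rewrite mem_head.
have mS y : b <= y <= b + n.+1 -> (y, a) \in S.
  by move=> yb; apply/sS/map_f; rewrite mem_iota; lia.
apply: conn_trans (IH S _).
  by apply: conn_step; rewrite ?mS //; rewrite /grid_adj /=; lia.
by move=> p /mapP[y]; rewrite mem_iota => yb ->; apply: mS; lia.
Qed.

Section Layout.
Variables (U : seq addr) (uU : uniq U).

(* A region with less than Q ^ h vertices gets a box of side about q ^ h. It is
   cut into at most 6 * Q + 1 <= q ^ 2 regions with less than Q ^ (h - 1)
   vertices; Q = 2 * q makes the wire lengths sum to a geometric series. *)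
Let q := 13.
Let Q := 26.
(** The edges handled at one level: two boundary edges for each of at most [q ^ 2] pieces, the edge
    up and the three edges down at each of at most [2 * Q] cut vertices, and two boundary edges of
    the region itself. *)
Let k := 2 * q ^ 2 + 4 * (2 * Q) + 2.
(** Each piece has two boundary edges, a connector is at most three sides long and a side is at most
    3 powers of [q], whence 18; [k] covers the added corners. The factor [Q] compensates that a box
    of level [h + 1] may hold only [Q ^ h] vertices. *)
Let C := (18 * q ^ 2 + k) * Q.

Let cnt R := count (in_region R) U.

(** There are [q] cells per direction, each preceded by a channel of width one. At level 0 the
    region has no vertex in [U], but the box still has its corner. *)
Fixpoint side h := if h is h'.+1 then q * (side h' + 1) + 1 else 1.

Definition in_box (z : nat * nat) h (p : nat * nat) : bool :=
  (z.1 <= p.1 < z.1 + side h) && (z.2 <= p.2 < z.2 + side h).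

Definition has_edge (v : addr) := [&& v \in U, v != [::] & behead v \in U].

Definition cell h (z : nat * nat) n : nat * nat :=
  (z.1 + 1 + (n %/ q) * (side h + 1), z.2 + 1 + (n %% q) * (side h + 1)).

(** A hook through the channels: one step out of the cell, along the channel beside it, then along
    the border of the box to its corner. Connectors may overlap; the congestion bound [k] allows for
    it. *)
Definition connector h (z : nat * nat) n : seq (nat * nat) :=
  let c := cell h z n in
  c :: [seq (c.1.-1, y) | y <- iota z.2 (c.2 - z.2).+1]
    ++ [seq (x, z.2) | x <- iota z.1 (c.1.-1 - z.1).+1].

Lemma side_gt0 h : 0 < side h.
Proof. by case: h => //= h; lia. Qed.

(** The summand 2 strengthens the induction: it absorbs the channels because [q >= 3]. *)
Lemma side_le h : side h + 2 <= 3 * q ^ h.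
Proof.
elim: h => //= h IH; rewrite expnS.
have : q * (side h + 2) <= q * (3 * q ^ h) by rewrite leq_mul2l IH orbT.
rewrite /q; lia.
Qed.

Lemma corner_in_box z h : in_box z h z.
Proof. by rewrite /in_box !leqnn /=; have := side_gt0 h; lia. Qed.

Lemma connector_conn h z n : conn grid_adj (connector h z n) (cell h z n) z.
Proof.
set c := cell h z n.
have c1 : z.1 < c.1 by rewrite /c /= addn1 addSn ltnS leq_addr.
have c2 : z.2 < c.2 by rewrite /c /= addn1 addSn ltnS leq_addr.
apply: (@conn_trans _ _ _ _ (c.1.-1, c.2)).
  apply: conn_step; rewrite ?mem_head //.
    by rewrite /grid_adj /= eqxx /= (prednK (leq_ltn_trans (leq0n _) c1)) eqxx orbT.
  rewrite inE mem_cat; apply/or3P/Or32/mapP; exists c.2 => //.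
  by rewrite mem_iota addnS ltnS subnKC ?leqnn ltnW.
apply: (@conn_trans _ _ _ _ (c.1.-1, z.2)).
  apply: conn_vline; first exact: ltnW.
  by move=> p pS; rewrite inE mem_cat pS orbT.
rewrite [in X in conn _ _ _ X](surjective_pairing z).
apply: conn_hline; first by rewrite -ltnS (ltn_predK c1).
by move=> p pS; rewrite inE mem_cat pS !orbT.
Qed.

Lemma cell_bound h n : n < q ^ 2 ->
  (n %/ q) * (side h + 1) + (side h + 1) + 1 <= side h.+1 /\
  (n %% q) * (side h + 1) + (side h + 1) + 1 <= side h.+1.
Proof.
move=> nq; have a : n %/ q < q by rewrite ltn_divLR // mulnn.
have b : n %% q < q by rewrite ltn_pmod.
by rewrite /= !leq_add2r -!mulSnr !leq_mul2r a b !orbT.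
Qed.

Lemma connector_in_box h z n p : n < q ^ 2 -> p \in connector h z n -> in_box z h.+1 p.
Proof.
move=> /cell_bound -/(_ h)[b1 b2]; have s0 := side_gt0 h.
rewrite inE mem_cat => /or3P[/eqP->|/mapP[y]|/mapP[y]].
- by rewrite /in_box /cell /=; move: b1 b2 => /=; lia.
- by rewrite mem_iota => + ->; rewrite /in_box /cell /=; move: b1 b2 => /=; lia.
- by rewrite mem_iota => + ->; rewrite /in_box /cell /=; move: b1 b2 => /=; lia.
Qed.

Lemma cell_in_box h z n p : n < q ^ 2 -> in_box (cell h z n) h p -> in_box z h.+1 p.
Proof.
move=> /cell_bound -/(_ h)[b1 b2]; have s0 := side_gt0 h.
by rewrite /in_box /cell /=; move: b1 b2 => /=; lia.
Qed.

Lemma size_connector h z n : n < q ^ 2 -> size (connector h z n) <= 3 * side h.+1.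
Proof.
move=> /cell_bound -/(_ h)[b1 b2]; have s0 := side_gt0 h.
rewrite /connector /= size_cat !size_map !size_iota; move: b1 b2 => /=.
by move: (n %/ q * _) (n %% q * _) (q * _) => a b S; rewrite size_map size_iota; lia.
Qed.

Lemma block_inj t a a' x :
  a * t <= x < a * t + t -> a' * t <= x < a' * t + t -> a = a'.
Proof.
move=> h h'; case: (ltngtP a a') => // lt; have := leq_mul lt (leqnn t);
rewrite mulSn; move: h h'; move: (a * t) (a' * t) => b b'; lia.
Qed.

Lemma cell_disjoint h z n n' p :
  in_box (cell h z n) h p -> in_box (cell h z n') h p -> n = n'.
Proof.
rewrite /in_box /cell /= => b b'.
rewrite (divn_eq n q) (divn_eq n' q).
have -> : n %/ q = n' %/ q.
  apply: (@block_inj (side h + 1) _ _ (p.1 - (z.1 + 1))); move: b b';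
  move: (n %/ q * _) (n' %/ q * _) (n %% q * _) (n' %% q * _) => a a' c c'; lia.
suff -> : n %% q = n' %% q by [].
apply: (@block_inj (side h + 1) _ _ (p.2 - (z.2 + 1))); move: b b';
move: (n %/ q * _) (n' %/ q * _) (n %% q * _) (n' %% q * _) => a a' c c'; lia.
Qed.

(** The first leg runs just before its block of cells and the second before all of them, so a
    connector touches a cell only at the corner of its own cell. Hence connectors do not raise the
    congestion inside cells. *)
Lemma connector_cell h z n n' p :
  p \in connector h z n -> in_box (cell h z n') h p -> n = n' /\ p = cell h z n.
Proof.
rewrite inE mem_cat => /or3P[/eqP-> b|/mapP[y + ->]|/mapP[y + ->]].
- by split=> //; apply: cell_disjoint b; exact: corner_in_box.
- move=> _; rewrite /in_box /cell /=.
  move=> b; have : n %/ q = n' %/ q.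
    apply: (@block_inj (side h + 1) _ _ (z.1 + n %/ q * (side h + 1) - z.1)); move: b;
    move: (n %/ q * _) (n' %/ q * _) (n' %% q * _) => a a' c'; lia.
  by move=> e; move: b; rewrite e; move: (n' %/ q * _) (n' %% q * _) => a' c'; lia.
- move=> _; rewrite /in_box /cell /=.
  by move: (n' %/ q * _) (n' %% q * _) => a' c'; lia.
Qed.
(* [layout_length] reads: total length <= (2 - 2 ^ (1 - h)) * C * cnt R. The
   slack between h and h + 1 pays for the wires of level h + 1. *)
Record layout h (R : region) (z : nat * nat)
    (phi : addr -> nat * nat) (W : addr -> seq (nat * nat)) : Prop := Layout {
  layout_vertex : forall v, v \in U -> in_region R v -> in_box z h (phi v);
  layout_wire : forall v p, p \in W v -> in_box z h p;
  layout_inner : forall v, has_edge v -> in_region R v -> in_region R (behead v) ->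
    conn grid_adj (W v) (phi v) (phi (behead v));
  layout_top : forall v, has_edge v -> in_region R v -> ~~ in_region R (behead v) ->
    conn grid_adj (W v) (phi v) z;
  layout_bot : forall v, has_edge v -> ~~ in_region R v -> in_region R (behead v) ->
    conn grid_adj (W v) (phi (behead v)) z;
  layout_congestion : forall p, count (fun v => p \in W v) U <= k;
  layout_mult : forall p, count (fun v => in_region R v && (phi v == p)) U <= k;
  layout_length : 2 ^ h * (\sum_(v <- U) size (W v)) + 2 * C * cnt R
                  <= 2 ^ h.+1 * C * cnt R }.

Lemma in_box_widen h z p : in_box z h p -> in_box z h.+1 p.
Proof. by rewrite /in_box /= /q; lia. Qed.

(** Needed for regions too light to pay for the wires of another level: the larger box has the same
    corner, and the slack in the length bound only grows. *)
Lemma layout_widen h R z phi W : layout h R z phi W -> layout h.+1 R z phi W.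
Proof.
case=> lv lw li lt lb lc lm ll; split=> //.
- by move=> v vU vR; apply: in_box_widen; apply: lv.
- by move=> v p pW; apply: in_box_widen; apply: lw pW.
- move: ll; rewrite !(expnS 2) -!(mulnA 2).
  move: (\sum_(v <- U) _) => T; move: (2 ^ h * T) (2 ^ h * C * cnt R) (C * cnt R) => a b d.
  lia.
Qed.

(** Edges are named by their lower ends, and by [region_top] and [region_bot] a boundary edge is
    named by one of the two vertices that describe the region. *)
Lemma boundary_le2 R : count (fun v => has_edge v && (in_region R v (+) in_region R (behead v))) U <= 2.
Proof.
pose s := R.1 :: if R.2 is Some y then [:: y] else [::].
apply: (@leq_trans (size s)); last by rewrite /s; case: R.2.
rewrite -size_filter; apply: uniq_leq_size; first exact: filter_uniq.
move=> v; rewrite mem_filter => /andP[/andP[/and3P[_ v0 _] b] _].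
move: b; rewrite /s inE; case: (boolP (in_region R v)) => /= Rv.
  by move=> /(region_top v0 Rv) {1}->; rewrite eqxx.
by move=> /(region_bot Rv) ->; rewrite inE eqxx orbT.
Qed.

Lemma main_edges_bound (M : seq addr) : uniq M -> size M <= 2 * Q ->
  count (fun v => has_edge v && ((v \in M) || (behead v \in M))) U <= 4 * (2 * Q).
Proof.
move=> uM sM; pose s := M ++ [seq i :: w | w <- M, i <- enum 'I_3].
apply: (@leq_trans (size s)); last first.
  by rewrite size_cat size_allpairs size_enum_ord -mulnS mulnC leq_mul2l sM orbT.
rewrite -size_filter; apply: uniq_leq_size; first exact: filter_uniq.
move=> v; rewrite mem_filter => /andP[/andP[/and3P[_ v0 _] b] _].
rewrite mem_cat; case/orP: b => [->//|bM]; apply/orP; right.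
case: v v0 bM => // i v _ /= vM; apply/allpairsP; exists (v, i).
by rewrite mem_enum.
Qed.

Lemma layout_empty R z : cnt R = 0 -> exists phi W, layout 0 R z phi W.
Proof.
move=> c0; exists (fun=> z), (fun=> [::]).
have nR v : v \in U -> ~~ in_region R v.
  by move=> vU; apply: contraT; rewrite negbK => vR; move/eqP: c0; rewrite -leqn0 leqNgt -has_count => /hasPn/(_ v vU)/negP.
split=> //.
- by move=> v vU vR; have := nR _ vU; rewrite vR.
- by move=> v /and3P[vU _ _] vR; have := nR _ vU; rewrite vR.
- by move=> v /and3P[vU _ _] vR; have := nR _ vU; rewrite vR.
- by move=> v /and3P[_ _ vU] _ vR; have := nR _ vU; rewrite vR.
- by move=> p; rewrite count_pred0.
- by move=> p; rewrite (leq_trans (sub_count (a2 := in_region R) _ _)) ?[count _ _]c0 // => v /andP[].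
- by rewrite c0 big1 ?muln0.
Qed.

(** * One level of the recursion: gluing the layouts of the pieces *)

Section Step.
Variables (h : nat) (R : region) (z : nat * nat) (M : seq addr) (Ls : seq region).
Hypotheses (uM : uniq M) (sM : size M <= 2 * Q) (sL : size Ls <= q ^ 2).
Hypothesis split_sum : forall u, (u \in M) + count (in_region^~ u) Ls = in_region R u.
Hypothesis split_top : forall L v, L \in Ls -> v != [::] -> in_region L v ->
  ~~ in_region L (behead v) -> v = R.1 \/ behead v \in M.
Let r := size Ls.
Let L (n : 'I_r) := tnth (in_tuple Ls) n.
Variables (f : 'I_r -> addr -> nat * nat) (w : 'I_r -> addr -> seq (nat * nat)).
Hypothesis lay : forall n, layout h (L n) (cell h z n) (f n) (w n).
Hypothesis big : Q ^ h <= cnt R.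

Let bd (S : region) v := has_edge v && (in_region S v (+) in_region S (behead v)).

Let main v := bd R v || has_edge v && ((v \in M) || (behead v \in M)).

(** All cut vertices share the corner of the box, which the bound [k] on multiplicities permits, as
    there are at most [2 * Q] of them. Edges between cut vertices become trivial. *)
Let phi v := if [pick n | in_region (L n) v] is Some n then f n v else z.

(** Every wire that leaves a piece is led to the corner [z], where the cut vertices sit and from
    where it can also leave the box. *)
Let wire v := flatten [seq w n v ++ (if bd (L n) v then connector h z n else [::]) | n <- enum 'I_r]
  ++ (if main v then [:: z] else [::]).

Let LsP n : L n \in Ls. Proof. exact: mem_tnth. Qed.
Let nq (n : 'I_r) : n < q ^ 2. Proof. exact: leq_trans (ltn_ord n) sL. Qed.

Let count_L u : count (in_region^~ u) Ls = \sum_(n < r) in_region (L n) u.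
Proof. by rewrite countE big_tnth. Qed.

Let L_inj n n' u : in_region (L n) u -> in_region (L n') u -> n = n'.
Proof.
move=> a b; apply/eqP; apply: contraT => nn.
have := split_sum u; rewrite count_L (bigD1 n) //= a (bigD1 n') 1?eq_sym //= b.
by case: in_region; lia.
Qed.

Let L_R n u : in_region (L n) u -> in_region R u.
Proof.
move=> a; have := split_sum u; rewrite count_L (bigD1 n) //= a.
by case: (in_region R u); lia.
Qed.

Let L_M n u : in_region (L n) u -> u \notin M.
Proof.
move=> a; have := split_sum u; rewrite count_L (bigD1 n) //= a.
by case: (in_region R u); case: (u \in M); lia.
Qed.

Let phiL n u : in_region (L n) u -> phi u = f n u.
Proof.
move=> a; rewrite /phi; case: pickP => [n' a'|/(_ n)]; last by rewrite a.
by rewrite (L_inj a a').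
Qed.

Let phiM u : u \in M -> phi u = z.
Proof.
by move=> uM'; rewrite /phi; case: pickP => [n /L_M|//]; rewrite uM'.
Qed.

Let cases u : in_region R u -> u \in M \/ exists n, in_region (L n) u.
Proof.
move=> a; case: (boolP (u \in M)) => uM'; [by left|right].
case: (pickP (fun n => in_region (L n) u)) => [n an|none]; first by exists n.
have := split_sum u; rewrite a (negPf uM') add0n count_L big1 // => n _.
by rewrite none.
Qed.

Let wireL n v : {subset w n v <= wire v}.
Proof.
move=> p pw; rewrite mem_cat; apply/orP; left; apply/flatten_mapP; exists n; first exact: mem_enum.
by rewrite mem_cat pw.
Qed.

Let wireC n v : bd (L n) v -> {subset connector h z n <= wire v}.
Proof.
move=> b p pw; rewrite mem_cat; apply/orP; left; apply/flatten_mapP; exists n; first exact: mem_enum.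
by rewrite b mem_cat pw orbT.
Qed.

Let wireM v : main v -> z \in wire v.
Proof. by move=> m; rewrite mem_cat m mem_head orbT. Qed.

Let wireP v p : p \in wire v ->
  [\/ exists n, p \in w n v, exists n, bd (L n) v /\ p \in connector h z n | main v /\ p = z].
Proof.
rewrite mem_cat => /orP[/flatten_mapP[n _]|].
  rewrite mem_cat => /orP[pw|]; first by constructor 1; exists n.
  by case: ifP => // b pc; constructor 2; exists n.
by case: ifP => // m; rewrite inE => /eqP->; constructor 3.
Qed.

Let exit_top n v : has_edge v -> in_region (L n) v -> ~~ in_region (L n) (behead v) ->
  conn grid_adj (wire v) (phi v) z.
Proof.
move=> e a b; rewrite (phiL a); apply: conn_trans.
  by apply: conn_sub (layout_top (lay n) e a b); apply: wireL.
apply: conn_sub (connector_conn _ _ _); apply: wireC.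
by rewrite /bd e a (negPf b).
Qed.

Let exit_bot n v : has_edge v -> ~~ in_region (L n) v -> in_region (L n) (behead v) ->
  conn grid_adj (wire v) (phi (behead v)) z.
Proof.
move=> e a b; rewrite (phiL b); apply: conn_trans.
  by apply: conn_sub (layout_bot (lay n) e a b); apply: wireL.
apply: conn_sub (connector_conn _ _ _); apply: wireC.
by rewrite /bd e (negPf a) b.
Qed.

Let z_off n : ~~ in_box (cell h z n) h z.
Proof.
by rewrite /in_box /cell /=; move: (n %/ q * _) (n %% q * _) => a b; lia.
Qed.

Let main_count : count main U <= 2 + 4 * (2 * Q).
Proof.
apply: (@leq_trans (count (bd R) U + count (fun v => has_edge v && ((v \in M) || (behead v \in M))) U)).
  by rewrite -count_predUI leq_addr.
by apply: leq_add; [exact: boundary_le2 | exact: main_edges_bound].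
Qed.

Let local_count : count (fun v => main v || [exists n, bd (L n) v]) U <= k.
Proof.
apply: (@leq_trans (count main U + \sum_(n < r) count (bd (L n)) U)).
  rewrite -count_sum countE [X in _ <= X + _]countE -big_split /=; apply: leq_sum => v _.
  case: (main v) => //=; case: existsP => //= -[n b].
  by rewrite (bigD1 n) //= b.
have b2 : \sum_(n < r) count (bd (L n)) U <= \sum_(n < r) 2.
  by apply: leq_sum => n _; apply: boundary_le2.
apply: leq_trans (leq_add main_count b2) _.
rewrite sum_nat_const card_ord; move: sL; rewrite -/r /k; move: (4 * (2 * Q)) (q ^ 2) => a b; lia.
Qed.

Lemma layout_step : layout h.+1 R z phi wire.
Proof.
split.
- move=> v vU /cases[vM|[n a]].
    by rewrite phiM //; apply: corner_in_box.
  by rewrite (phiL a); apply: (cell_in_box (nq n)); exact: (layout_vertex (lay n)).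
- move=> v p /wireP[[n pw]|[n [_ pc]]|[_ ->]].
  + by apply: (cell_in_box (nq n)); exact: (layout_wire (lay n) pw).
  + exact: connector_in_box (nq n) pc.
  + exact: corner_in_box.
- move=> v e vR bR; have v0 : v != [::] by case/and3P: e.
  case: (cases vR) => [vM|[n a]].
    rewrite (phiM vM); case: (cases bR) => [bM|[m b]].
      by rewrite (phiM bM); apply/conn_refl/wireM; rewrite /main e vM orbT.
    by apply/conn_sym; [exact: grid_adj_sym | apply: exit_bot b => //; apply: contraL vM; apply: L_M].
  case: (boolP (in_region (L n) (behead v))) => b.
    rewrite (phiL a) (phiL b); apply: conn_sub (layout_inner (lay n) e a b); exact: wireL.
  (* The parent of [v] lies in [R], so [v] is not the top of [R]; hence an edge that leaves a piece
     upwards inside [R] ends at a cut vertex. *)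
  case: (split_top (LsP n) v0 a b) => [vx|bM]; last by rewrite (phiM bM); apply: exit_top b.
  case/andP: bR => /size_suffix + _; rewrite -vx size_behead.
  by case: (v) v0 => //= i u _; rewrite ltnn.
- move=> v e vR bR; case: (cases vR) => [vM|[n a]].
    by rewrite (phiM vM); apply/conn_refl/wireM; rewrite /main /bd e vR (negPf bR).
  by apply: exit_top (a) _ => //; apply: contra bR; apply: L_R.
- move=> v e vR bR; case: (cases bR) => [bM|[n b]].
    by rewrite (phiM bM); apply/conn_refl/wireM; rewrite /main /bd e bR (negPf vR).
  by apply: exit_bot (b) => //; apply: contra vR; apply: L_R.
(* Inside a cell only wires already counted by its own layout occur: a connector meets the cell in
   its corner at most, where the inner wire of the same edge ends. Outside the cells only the edges
   handled at this level pass. *)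
- move=> p; case: (pickP (fun n : 'I_r => in_box (cell h z n) h p)) => [n pn|pn].
    apply: leq_trans (layout_congestion (lay n) p); apply: sub_count => v.
    case/wireP => [[m pw]|[m [b pc]]|[_ pz]].
    + suff -> : n = m by [].
      by apply/val_inj/(cell_disjoint pn); exact: (layout_wire (lay m) pw).
    + case: (connector_cell pc pn) => /val_inj mn ->; rewrite -mn.
      have [e] := andP b; case: (boolP (in_region (L m) v)) => /= a b'.
        by case: (conn_mem (layout_top (lay m) e a b')).
      by case: (conn_mem (layout_bot (lay m) e a b')).
    + by move: pn; rewrite pz (negPf (z_off n)).
  apply: leq_trans local_count; apply: sub_count => v.
  case/wireP => [[m pw]|[m [b pc]]|[-> //]].
    by have := pn m; rewrite (layout_wire (lay m) pw).
  by apply/orP; right; apply/existsP; exists m.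
- move=> p; case: (pickP (fun n : 'I_r => in_box (cell h z n) h p)) => [n pn|pn].
    apply: leq_trans (layout_mult (lay n) p); rewrite -!size_filter.
    apply: uniq_leq_size; first exact: filter_uniq.
    move=> v; rewrite !mem_filter => /andP[/andP[vR /eqP vp] vU]; rewrite vU andbT.
    case: (cases vR) => [vM|[m a]].
      by move: pn; rewrite -vp phiM // (negPf (z_off n)).
    have mb := layout_vertex (lay m) vU a; rewrite -(phiL a) vp in mb.
    have mn : n = m by apply/val_inj; exact: cell_disjoint pn mb.
    by rewrite mn a -(phiL a) vp eqxx.
  apply: (@leq_trans (size M)); last by move: sM; rewrite /k /Q; lia.
  rewrite -size_filter; apply: uniq_leq_size; first exact: filter_uniq.
  move=> v; rewrite mem_filter => /andP[/andP[vR /eqP vp] vU].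
  case: (cases vR) => [//|[m a]]; have := layout_vertex (lay m) vU a.
  by rewrite -(phiL a) vp pn.
- pose T := \sum_(n < r) \sum_(v <- U) size (w n v).
  pose c := \sum_(n < r) cnt (L n).
  have cR : c <= cnt R.
    rewrite /c /cnt -count_sum (countE (in_region R)); apply: leq_sum => u _.
    by rewrite -(split_sum u) count_L leq_addl.
  have TC : 2 ^ h * T + 2 * C * c <= 2 ^ h.+1 * C * c.
    rewrite /T /c !big_distrr -big_split; apply: leq_sum => n _.
    exact: layout_length (lay n).
  have X : \sum_(v <- U) size (wire v) <= T + (r * (2 * (3 * side h.+1)) + k).
    apply: (@leq_trans (\sum_(v <- U) (\sum_(n < r) size (w n v)
        + \sum_(n < r) bd (L n) v * (3 * side h.+1) + main v))).
      apply: leq_sum => v _; rewrite size_cat; apply: leq_add; last by case: (main v).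
      rewrite size_flatten /shape -map_comp sumnE big_map big_enum -big_split /=.
      apply: leq_sum => n _; rewrite size_cat leq_add2l; case: (bd _ _) => //.
      by rewrite mul1n; apply: size_connector.
    rewrite !big_split /= -addnA; apply: leq_add.
      by rewrite exchange_big.
    apply: leq_add; last first.
      by rewrite -countE (leq_trans main_count) // /k; move: (q ^ 2) => a; lia.
    rewrite exchange_big /= -[r in X in _ <= X]card_ord -sum_nat_const; apply: leq_sum => n _.
    by rewrite -big_distrl leq_mul2r -countE boundary_le2 orbT.
  have D : r * (2 * (3 * side h.+1)) + k <= (18 * q ^ 2 + k) * q ^ h.+1.
    rewrite mulnDl; apply: leq_add; last by rewrite leq_pmulr // expn_gt0.
    have := leq_mul sL (leq_mul (leqnn 6) (leq_trans (leq_addr _ _) (side_le h.+1))).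
    rewrite -/r; move: (side h.+1) (q ^ 2) (q ^ h.+1) => a b d; lia.
  (* By [Q = 2 * q] the powers combine to [Q ^ h.+1], and [big] bounds [Q ^ h] by the number of
     vertices. The new length thus fits into the slack gained from [h] to [h + 1]. *)
  have G : 2 ^ h.+1 * ((18 * q ^ 2 + k) * q ^ h.+1) <= C * cnt R.
    rewrite mulnCA -expnMn /C -mulnA leq_mul2l; apply/orP; right.
    by rewrite -[2 * q]/Q expnS leq_mul2l big orbT.
  have F : 2 ^ h.+1 * (r * (2 * (3 * side h.+1)) + k) <= C * cnt R.
    by apply: leq_trans G; rewrite leq_mul2l D orbT.
  have X' := leq_mul (leqnn (2 ^ h.+1)) X; rewrite mulnDr in X'.
  apply: (@leq_trans (2 ^ h.+1 * T + C * cnt R + 2 * C * cnt R)).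
    by rewrite leq_add2r; apply: leq_trans X' _; rewrite leq_add2l.
  have [d eC] : exists d, 2 ^ h * C = C + d.
    by exists (2 ^ h * C - C); rewrite subnKC // leq_pmull // expn_gt0.
  have Cc : d * c <= d * cnt R by rewrite leq_mul2l cR orbT.
  have e1 x : 2 ^ h.+1 * C * x = 2 * (C * x + d * x).
    by rewrite expnS -(mulnA 2 (2 ^ h) C) eC -mulnA mulnDl.
  have e2 x : 2 ^ h.+2 * C * x = 2 * (2 * (C * x + d * x)).
    by rewrite [2 ^ h.+2]expnS -(mulnA 2 (2 ^ h.+1) C) -(mulnA 2 (2 ^ h.+1 * C)) e1.
  move: TC; rewrite e1 e2.
  rewrite -(mulnA 2 C c) -(mulnA 2 C (cnt R)) expnS -(mulnA 2 (2 ^ h) T).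
  move: (C * c) (C * cnt R) (d * c) (d * cnt R) (2 ^ h * T) Cc; lia.
Qed.
End Step.

Lemma layout_exists h R z : valid_region R -> cnt R < Q ^ h ->
  exists phi W, layout h R z phi W.
Proof.
elim: h R z => [|h IH] R z vR cR.
  by apply: layout_empty; move: cR; rewrite expn0 ltnS leqn0 => /eqP.
have [lt|big] := ltnP (cnt R) (Q ^ h).
  by have [phi [W H]] := IH R z vR lt; exists phi, W; apply: layout_widen.
have t0 : 0 < Q ^ h by rewrite expn_gt0.
case: R vR cR big => x oy vR cR big.
have [M [Ls [[uM cM sL] LsP E top]]] := split_region U t0 vR.
have sM : size M <= 2 * Q.
  rewrite -ltnS -(ltn_pmul2r t0); apply: leq_ltn_trans cM _.
  rewrite -[(2 * Q).+1]addn1 mulnDl mul1n ltn_add2r -mulnA -expnS ltn_pmul2l //.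
have sL' : size Ls <= q ^ 2.
  by apply: leq_trans sL _; move: sM; rewrite /Q /q; lia.
pose L (n : 'I_(size Ls)) := tnth (in_tuple Ls) n.
have /fin_all_exists[f] n : exists F : (addr -> nat * nat) * (addr -> seq (nat * nat)),
    layout h (L n) (cell h z n) F.1 F.2.
  have [vL cL] := LsP (L n) (mem_tnth _ _).
  by have [phi [W H]] := IH (L n) (cell h z n) vL cL; exists (phi, W).
move=> lay.
have H := @layout_step h (x, oy) z M Ls uM sM sL' E top (fun n => (f n).1) (fun n => (f n).2) lay big.
by do 2![eexists]; apply: H.
Qed.
End Layout.

Theorem grid_routable : exists k C, routable grid_adj k C.
Proof.
do 2![eexists] => U uU.
have [h hU] : exists h, count (in_region ([::], None)) U < 26 ^ h.
  by exists (size U); apply: leq_ltn_trans (count_size _ _) (ltn_expl _ _).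
have inT v : in_region ([::], None) v by rewrite /in_region suffix0s.
have [phi [W [lv lw li lt lb lc lm ll]]] := layout_exists uU (0, 0) (R := ([::], None)) I hU.
exists phi, W; split.
- by move=> i v ivU vU; apply: li => //; rewrite /has_edge ivU.
- by move=> g; apply: leq_trans (lm g); apply: sub_count => v /= ->; rewrite inT.
- exact: lc.
- rewrite -(leq_pmul2l (_ : 0 < 2 ^ h)) ?expn_gt0 //.
  apply: leq_trans (leq_trans (leq_addr _ _) ll) _.
  rewrite (eq_count (a2 := predT)) // count_predT expnSr -(mulnA (2 ^ h) 2) -(mulnA (2 ^ h)).
  by rewrite leq_mul2l; apply/orP; right; exact: leqnn.
Qed.

Local Open Scope classical_set_scope.
Local Open Scope group_scope.

(** * Groups modulo a normal subgroup *)

Lemma seq_choice (T U : eqType) (P : T -> U -> Prop) (s : seq T) :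
  (forall x, x \in s -> exists y, P x y) ->
  exists r : seq U, (forall y, y \in r -> exists2 x, x \in s & P x y) /\
    forall x, x \in s -> exists2 y, y \in r & P x y.
Proof.
elim: s => [|x s IH] h; first by exists [::].
have [y Pxy] := h x (mem_head _ _).
have [|r [r1 r2]] := IH; first by move=> z zs; apply: h; rewrite inE zs orbT.
exists (y :: r); split=> z; rewrite inE => /orP[/eqP->|zr].
- by exists x; rewrite ?mem_head.
- by have [w ws Pw] := r1 z zr; exists w; rewrite // inE ws orbT.
- by exists y; rewrite ?mem_head.
- by have [w ws Pw] := r2 z zr; exists w; rewrite // inE ws orbT.
Qed.

Section Subgroups.
Variable G : groupType.
Implicit Types (x y z t : G) (A H K L M : set G).

Definition subgrp H : Prop :=
  [/\ H 1, forall x y, H x -> H y -> H (x * y) & forall x, H x -> H x^-1].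

Definition normalizes A M : Prop := forall m a, M m -> A a -> M (m ^ a).

Definition spans A H : Prop := forall L, subgrp L -> A `<=` L -> H `<=` L.

Definition span A : set G := [set x | forall L, subgrp L -> A `<=` L -> L x].

Definition prodset A M : set G := [set x | exists2 a, A a & M (a^-1 * x)].

(** Integer powers: one natural exponent for each sign makes closure under products and inverses
    immediate. *)
Definition cyc t : set G := [set x | exists m n : nat, x = t ^+ m * t ^- n].

Lemma subgrp1 H : subgrp H -> H 1. Proof. by case. Qed.

Lemma subgrpM H x y : subgrp H -> H x -> H y -> H (x * y).
Proof. by case=> _ + _; apply. Qed.

Lemma subgrpV H x : subgrp H -> H x -> H x^-1.
Proof. by case=> _ _; apply. Qed.

Lemma subgrpX H x n : subgrp H -> H x -> H (x ^+ n).
Proof.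
move=> sH Hx; elim: n => [|n IH]; first exact: subgrp1.
by rewrite expgS; apply: subgrpM.
Qed.

Lemma subgrpJ H x y : subgrp H -> H x -> H y -> H (x ^ y).
Proof. by move=> sH Hx Hy; do !apply: subgrpM => //; apply: subgrpV. Qed.

Lemma subgrpMl H x y : subgrp H -> H x -> H (x * y) -> H y.
Proof. by move=> sH Hx Hxy; rewrite -(mulKg x y); apply: subgrpM => //; apply: subgrpV. Qed.

Lemma subgrpMr H x y : subgrp H -> H y -> H (x * y) -> H x.
Proof. by move=> sH Hx Hxy; rewrite -(mulgK y x); apply: subgrpM => //; apply: subgrpV. Qed.

Lemma subgrpI H K : subgrp H -> subgrp K -> subgrp (H `&` K).
Proof.
move=> [h1 hM hV] [k1 kM kV]; split=> //.
- by move=> x y [? ?] [? ?]; split; auto.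
- by move=> x [? ?]; split; auto.
Qed.

Lemma subgrpT : subgrp setT. Proof. by []. Qed.

Lemma subgrp_span A : subgrp (span A).
Proof.
split.
- by move=> L [].
- by move=> x y hx hy L sL AL; apply: subgrpM => //; [apply: hx | apply: hy].
- by move=> x hx L sL AL; apply: subgrpV => //; apply: hx.
Qed.

Lemma sub_span A : A `<=` span A.
Proof. by move=> x Ax L _; apply. Qed.

Lemma subgrp_conj L z : subgrp L -> subgrp [set x | L (x ^ z)].
Proof.
move=> sL; split => /= [|x y hx hy|x hx]; rewrite ?conj1g ?conjMg ?conjVg.
- exact: subgrp1.
- exact: subgrpM.
- exact: subgrpV.
Qed.

Lemma subgrp_cyc t : subgrp (cyc t).
Proof.
have c m n : commute (t ^+ m) (t ^- n) by apply/commuteV/commuteX2.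
split.
- by exists 0, 0; rewrite expg0 invg1 mulg1.
- move=> x y [m [n ->]] [m' [n' ->]]; exists (m + m'), (n + n').
  rewrite [n + n']addnC !expgnDr invgM -!mulgA; congr (_ * _).
  by rewrite !mulgA; congr (_ * _); exact/esym/c.
- by move=> x [m [n ->]]; exists n, m; rewrite invgM invgK.
Qed.

Lemma cyc_gen t : cyc t t.
Proof. by exists 1%N, 0; rewrite expg0 invg1 mulg1. Qed.

Lemma cycP t x : cyc t x -> exists n, x = t ^+ n \/ x = t ^- n.
Proof.
move=> [m [n ->]]; have [mn|nm] := leqP n m.
  by exists (m - n); left; rewrite expgnFr.
exists (n - m); right; rewrite expgnFr 1?ltnW // invgM invgK.
by [].
Qed.

Lemma cyc_sub t H : subgrp H -> H t -> cyc t `<=` H.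
Proof.
move=> sH Ht x [m [n ->]]; apply: subgrpM => //; first exact: subgrpX.
by apply: subgrpV => //; apply: subgrpX.
Qed.

Lemma subgrp_prodset A M : subgrp A -> subgrp M -> normalizes A M ->
  subgrp (prodset A M).
Proof.
move=> sA sM nM; split.
- by exists 1; [apply: subgrp1 | rewrite mulg1 invg1; apply: subgrp1].
- move=> x y [a Aa Mx] [b Ab My]; exists (a * b); first exact: subgrpM.
  have -> : (a * b)^-1 * (x * y) = (a^-1 * x) ^ b * (b^-1 * y) by rewrite /conjg !gnorm.
  by apply: subgrpM => //; apply: nM.
- move=> x [a Aa Mx]; exists a^-1; first exact: subgrpV.
  have -> : a^-1^-1 * x^-1 = ((a^-1 * x)^-1) ^ a^-1 by rewrite /conjg !gnorm.
  by apply: nM; apply: subgrpV.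
Qed.

Lemma prodset_l A M : subgrp M -> A `<=` prodset A M.
Proof. by move=> sM a Aa; exists a => //; rewrite mulVg; apply: subgrp1. Qed.

Lemma prodset_r A M : subgrp A -> M `<=` prodset A M.
Proof. by move=> sA m Mm; exists 1; [apply: subgrp1 | rewrite invg1 mul1g]. Qed.

Lemma prodset_sub A M H : subgrp H -> A `<=` H -> M `<=` H -> prodset A M `<=` H.
Proof. by move=> sH AH MH x [a /AH Ha /MH Hx]; rewrite -(mulVKg a x); apply: subgrpM. Qed.

(* A pair (H, M) with M normal in H stands for the quotient group H / M. *)

Definition fin_gen H M : Prop := exists F : seq G,
  (forall x, x \in F -> H x) /\ spans ([set x | x \in F] `|` M) H.

Fixpoint word (a b : G) (u : seq bool) : G :=
  if u is c :: u' then (if c then a else b) * word a b u' else 1.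

(** A free semigroup of rank 2 in [H / M]. Positive words suffice to plant a ternary tree, and it is
    coincidences of positive words that Milnor's argument exploits. *)
Definition free_mod H M : Prop := exists a b,
  [/\ H a, H b & forall u v, M ((word a b u)^-1 * word a b v) -> u = v].

Definition fin_quot H K : Prop := exists F : seq G,
  (forall x, x \in F -> H x) /\ forall x, H x -> exists2 f, f \in F & K (f^-1 * x).

Definition cyc_quot H K : Prop := exists t, H t /\ spans ([set t] `|` K) H.

(** A subnormal series from [H] down to [M] with finite or cyclic factors. It is peeled from the top
    because [kernel_fin_gen] passes finite generation down one factor at a time. *)
Inductive polyfc : set G -> set G -> Prop :=
| polyfc_refl H : polyfc H H
| polyfc_step H K M : subgrp K -> K `<=` H -> normalizes H K ->
    fin_quot H K \/ cyc_quot H K -> polyfc K M -> polyfc H M.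

Lemma polyfc_sub H M : polyfc H M -> M `<=` H.
Proof. by elim=> [H0 x //|H0 K M0 _ KH _ _ _ MK]; apply: subset_trans KH. Qed.

Lemma polyfc_trans H K M : polyfc H K -> polyfc K M -> polyfc H M.
Proof. by move=> p; elim: p => // H0 H1 K0 s1 H1H n1 q _ IH pM; apply: polyfc_step (IH pM). Qed.

Lemma word_mem H a b u : subgrp H -> H a -> H b -> H (word a b u).
Proof.
move=> sH Ha Hb; elim: u => [|c u IH] /=; first exact: subgrp1.
by apply: subgrpM => //; case: c.
Qed.

Lemma cyc_quotE H K t : subgrp H -> subgrp K -> K `<=` H -> normalizes H K ->
  H t -> spans ([set t] `|` K) H -> H `<=` prodset (cyc t) K.
Proof.
move=> sH sK KH nK Ht; apply.
  apply: subgrp_prodset => //; first exact: subgrp_cyc.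
  by move=> m a Km /(cyc_sub sH Ht); apply: nK.
move=> x [->|Kx]; first by apply: prodset_l => //; exact: cyc_gen.
by apply: prodset_r => //; exact: subgrp_cyc.
Qed.

Lemma torsion_quot H K t n : subgrp H -> subgrp K -> K `<=` H -> normalizes H K ->
  H t -> spans ([set t] `|` K) H -> 0 < n -> K (t ^+ n) -> fin_quot H K.
Proof.
move=> sH sK KH nK Ht sp n0 Ktn; exists [seq t ^+ i | i <- iota 0 n]; split.
  by move=> x /mapP[i _ ->]; apply: subgrpX.
move=> x /(cyc_quotE sH sK KH nK Ht sp)[s [a [b ->]] Kx].
have Kc c : exists2 f, f \in [seq t ^+ i | i <- iota 0 n] & K (f^-1 * t ^+ c).
  exists (t ^+ (c %% n)); first by apply/map_f; rewrite mem_iota /= ltn_mod.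
  rewrite {2}(divn_eq c n) addnC expgnDr mulKg mulnC expgnA; exact: subgrpX.
(* Modulo [n], the exponent [n.-1 * b] replaces the negative exponent in [t ^- b]. *)
have [f fF Kf] := Kc (a + n.-1 * b)%N; exists f => //.
have -> : f^-1 * x = f^-1 * t ^+ (a + n.-1 * b)%N * (((t ^+ n) ^+ b)^-1 * ((t ^+ a * t ^- b)^-1 * x)).
  have -> : ((t ^+ n) ^+ b)^-1 = t ^- (n.-1 * b)%N * t ^- b.
    by rewrite -invgM -expgnDr -expgnA -mulSn prednK.
  by rewrite expgnDr !gnorm.
by apply: subgrpM => //; apply: subgrpM => //; apply: subgrpV => //; apply: subgrpX.
Qed.

(** * Finite generation of kernels, after Schreier and Milnor *)

Section Kernel.
Variables (H K M : set G).
Hypotheses (sH : subgrp H) (sK : subgrp K) (sM : subgrp M).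
Hypotheses (MK : M `<=` K) (KH : K `<=` H).
Hypotheses (nK : normalizes H K) (nM : normalizes H M).

(** Schreier's lemma. The list [T] covers the cosets without distinguished representatives, so every
    product [t'^-1 * x * t] that lies in [K] is taken as a generator, and so is every element of [T]
    in [K]. *)
Lemma schreier : fin_gen H M -> fin_quot H K -> fin_gen K M.
Proof.
move=> [X [XH spX]] [T [TH cov]].
pose X' := X ++ [seq x^-1 | x <- X].
pose Y := [seq x <- 1 :: T ++ [seq t'^-1 * p.1 * p.2 | t' <- T, p <- [seq (x, t) | x <- X', t <- T]] | `[< K x >]].
exists Y; split; first by move=> x; rewrite mem_filter => /andP[/asboolP].
move=> L0 sL0 YL0.
have mY x : K x -> x \in T ++ [seq t'^-1 * p.1 * p.2 | t' <- T, p <- [seq (x, t) | x <- X', t <- T]] -> L0 x.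
  move=> Kx xT; apply: YL0; left; rewrite /= mem_filter inE xT orbT andbT; exact/asboolP.
have mM x : M x -> L0 x by move=> Mx; apply: YL0; right.
pose L := K `&` L0; have sL : subgrp L by apply: subgrpI.
(* This union of cosets of [L] contains 1 and is stable under left multiplication by the generators
   of [H], hence it contains [H]. *)
pose TL := [set x | exists2 t, t \in T & L (t^-1 * x)].
have step x : x \in X' -> forall g, TL g -> TL (x * g).
  move=> xX g [t tT Lg].
  have Hx : H x.
    by move: xX; rewrite mem_cat => /orP[/XH|/mapP[x' /XH + ->]] // => h; apply: subgrpV.
  have [|t' t'T Kt'] := cov (x * t); first by apply: subgrpM => //; exact: TH.
  exists t' => //; have -> : t'^-1 * (x * g) = (t'^-1 * x * t) * (t^-1 * g) by rewrite !gnorm.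
  apply: subgrpM => //; rewrite mulgA in Kt'; split=> //; apply: mY => //.
  rewrite mem_cat; apply/orP; right; apply/allpairsP; exists (t', (x, t)); split=> //.
  by apply/allpairsP; exists (x, t).
have stepM m : M m -> forall g, TL g -> TL (m * g).
  move=> Mm g [t tT Lg]; exists t => //.
  have -> : t^-1 * (m * g) = m ^ t * (t^-1 * g) by rewrite /conjg !gnorm.
  have Mmt : M (m ^ t) by apply: nM => //; exact: TH.
  by apply: subgrpM => //; split; [exact: MK | exact: mM].
pose N := [set h | (forall g, TL g -> TL (h * g)) /\ (forall g, TL g -> TL (h^-1 * g))].
have sN : subgrp N.
  split=> /=.
  - by split=> g; rewrite ?invg1 mul1g.
  - move=> x y [x1 x2] [y1 y2]; split=> g Tg; first by rewrite -mulgA; auto.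
    by rewrite invgM -mulgA; auto.
  - by move=> x [x1 x2]; split=> // g; rewrite invgK; auto.
have HN : H `<=` N.
  apply: spX => // x [xX|Mx].
    split; apply: step; first by rewrite mem_cat xX.
    by rewrite mem_cat (map_f (fun x => x^-1)) ?orbT.
  by split; apply: stepM => //; apply: subgrpV.
have T1 : TL 1.
  have [t tT Kt] := cov 1 (subgrp1 sH); exists t => //.
  rewrite mulg1 in Kt *; apply: (subgrpV sL).
  have {}Kt : K t by rewrite -(invgK t); apply: subgrpV.
  by split=> //; apply: mY => //; rewrite mem_cat tT.
move=> x Kx; have [/(_ 1 T1) + _] := HN x (KH Kx); rewrite mulg1 => -[t tT [Ktx Ltx]].
rewrite -(mulVKg t x); apply: subgrpM => //; apply: mY; last by rewrite mem_cat tT.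
by rewrite -(invgK t); apply: subgrpV => //; apply: subgrpMr Ktx.
Qed.

Hypothesis nf : ~ free_mod H M.

(** Moving every [t] to the right turns a positive word in [t * y] and [t] into a product of
    conjugates [y ^ (t ^- j)] followed by a power of [t]. *)
Lemma word_conj (t y : G) L u : subgrp L ->
  (forall j, 0 < j <= size u -> L (y ^ (t ^- j))) ->
  L (word (t * y) t u * t ^- size u).
Proof.
elim: u L => [|c u IH] L sL hL /=; first by rewrite invg1 mulg1; apply: subgrp1.
have -> : (if c then t * y else t) * word (t * y) t u * t ^- (size u).+1 =
   (if c then y else 1) ^ (t ^- 1) * (word (t * y) t u * t ^- size u) ^ (t ^- 1).
  by rewrite /conjg expg1 expgS; case: (c); rewrite !gnorm.
apply: subgrpM => //.
  by case: (c); [apply: hL | rewrite conj1g; apply: subgrp1].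
apply: (IH [set x | L (x ^ (t ^- 1))]); first exact: subgrp_conj.
move=> j /andP[j0 ju] /=; rewrite -conjgM -invgM -expgnDr add1n.
by apply: hL.
Qed.

(* Two positive words in t y and t that agree modulo M express y through its
   conjugates by positive powers of t. *)
Lemma conj_rel t y : H t -> K y -> (forall n, K (t ^+ n) -> n = 0) ->
  exists l, forall L, subgrp L -> M `<=` L ->
    (forall j, 0 < j <= l -> L (y ^ (t ^- j))) -> L y.
Proof.
move=> Ht Ky tK.
have [u [v [uv Muv]]] : exists u v, u <> v /\ M ((word (t * y) t u)^-1 * word (t * y) t v).
  apply: contrapT => h; apply: nf; exists (t * y), t; split=> //.
    by apply: subgrpM => //; apply: KH.
  by move=> u v Muv; apply: contrapT => uv; apply: h; exists u, v.
have Hw u' : H (word (t * y) t u').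
  by apply: word_mem => //; apply: subgrpM => //; exact: KH.
have Kw u' : K (word (t * y) t u' * t ^- size u').
  apply: word_conj => // j _; apply: nK => //; apply: subgrpV => //; exact: subgrpX.
(* Modulo [K] the two words are powers of [t] with their lengths as exponents, and [t] has infinite
   order there. *)
have suv : size u = size v.
  have : K (t ^+ size v * t ^- size u).
    have -> : t ^+ size v * t ^- size u = (word (t * y) t v * t ^- size v)^-1 *
       (((word (t * y) t u)^-1 * word (t * y) t v) ^ (word (t * y) t u)^-1) *
       (word (t * y) t u * t ^- size u) by rewrite /conjg !gnorm.
    apply: subgrpM => //; apply: subgrpM => //; first by apply: subgrpV => //; exact: Kw.
    by apply: nK; [exact: MK | apply: subgrpV => //; exact: Hw].
  have [le|lt] := leqP (size u) (size v).
    by rewrite -expgnFr // => /tK/eqP; rewrite subn_eq0 => vu; apply/eqP; rewrite eqn_leq le.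
  rewrite -[X in K X]invgK => /(subgrpV sK); rewrite !invgK invgM invgK -expgnFr 1?ltnW //.
  by move/tK/eqP; rewrite subn_eq0 leqNgt lt.
elim: u v uv Muv suv => [|c u IH] [|d v] //= uv Muv [suv].
have [cd|cd] := eqVneq c d.
  rewrite cd in uv Muv *; apply: (IH v) => //; first by move=> e; apply: uv; rewrite e.
  by move: Muv; rewrite invgM !gnorm.
(* The first letters differ, so cancelling [t] isolates [y]. The remaining factor [U * V^-1] lies in
   [L] by [word_conj], since the lengths agree. *)
pose U := word (t * y) t u; pose V := word (t * y) t v.
exists (size u) => L sL ML hL.
have LUV : L (U * V^-1).
  have -> : U * V^-1 = (U * t ^- size u) * (V * t ^- size v)^-1 by rewrite suv !gnorm.
  apply: subgrpM => //; first exact: word_conj.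
  by apply: subgrpV => //; apply: word_conj; rewrite -?suv.
have Mc x : M x -> L (x ^ V^-1) by move=> Mx; apply: ML; apply: nM => //; apply: subgrpV => //; exact: Hw.
case: c d cd Muv {uv} => [] [] //= _ Muv.
  have -> : y = ((U * V^-1) * ((U^-1 * (t * y)^-1 * (t * V)) ^ V^-1))^-1.
    by rewrite /conjg !gnorm.
  by apply: subgrpV => //; apply: subgrpM => //; apply: Mc; move: Muv; rewrite !gnorm.
have -> : y = (U * V^-1) * ((U^-1 * t^-1 * (t * y * V)) ^ V^-1).
  by rewrite /conjg !gnorm.
by apply: subgrpM => //; apply: Mc; move: Muv; rewrite !gnorm.
Qed.

(** Conjugating the relation of [conj_rel] by [t ^+ j] expresses [y ^ (t ^+ j)] through conjugates
    with smaller exponents; the relation for [t^-1] does the same for negative exponents. A finite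
    window of exponents therefore yields all. *)
Lemma conj_span t y : H t -> K y -> (forall n, K (t ^+ n) -> n = 0) ->
  exists N, forall L, subgrp L -> M `<=` L ->
    (forall j, j <= N -> L (y ^ (t ^+ j)) /\ L (y ^ (t ^- j))) ->
    forall j, L (y ^ (t ^+ j)) /\ L (y ^ (t ^- j)).
Proof.
move=> Ht Ky tK.
have [l1 h1] := conj_rel Ht Ky tK.
have tVK n : K (t^-1 ^+ n) -> n = 0.
  by rewrite expVgn => /(subgrpV sK); rewrite invgK => /tK.
have [l2 h2] := conj_rel (subgrpV sH Ht) Ky tVK.
exists (maxn l1 l2) => L sL ML hL j.
have [n] := ubnP j; elim: n j => // n IH j; rewrite ltnS => jn.
have [/hL //|] := leqP j (maxn l1 l2); rewrite gtn_max => /andP[j1 j2].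
have Lc z : subgrp [set x | L (x ^ z)] by apply: subgrp_conj.
have Mc z : H z -> M `<=` [set x | L (x ^ z)].
  by move=> Hz x Mx; apply: ML; apply: nM.
split.
- apply: (h1 [set x | L (x ^ (t ^+ j))]) => //; first by apply: Mc; apply: subgrpX.
  move=> i /andP[i0 il] /=; rewrite -conjgM.
  have ij : i <= j by apply: leq_trans il (ltnW j1).
  rewrite -(subnKC ij) expgnDr mulKg; apply: (proj1 (IH _ _)).
  by apply: leq_trans jn; rewrite -subn_gt0 subKn.
- apply: (h2 [set x | L (x ^ (t ^- j))]) => //; first by apply: Mc; apply: subgrpV => //; apply: subgrpX.
  move=> i /andP[i0 il] /=; rewrite -conjgM expVgn invgK.
  have ij : i <= j by apply: leq_trans il (ltnW j2).
  rewrite -(subnK ij) expgnDr invgM mulVKg; apply: (proj2 (IH _ _)).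
  by apply: leq_trans jn; rewrite -subn_gt0 subKn.
Qed.

(** If [t] has finite order modulo [K], [schreier] applies. Otherwise each generator of [H] is a
    power of [t] times some [y] in [K]; modulo [M] the conjugates of these [y] by powers of [t]
    generate [K], and by [conj_span] finitely many suffice. *)
Lemma cyclic_kernel : fin_gen H M -> cyc_quot H K -> fin_gen K M.
Proof.
move=> fgH [t [Ht sp]].
have [tK|] := pselect (forall n, K (t ^+ n) -> n = 0); last first.
  move/existsNP => [n /not_implyP[Ktn n0]]; apply: schreier => //.
  by apply: torsion_quot Ktn => //; rewrite lt0n; apply/eqP.
case: fgH => X [XH spX].
have dec x : x \in X -> exists y, K y /\ cyc t (x * y^-1).
  move=> /XH /(cyc_quotE sH sK KH nK Ht sp)[s cs Ks]; exists (s^-1 * x); split=> //.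
  by rewrite invgM !gnorm.
have [Y [Y1 Y2]] := seq_choice dec.
have [N hN] : exists N, forall y, y \in Y -> forall L, subgrp L -> M `<=` L ->
    (forall j, j <= N -> L (y ^ (t ^+ j)) /\ L (y ^ (t ^- j))) ->
    forall j, L (y ^ (t ^+ j)) /\ L (y ^ (t ^- j)).
  have KY y : y \in Y -> K y by move=> /Y1[x _ []].
  elim: (Y) KY => [|y s IH] KY; first by exists 0.
  have [|N1 h1] := IH; first by move=> z zs; apply: KY; rewrite inE zs orbT.
  have [N2 h2] := conj_span Ht (KY y (mem_head _ _)) tK.
  exists (maxn N1 N2) => z; rewrite inE => /orP[/eqP->|zs] L sL ML hL.
    by apply: h2 => // j jN; apply: hL; rewrite leq_max jN orbT.
  by apply: (h1 z) => // j jN; apply: hL; rewrite leq_max jN.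
exists ([seq y ^ (t ^+ j) | y <- Y, j <- iota 0 N.+1] ++ [seq y ^ (t ^- j) | y <- Y, j <- iota 0 N.+1]).
split.
  move=> x; rewrite mem_cat => /orP[]/allpairsPdep[y [j [yY _ ->]]];
  have [x0 _ [Ky _]] := Y1 y yY; apply: nK => //; first exact: subgrpX.
  by apply: subgrpV => //; exact: subgrpX.
move=> L0 sL0 L0s.
(* Being normalized by [t], this part of [L0] has a product with [cyc t] that is a subgroup. The
   product contains the generators of [H], and it meets [K] only in [L] because no nontrivial power
   of [t] lies in [K]. *)
pose L := [set x | K x /\ forall s, cyc t s -> L0 (x ^ s)].
have Hc s : cyc t s -> H s by apply: cyc_sub.
have sL : subgrp L.
  split=> /=.
  - by split=> [|s _]; [exact: subgrp1|rewrite conj1g; apply: subgrp1].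
  - move=> x y [Kx x1] [Ky y1]; split; first exact: subgrpM.
    by move=> s cs; rewrite conjMg; apply: subgrpM; auto.
  - move=> x [Kx x1]; split; first exact: subgrpV.
    by move=> s cs; rewrite conjVg; apply: subgrpV; auto.
have nL : normalizes (cyc t) L.
  move=> x s [Kx x1] cs; split; first by apply: nK => //; exact: Hc.
  by move=> s' cs'; rewrite -conjgM; apply: x1; apply: subgrpM => //; exact: subgrp_cyc.
have ML : M `<=` L.
  move=> x Mx; split; first exact: MK.
  by move=> s cs; apply: L0s; right; apply: nM => //; exact: Hc.
have YL y : y \in Y -> L y.
  move=> yY; have [x0 _ [Ky _]] := Y1 y yY; split=> // s /cycP[j hj].
  have [|||a b] := hN y yY L0 _ _ _ j => //.
  - by move=> m Mm; apply: L0s; right.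
  - move=> i iN; split; apply: L0s; left; rewrite /mkset mem_cat.
      by apply/orP; left; apply/allpairsPdep; exists y, i; rewrite mem_iota.
    by apply/orP; right; apply/allpairsPdep; exists y, i; rewrite mem_iota.
  - by case: hj => ->.
have sc := subgrp_cyc t.
have HL : H `<=` prodset (cyc t) L.
  apply: spX; first exact: subgrp_prodset.
  move=> x [xX|Mx]; last by apply: prodset_r => //; exact: ML.
  have [y yY [Ky cs]] := Y2 x xX; exists (x * y^-1) => //.
  by rewrite invgM !gnorm; exact: YL.
move=> x Kx; have [s cs [Ksx Lsx]] := HL x (KH Kx).
have Ks : K s by rewrite -(invgK s); apply: subgrpV => //; apply: subgrpMr Ksx.
have s1 : s = 1.
  case: (cycP cs) Ks => n [->|->]; first by move/tK->.
  by move=> /(subgrpV sK); rewrite invgK => /tK->; rewrite invg1.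
by have := Lsx 1 (subgrp1 sc); rewrite s1 conjg1 invg1 mul1g.
Qed.

End Kernel.

Lemma kernel_fin_gen H K : polyfc H K -> forall M, subgrp H -> subgrp K -> subgrp M ->
  M `<=` K -> normalizes H M -> ~ free_mod H M -> fin_gen H M -> fin_gen K M.
Proof.
elim=> // {}H H1 {}K s1 H1H n1 q p IH M sH sK sM MK nM nf fg.
have MH1 : M `<=` H1 by apply: subset_trans MK (polyfc_sub p).
apply: IH => //.
- by move=> m a Mm /H1H; apply: nM.
- move=> [a [b [Ha Hb ab]]]; apply: nf; exists a, b; split=> //; exact: H1H.
- by case: q => q; [apply: schreier q | apply: cyclic_kernel q].
Qed.

End Subgroups.

(** * Elementary amenable groups *)

Lemma polyfc_prodset (G : groupType) (W N A B : set G) :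
  subgrp N -> normalizes W N -> polyfc A B -> A `<=` W -> subgrp A ->
  polyfc (prodset A N) (prodset B N).
Proof.
move=> sN nN; elim=> [H _ _|H K M sK KH nK q _ IH HW sH]; first exact: polyfc_refl.
have KW := subset_trans KH HW.
have nH S : S `<=` W -> normalizes S N by move=> SW m a Nm /SW; apply: nN.
have sKN : subgrp (prodset K N) by apply: subgrp_prodset => //; exact: nH.
apply: polyfc_step (IH KW sK) => //.
- by move=> x [k Kk Nx]; exists k => //; exact: KH.
- move=> x h [k Kk Nx] [h0 Hh Nh]; rewrite -(mulVKg h0 h) conjgM.
  apply: subgrpJ => //; last by apply: prodset_r.
  exists (k ^ h0); first exact: nK.
  have -> : (k ^ h0)^-1 * x ^ h0 = (k^-1 * x) ^ h0 by rewrite -conjVg -conjMg.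
  by apply: nN => //; exact: HW.
- case: q => [[F [FH cov]]|[t [Ht sp]]]; [left|right].
    exists F; split; first by move=> x xF; apply: prodset_l => //; exact: FH.
    move=> x [h Hh Nx]; have [f fF Kf] := cov h Hh; exists f => //.
    by exists (f^-1 * h) => //; rewrite !gnorm.
  exists t; split; first exact: prodset_l.
  move=> L sL tL; apply: prodset_sub => //.
    apply: sp => // x [->|Kx]; first by apply: tL; left.
    by apply: tL; right; apply: prodset_l.
  by move=> x Nx; apply: tL; right; apply: prodset_r.
Qed.

Section Morphism.
Variables (A B : groupType) (f : {multiplicative A -> B}).

Lemma mor1 : f 1 = 1.
Proof. by apply: (@mulgI _ (f 1)); rewrite -gmulfM !mulg1. Qed.

Lemma morV x : f x^-1 = (f x)^-1.
Proof. by apply: (@mulgI _ (f x)); rewrite -gmulfM !mulgV mor1. Qed.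

Lemma morJ x y : f (x ^ y) = f x ^ f y.
Proof. by rewrite /conjg !gmulfM morV. Qed.

Lemma mor_word a b u : f (word a b u) = word (f a) (f b) u.
Proof. by elim: u => [|c u IH] /=; rewrite ?mor1 // gmulfM IH; case: c. Qed.

Lemma subgrp_preim H : subgrp H -> subgrp (f @^-1` H).
Proof.
by case=> h1 hM hV; split=> /= [|x y|x]; rewrite ?mor1 ?gmulfM ?morV; auto.
Qed.

Lemma subgrp_im H : subgrp H -> subgrp (f @` H).
Proof.
case=> h1 hM hV; split=> [|_ _ [x Hx <-] [y Hy <-]|_ [x Hx <-]].
- by exists 1; rewrite ?mor1.
- by exists (x * y); [apply: hM | rewrite gmulfM].
- by exists x^-1; [apply: hV | rewrite morV].
Qed.

Lemma polyfc_im H M : polyfc H M -> polyfc (f @` H) (f @` M).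
Proof.
elim=> [{}H|{}H K {}M sK KH nK q _ IH]; first exact: polyfc_refl.
apply: polyfc_step IH; first exact: subgrp_im.
- by move=> _ [x /KH Hx <-]; exists x.
- by move=> _ _ [x Kx <-] [y Hy <-]; exists (x ^ y); [apply: nK | rewrite morJ].
- case: q => [[F [FH cov]]|[t [Ht sp]]]; [left|right].
    exists (map f F); split; first by move=> _ /mapP[x /FH Hx ->]; exists x.
    move=> _ [x Hx <-]; have [g gF Kg] := cov x Hx; exists (f g); first exact: map_f.
    by exists (g^-1 * x); rewrite // gmulfM morV.
  exists (f t); split; first by exists t.
  move=> L sL tL _ [x Hx <-]; apply: (sp (f @^-1` L)) Hx; first exact: subgrp_preim.
  by move=> y [->|Ky]; apply: tL; [left | right; exists y].
Qed.

Lemma polyfc_preim W H M : subgrp W -> polyfc H M -> subgrp H -> H `<=` f @` W ->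
  polyfc (W `&` f @^-1` H) (W `&` f @^-1` M).
Proof.
move=> sW; elim=> [{}H _ _|{}H K {}M sK KH nK q _ IH sH HW]; first exact: polyfc_refl.
have sP S : subgrp S -> subgrp (W `&` f @^-1` S).
  by move=> sS; apply: subgrpI => //; exact: subgrp_preim.
apply: polyfc_step (IH _ (subset_trans KH HW)) => //; first exact: sP.
- by move=> x [Wx Kx]; split=> //; exact: KH.
- move=> x y [Wx Kx] [Wy Hy]; split; first exact: subgrpJ.
  by rewrite /= morJ; apply: nK.
- case: q => [[F [FH cov]]|[t [Ht sp]]]; [left|right].
    have [|F' [F1 F2]] := @seq_choice _ _ (fun x y => W y /\ f y = x) F.
      by move=> x /FH /HW [y Wy <-]; exists y.
    exists F'; split.
      by move=> y /F1[x xF [Wy fy]]; split=> //; rewrite /= fy; exact: FH.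
    move=> x [Wx Hx]; have [g gF Kg] := cov (f x) Hx.
    have [y yF [Wy fy]] := F2 g gF; exists y => //; split.
      by apply: subgrpM => //; exact: subgrpV.
    by rewrite /= gmulfM morV fy.
  have [s Ws fs] := HW t Ht; exists s; split; first by split=> //=; rewrite fs.
  move=> L sL tL x [Wx Hx].
  have [l [Wl Ll] fl] : (f @` (W `&` L)) (f x).
    apply: (sp _ (subgrp_im (subgrpI sW sL))) Hx => y [->|Ky].
      by exists s => //; split=> //; apply: tL; left.
    have [k Wk fk] := HW y (KH _ Ky); exists k => //; split=> //.
    by apply: tL; right; split=> //; rewrite /= fk.
  rewrite -(mulVKg l x); apply: subgrpM => //; apply: tL; right; split.
    by apply: subgrpM => //; exact: subgrpV.
  by rewrite /= gmulfM morV fl mulVg; apply: subgrp1.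
Qed.

Lemma fin_gen_im H M : fin_gen H M -> fin_gen (f @` H) (f @` M).
Proof.
move=> [F [FH sp]]; exists (map f F); split.
  by move=> _ /mapP[x /FH Hx ->]; exists x.
move=> L sL FL _ [x Hx <-]; apply: (sp (f @^-1` L)) Hx; first exact: subgrp_preim.
move=> y [yF|My]; apply: FL; first by left; exact: map_f.
by right; exists y.
Qed.

Lemma normalizes_im H M : normalizes H M -> normalizes (f @` H) (f @` M).
Proof. by move=> nM _ _ [m Mm <-] [a Ha <-]; rewrite -morJ; exists (m ^ a) => //; exact: nM. Qed.

Lemma normalizes_preim H M : normalizes H M -> normalizes (f @^-1` H) (f @^-1` M).
Proof. by move=> nM m a /= Mm Ha; rewrite morJ; apply: nM. Qed.

End Morphism.

(* Quantifying over all sections (H, M) makes the property inherited by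
   subgroups and quotients. *)
Definition tame (G : groupType) : Prop := forall H M : set G,
  subgrp H -> subgrp M -> M `<=` H -> normalizes H M -> fin_gen H M ->
  free_mod H M \/ polyfc H M.

Lemma tame_finite (G : groupType) : finite_set [set: G] -> tame G.
Proof.
move=> /finite_seqP[s sE] H M sH sM MH nM _; right.
apply: polyfc_step (polyfc_refl M) => //; left.
exists [seq x <- s | `[< H x >]]; split; first by move=> x; rewrite mem_filter => /andP[/asboolP].
move=> x Hx; exists x; last by rewrite mulVg; apply: subgrp1.
have : [set: G] x by []. 
by rewrite mem_filter sE /= => ->; rewrite andbT; exact/asboolP.
Qed.

Lemma tame_abelian (G : groupType) : (forall x y : G, commute x y) -> tame G.
Proof.
move=> ab H M sH sM MH nM [F [FH sp]]; right.
have nab (S T : set G) : normalizes S T.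
  by move=> m a Tm _; rewrite /conjg (ab m a) mulKg.
have -> : H = span ([set x | x \in F] `|` M).
  apply/seteqP; split; first by move=> x Hx L sL FL; exact: sp FL _ Hx.
  by move=> x; apply => // y [/FH|/MH].
(* Dropping the generators one at a time gives the series; each factor is generated by the image of
   [a]. *)
elim: (F) => [|a s IH].
  suff <- : M = span ([set x | x \in [::]] `|` M) by apply: polyfc_refl.
  apply/seteqP; split; first by move=> x Mx; apply: sub_span; right.
  by move=> x; apply => // y [].
apply: polyfc_step IH => //; first exact: subgrp_span.
  move=> x hx L sL sub; apply: hx => // y [ys|My]; apply: sub; [left|by right].
  by rewrite /= inE ys orbT.
right; exists a; split; first by apply: sub_span; left; rewrite /= mem_head.
move=> L sL aL x; apply => // y [|My]; last by apply: aL; right; apply: sub_span; right.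
rewrite /= inE => /orP[/eqP->|ys]; first by apply: aL; left.
by apply: aL; right; apply: sub_span; left.
Qed.

Lemma tame_subgroup (G H : groupType) (i : {multiplicative H -> G}) :
  injective i -> tame G -> tame H.
Proof.
move=> inj tG H0 M sH sM MH nM fg.
have pK S : i @^-1` (i @` S) = S.
  apply/seteqP; split=> [x [y Sy /inj <-] //|x Sx]; by exists x.
case: (tG (i @` H0) (i @` M)) => //.
- exact: subgrp_im.
- exact: subgrp_im.
- exact: image_subset.
- exact: normalizes_im.
- exact: fin_gen_im.
- move=> [_ [_ [[a Ha <-] [b Hb <-] fr]]]; left; exists a, b; split=> // u v Muv.
  by apply: fr; exists ((word a b u)^-1 * word a b v); rewrite // gmulfM morV !mor_word.
- move=> p; right; have := @polyfc_preim _ _ i setT _ _ (subgrpT _) p (subgrp_im i sH) (image_subset i (@subsetT _ _)).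
  by rewrite !setTI !pK.
Qed.

Lemma tame_quotient (G Q : groupType) (q : {multiplicative G -> Q}) :
  range q = setT -> tame G -> tame Q.
Proof.
move=> sur tG H M sH sM MH nM [F [FH sp]].
have lift x : exists y, q y = x by have : [set: Q] x by []; rewrite -sur => -[y _ <-]; exists y.
have imK S : q @` (q @^-1` S) = S.
  apply/seteqP; split=> [_ [y Sy <-] //|x Sx]; have [y yx] := lift x.
  by exists y; rewrite /= ?yx.
case: (tG (q @^-1` H) (q @^-1` M)) => //.
- exact: subgrp_preim.
- exact: subgrp_preim.
- by move=> x; apply: MH.
- exact: normalizes_preim.
- have [|F' [F1 F2]] := @seq_choice _ _ (fun x y => q y = x) F.
    by move=> x _; exact: lift.
  exists F'; split; first by move=> y /F1[x xF yx]; rewrite /= yx; exact: FH.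
  move=> L sL FL x Hx.
  have [l Ll lx] : (q @` L) (q x).
    apply: (sp _ (subgrp_im q sL)) Hx => y [yF|My].
      by have [z zF zy] := F2 y yF; exists z => //; apply: FL; left.
    by have [z zy] := lift y; exists z => //; apply: FL; right; rewrite /= zy.
  rewrite -(mulVKg l x); apply: subgrpM => //; apply: FL; right.
  by rewrite /= gmulfM morV lx mulVg; apply: subgrp1.
- move=> [a [b [Ha Hb fr]]]; left; exists (q a), (q b); split=> // u v Muv.
  by apply: fr; rewrite /= gmulfM morV !mor_word.
- by move=> /(polyfc_im q); rewrite !imK; right.
Qed.

(** [M1] splits the section into [H / M1], a section of [Q], and [M1 / M], which comes from a
    section of [N]. Tameness of [N] needs [M1 / M] finitely generated; [kernel_fin_gen] draws this
    from the series of [H / M1] when there is no free semigroup. *)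
Lemma tame_extension (N G Q : groupType)
    (i : {multiplicative N -> G}) (q : {multiplicative G -> Q}) :
  range q = setT -> range i = q @^-1` [set 1] ->
  tame N -> tame Q -> tame G.
Proof.
move=> sur ex tN tQ H M sH sM MH nM fg.
have [fr|nf] := pselect (free_mod H M); [by left | right].
have qi n : q (i n) = 1.
  have : range i (i n) by exists n.
  by rewrite ex.
pose M1 := H `&` q @^-1` (q @` M).
have sM1 : subgrp M1 by apply: subgrpI => //; apply/subgrp_preim/subgrp_im.
have MM1 : M `<=` M1 by move=> x Mx; split; [exact: MH | exists x].
have p1 : polyfc H M1.
  have -> : H = H `&` q @^-1` (q @` H).
    by apply/seteqP; split=> [x Hx|x []//]; split=> //; exists x.
  case: (tQ (q @` H) (q @` M)) => //.
  - exact: subgrp_im.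
  - exact: subgrp_im.
  - exact: image_subset.
  - exact: normalizes_im.
  - exact: fin_gen_im.
  - move=> [_ [_ [[a Ha <-] [b Hb <-] fr]]]; exfalso; apply: nf; exists a, b; split=> // u v Muv.
    by apply: fr; exists ((word a b u)^-1 * word a b v); rewrite // gmulfM morV !mor_word.
  - by move=> p; apply: polyfc_preim => //; exact: subgrp_im.
apply: polyfc_trans (p1) _.
have [F [FM1 sp]] : fin_gen M1 M by apply: (kernel_fin_gen p1).
pose A := i @^-1` M1; pose B := i @^-1` M.
(* Each generator of [M1] is corrected by an element of [M] so that it falls into the kernel of
   [q]. *)
have [|F' [F1 F2]] := @seq_choice _ _ (fun x y => exists2 m, M m & i y = x * m^-1) F.
  move=> x /FM1[Hx [m Mm qm]].
  have [y _ yE] : range i (x * m^-1) by rewrite ex /= gmulfM morV -qm mulgV.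
  by exists y, m.
have fgA : fin_gen A B.
  exists F'; split.
    move=> y /F1[x xF [m Mm yE]]; rewrite /A /= yE.
    by apply: subgrpM => //; [exact: FM1 | apply: subgrpV => //; exact: MM1].
  move=> L sL FL x M1x.
  pose L' := i @` (A `&` L).
  have sL' : subgrp L' by apply/subgrp_im/subgrpI => //; exact: subgrp_preim.
  have nL' : normalizes L' M.
    by move=> m _ Mm [a [[Ha _] _] <-]; apply: nM.
  have [_ [a [Aa La] <-] Max] : prodset L' M (i x).
    apply: sp M1x; first exact: subgrp_prodset.
    move=> y [yF|My]; last by apply: prodset_r.
    have [z zF [m Mm zE]] := F2 y yF; exists (i z); last by rewrite zE !gnorm.
    exists z => //; split; last by apply: FL; left.
    rewrite /A /= zE; apply: subgrpM => //; first exact: FM1.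
    by apply: subgrpV => //; exact: MM1.
  rewrite -(mulVKg a x); apply: subgrpM => //; apply: FL; right.
  by rewrite /B /= gmulfM morV.
have AP : i @` A `<=` H by move=> _ [a [Ha _] <-].
case: (tN A B) => //.
- exact: subgrp_preim.
- exact: subgrp_preim.
- by move=> x; apply: MM1.
- by apply: normalizes_preim => m a Mm [Ha _]; apply: nM.
- move=> [a [b [[Ha _] [Hb _] fr]]]; exfalso; apply: nf; exists (i a), (i b); split=> // u v Muv.
  by apply: fr; rewrite /B /= gmulfM morV !mor_word.
- move=> /(polyfc_im i) p.
  have sA : subgrp (i @` A) by apply/subgrp_im/subgrp_preim.
  have := polyfc_prodset sM nM p AP sA.
  have -> : prodset (i @` A) M = M1.
    apply/seteqP; split.
      apply: prodset_sub => //; by move=> _ [a Aa <-].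
    move=> x [Hx [m Mm qm]].
    have [y _ yE] : range i (x * m^-1) by rewrite ex /= gmulfM morV -qm mulgV.
    exists (i y); last by rewrite yE !gnorm.
    exists y => //; rewrite /A /= yE; split.
      by apply: subgrpM => //; apply: subgrpV => //; exact: MH.
    by exists 1; [apply: subgrp1 | rewrite mor1 -yE qi].
  suff -> : prodset (i @` B) M = M by [].
  apply/seteqP; split; first by apply: prodset_sub => // _ [a Ba <-].
  by apply: prodset_r; apply/subgrp_im/subgrp_preim.
Qed.

(** [H0] need not lie in one member of the union, but its finitely many generators modulo [M] do; so
    [H0] is the product of its trace on that member with [M]. *)
Lemma tame_union (G : groupType) (J : Type) (H : J -> groupType)
    (i : forall j, {multiplicative H j -> G}) :
  (forall j, injective (i j)) ->
  (forall j j', exists l, range (i j) `|` range (i j') `<=` range (i l)) ->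
  \bigcup_j range (i j) = setT ->
  (forall j, tame (H j)) -> tame G.
Proof.
move=> inj dir cov tH H0 M sH sM MH nM [F [FH sp]].
have [j Fj] : exists j, forall x, x \in F -> range (i j) x.
  elim: (F) => [|x s [j IH]].
    have : [set: G] 1 by [].
    by rewrite -cov => -[j _ _]; exists j.
  have : [set: G] x by []; rewrite -cov => -[j' _ xj'].
  have [l hl] := dir j j'; exists l => y; rewrite inE => /orP[/eqP->|/IH yj]; apply: hl; by [right|left].
pose f := i j; pose A := f @^-1` H0; pose B := f @^-1` M.
have sA : subgrp A by apply: subgrp_preim.
have sB : subgrp B by apply: subgrp_preim.
have [|F' [F1 F2]] := @seq_choice _ _ (fun x y => f y = x) F.
  by move=> x /Fj[y _ yx]; exists y.
have main L : subgrp L -> (forall y, y \in F' -> L y) -> H0 `<=` prodset (f @` (A `&` L)) M.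
  move=> sL FL; apply: sp.
    apply: subgrp_prodset => //; first by apply/subgrp_im/subgrpI.
    by move=> m _ Mm [a [Ha _] <-]; apply: nM.
  move=> x [xF|Mx]; last by apply: prodset_r => //; apply/subgrp_im/subgrpI.
  apply: prodset_l => //; have [y yF yx] := F2 x xF.
  by exists y => //; split; [rewrite /A /= yx; exact: FH | exact: FL].
case: (tH j A B) => //.
- by move=> x; apply: MH.
- exact: normalizes_preim.
- exists F'; split; first by move=> y /F1[x /FH Hx yx]; rewrite /A /= yx.
  move=> L sL FL x Ax.
  have [|_ [l [Al Ll] <-] Mlx] := main L sL _ (f x) Ax.
    by move=> y yF; apply: FL; left.
  rewrite -(mulVKg l x); apply: subgrpM => //; apply: FL; right.
  by rewrite /B /= gmulfM morV.
- move=> [a [b [Ha Hb fr]]]; left; exists (f a), (f b); split=> // u v Muv.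
  by apply: fr; rewrite /B /= gmulfM morV !mor_word.
- move=> /(polyfc_im f) p; right.
  have AP : f @` A `<=` H0 by move=> _ [a Ha <-].
  have := polyfc_prodset sM nM p AP (subgrp_im f sA).
  have -> : prodset (f @` A) M = H0.
    apply/seteqP; split; first by apply: prodset_sub.
    move=> x Hx; have [|_ [a [Aa _] <-] Max] := main setT (subgrpT _) _ x Hx => //.
    by exists (f a) => //; exists a.
  suff -> : prodset (f @` B) M = M by [].
  apply/seteqP; split; first by apply: prodset_sub => // _ [a Ba <-].
  by apply: prodset_r; apply/subgrp_im.
Qed.

(** * Virtually cyclic groups and commuting pairs *)

Section Plane.
Variable G : groupType.
Implicit Types (x y z t w : G) (H K L : set G).

(* (i, j) |-> w^i t^j embeds the grid N^2 in G. *)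
Definition plane w t : Prop := commute w t /\
  forall i j i' j' : nat, w ^+ i * t ^+ j = w ^+ i' * t ^+ j' -> i = i' /\ j = j'.

Definition virt_cyc H : Prop := exists z, H z /\ fin_quot H (cyc z).

Lemma expg_cancel z m n : (forall k, z ^+ k = 1 -> k = 0) -> z ^+ m = z ^+ n -> m = n.
Proof.
move=> inf; wlog mn : m n / m <= n => [W|e].
  by case: (leqP m n) => [/W|/ltnW/W h /esym /h].
have /inf/eqP : z ^+ (n - m) = 1 by rewrite expgnFr // e mulgV.
by rewrite subn_eq0 => nm; apply/eqP; rewrite eqn_leq mn.
Qed.

(** By pigeonhole two of the powers of [x] with exponents from 0 to [size F] lie in the same coset,
    so some positive power with exponent at most [size F] lies in [cyc z]; the factorial is a
    multiple of all these exponents. *)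
Lemma common_exponent K z : subgrp K -> fin_quot K (cyc z) ->
  exists2 N, 0 < N & forall x, K x -> cyc z (x ^+ N).
Proof.
move=> sK [F [FK cov]]; exists (size F)`!; first exact: fact_gt0.
move=> x Kx.
have /fin_all_exists[g hg] (i : 'I_(size F).+1) : exists j : 'I_(size F), cyc z ((nth 1 F j)^-1 * x ^+ i).
  have [f fF zf] := cov _ (subgrpX i sK Kx).
  by move: (fF); rewrite -index_mem => lt; exists (Ordinal lt); rewrite /= nth_index.
have /injectivePn[i [j ij gij]] : ~~ injectiveb g.
  apply/negP => /injectiveP/leq_card; rewrite !card_ord; lia.
wlog lt : i j ij gij / i < j.
  move=> W; case: (ltngtP i j) => [/W|/W h|/val_inj e]; first exact.
    by apply: h; rewrite // eq_sym.
  by rewrite e eqxx in ij.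
have sc := subgrp_cyc z.
have czd : cyc z (x ^+ (j - i)).
  have := subgrpM sc (subgrpV sc (hg i)) (hg j); rewrite gij invgM !gnorm.
  have c : commute (x ^+ j) (x ^+ i) by apply: commuteX2.
  by rewrite expgnFr 1?ltnW //; rewrite (commuteV c).
have : (j - i) %| (size F)`!.
  by apply: dvdn_fact; have := ltn_ord j; lia.
case/dvdnP => c ->; rewrite mulnC expgnA; exact: subgrpX.
Qed.

Lemma virt_cyc_fin H K : fin_quot H K -> K `<=` H -> subgrp H -> virt_cyc K -> virt_cyc H.
Proof.
move=> [F [FH cov]] KH sH [z [Kz [F' [FK cov']]]]; exists z; split; first exact: KH.
exists [seq f * g | f <- F, g <- F']; split.
  by move=> x /allpairsP[[f g] [/FH Hf /FK /KH Hg ->]]; apply: subgrpM.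
move=> x /cov[f fF /cov'[g gF zx]]; exists (f * g); last by rewrite invgM -mulgA.
by apply/allpairsP; exists (f, g).
Qed.

Section Extend.
Variables (H K : set G) (t z : G).
Hypotheses (sH : subgrp H) (sK : subgrp K) (KH : K `<=` H) (nK : normalizes H K).
Hypotheses (Ht : H t) (sp : spans ([set t] `|` K) H).
Hypothesis tK : forall n, K (t ^+ n) -> n = 0.
Hypotheses (Kz : K z) (fz : fin_quot K (cyc z)).

(** If [z] has finite order, then [K] is finite, so the powers of [t] alone have finite index in
    [H]. *)
Lemma virt_cyc_torsion n : 0 < n -> z ^+ n = 1 -> virt_cyc H.
Proof.
move=> n0 zn; exists t; split=> //; case: fz => F [FK cov].
exists [seq f * z ^+ i | f <- F, i <- iota 0 n]; split.
  move=> x /allpairsPdep[f [i [/FK Kf _ ->]]]; apply: KH.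
  by apply: subgrpM => //; apply: subgrpX.
have zE x : cyc z x -> exists2 i, i < n & x = z ^+ i.
  have zm m : z ^+ m = z ^+ (m %% n).
    by rewrite {1}(divn_eq m n) expgnDr mulnC expgnA zn expg1n mul1g.
  case/cycP => m [->|->]; first by exists (m %% n); rewrite ?ltn_mod.
  exists ((n - m %% n) %% n); first by rewrite ltn_mod.
  rewrite -zm zm expgnFr; last by rewrite ltnW ?ltn_mod.
  by rewrite zn mul1g.
move=> x /(cyc_quotE sH sK KH nK Ht sp)[s cs Ks].
(* The conjugation moves the factor from [K] to the left of the power of [t], because [fin_quot]
   refers to left cosets. *)
have Kx : K ((s^-1 * x) ^ s^-1) by apply: nK => //; apply: subgrpV => //; exact: cyc_sub cs.
have [f fF /zE[i lin fi]] := cov _ Kx; exists (f * z ^+ i).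
  by apply/allpairsPdep; exists f, i; rewrite mem_iota.
have -> : (f * z ^+ i)^-1 * x = s; last by [].
by rewrite -fi /conjg !gnorm.
Qed.

(* The subgroup L of N-th powers is invariant under conjugation by t and infinite
   cyclic, so t acts on it by a sign and t^2 centralizes it. *)
Lemma plane_extend : (forall n, z ^+ n = 1 -> n = 0) -> exists w u, plane w u.
Proof.
move=> inf; have [N N0 hN] := common_exponent sK fz.
pose L := span [set x ^+ N | x in K].
have sL : subgrp L by apply: subgrp_span.
have Lz : L `<=` cyc z.
  by move=> x; apply; [exact: subgrp_cyc | move=> _ [y Ky <-]; exact: hN].
have exr : exists n, (0 < n) && `[< L (z ^+ n) >].
  by exists N; rewrite N0; apply/asboolP; apply: sub_span; exists z.
(* The least positive exponent of [z] in [L] yields a generator of [L]. *)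
case: (ex_minnP exr) => r /andP[r0 /asboolP Lr] rmin.
pose w := z ^+ r.
have infw n : w ^+ n = 1 -> n = 0.
  by rewrite -expgnA => /inf/eqP; rewrite muln_eq0 gtn_eqF //= => /eqP.
have Lw x : L x -> exists a, x = w ^+ a \/ x = w ^- a.
  move=> Lx.
  have dv k : L (z ^+ k) -> z ^+ k = w ^+ (k %/ r).
    move=> Lk; suff k0 : k %% r = 0 by rewrite -expgnA {1}(divn_eq k r) k0 addn0 mulnC.
    apply/eqP; rewrite -leqn0 leqNgt; apply/negP => k0.
    have /rmin : (0 < k %% r) && `[< L (z ^+ (k %% r)) >].
      rewrite k0; apply/asboolP; move: Lk; rewrite {1}(divn_eq k r) expgnDr.
      by apply: subgrpMl => //; rewrite mulnC expgnA; exact: (subgrpX _ sL).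
    by rewrite leqNgt ltn_mod r0.
  move: (Lx); case: (cycP (Lz _ Lx)) => k [->|->].
    by move=> /dv->; exists (k %/ r); left.
  by move=> /(subgrpV sL); rewrite invgK => /dv->; exists (k %/ r); right.
have Lc s x : H s -> L x -> L (x ^ s).
  move=> Hs Lx; apply: (Lx [set x | L (x ^ s)]); first exact: subgrp_conj.
  move=> _ [y Ky <-] /=; rewrite conjXg; apply: sub_span; exists (y ^ s) => //.
  exact: nK.
have [a ha] := Lw _ (Lc t w Ht Lr).
have [b hb] := Lw _ (Lc t^-1 w (subgrpV sH Ht) Lr).
(* Conjugating by [t^-1] and back by [t] multiplies the exponents. As [w] has infinite order,
   [a * b] must be 1. *)
have wab : w ^+ (a * b) = w \/ w ^- (a * b) = w.
  have : (w ^ t^-1) ^ t = w by rewrite -conjgM mulVg conjg1.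
  case: hb => ->; rewrite ?conjVg conjXg; case: ha => ->; rewrite ?expVgn ?invgK -expgnA; by [left|right].
have a1 : a = 1%N.
  case: wab => wab; last first.
    have /infw : w ^+ (a * b).+1 = 1 by rewrite expgS -[X in X * _]wab mulVg.
    by [].
  have := expg_cancel infw (wab : w ^+ (a * b) = w ^+ 1).
  by move/eqP; rewrite muln_eq1 => /andP[/eqP].
have cw : commute w (t ^+ 2).
  have : w ^ (t ^+ 2) = w.
    rewrite a1 expg1 in ha; rewrite expgS expg1 conjgM.
    by case: ha => e; rewrite e ?conjVg e ?invgK.
  by move=> e; rewrite /commute conjgC e.
exists w, (t ^+ 2); split=> //.
have Kw n : K (w ^+ n) by apply: subgrpX => //; apply: subgrpX.
have half i j i' j' : j <= j' -> w ^+ i * (t ^+ 2) ^+ j = w ^+ i' * (t ^+ 2) ^+ j' -> i = i' /\ j = j'.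
  move=> jj e.
  have e' : w ^+ i = w ^+ i' * (t ^+ 2) ^+ (j' - j).
    by rewrite expgnFr // mulgA -e mulgK.
  have /tK/eqP : K (t ^+ (2 * (j' - j))).
    by rewrite expgnA; apply: (@subgrpMl _ _ (w ^+ i')) => //; rewrite -e'.
  rewrite muln_eq0 /= subn_eq0 => j'j.
  have jE : j = j' by apply/eqP; rewrite eqn_leq jj.
  by split=> //; apply: (expg_cancel infw); rewrite e' jE subnn expg0 mulg1.
move=> i j i' j' e; case: (leqP j j') => [|/ltnW] jj; first exact: half e.
by have [-> ->] := half _ _ _ _ jj (esym e).
Qed.
End Extend.

(** Finite factors preserve virtual cyclicity. An infinite cyclic factor over a virtually cyclic
    kernel gives a plane if the kernel is infinite and a virtually cyclic group if it is finite. *)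
Lemma polyfc_dichotomy H M : polyfc H M -> M = [set 1] -> subgrp H ->
  virt_cyc H \/ exists w u, plane w u.
Proof.
elim=> [{}H -> _|{}H K {}M sK KH nK q _ IH M1 sH].
  left; exists 1; split=> //; exists [:: 1]; split; first by move=> x; rewrite inE => /eqP->.
  by move=> x ->; exists 1; rewrite ?mem_head // mulVg; apply: subgrp1; exact: subgrp_cyc.
case: (IH M1 sK) => [vK|]; last by right.
case: q => [q|[t [Ht sp]]]; first by left; apply: virt_cyc_fin q _ _ vK.
have [tK|] := pselect (forall n, K (t ^+ n) -> n = 0); last first.
  move/existsNP => [n /not_implyP[Ktn n0]]; left; apply: virt_cyc_fin (vK) => //.
  by apply: torsion_quot Ktn => //; rewrite lt0n; apply/eqP.
case: vK => z [Kz fz].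
have [inf|] := pselect (forall n, z ^+ n = 1 -> n = 0).
  by right; apply: (plane_extend sH sK nK Ht tK Kz fz inf).
move/existsNP => [n /not_implyP[zn n0]]; left.
apply: (virt_cyc_torsion sH sK KH nK Ht sp Kz fz _ zn).
by rewrite lt0n; apply/eqP.
Qed.
End Plane.

Lemma subgrp_is_subgroup (G : groupType) (H : set G) : subgrp H <-> is_subgroup H.
Proof.
split=> [[h1 hM hV]|[h1 hD]].
  split; first by rewrite in_setE.
  by move=> x y; rewrite !in_setE => Hx Hy; apply: hM => //; exact: hV.
have hV x : H x -> H x^-1.
  by move=> Hx; have := hD 1 x h1; rewrite !in_setE mul1g; apply.
split=> //; first by move: h1; rewrite in_setE.
move=> x y Hx Hy; have := hD x y^-1; rewrite !in_setE invgK; apply => //; exact: hV.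
Qed.

Lemma tame_elementary_amenable (G : groupType) : elementary_amenable G -> tame G.
Proof.
elim=> {G}.
- exact: tame_finite.
- exact: tame_abelian.
- by move=> G H i inj _; apply: (tame_subgroup inj).
- by move=> G Q q sur _; apply: (tame_quotient sur).
- by move=> N G Q i q _ sur ex _ tN _ tQ; apply: tame_extension ex tN tQ.
- by move=> G J H i inj dir cov _ tH; apply: tame_union dir cov tH.
Qed.

Lemma virt_cyc_virtually_cyclic (G : groupType) : @virt_cyc G setT -> virtually_cyclic G.
Proof.
move=> [z [_ [F [_ cov]]]]; exists (cyc z); split.
- exact/subgrp_is_subgroup/subgrp_cyc.
- exists z; apply/seteqP; split=> x; first exact: cycP.
  case=> n [->|->]; [exists n, 0|exists 0, n]; by rewrite expg0 ?invg1 ?mulg1 ?mul1g.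
- apply: (@sub_finite_set _ _ [set [set f * h | h in cyc z] | f in [set` F]]); last first.
    by apply: finite_image; exact: finite_seq.
  move=> _ [x _ <-]; have [f fF zf] := cov x I; exists f => //.
  apply/seteqP; split=> _ [h zh <-].
    exists (x^-1 * f * h); last by rewrite !gnorm.
    apply: subgrpM => //; first exact: subgrp_cyc.
    by rewrite -[x^-1 * f]invgK invgM invgK; apply: subgrpV => //; exact: subgrp_cyc.
  exists (f^-1 * x * h); last by rewrite !gnorm.
  by apply: subgrpM => //; exact: subgrp_cyc.
Qed.

Theorem elementary_amenable_dichotomy (G : groupType) (S : set G) :
  elementary_amenable G -> finite_set S -> generates S -> ~ virtually_cyclic G ->
  (exists a b : G, injective (word a b)) \/ exists w t : G, plane w t.
Proof.
move=> ea fS gS nv.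
have s1 : subgrp [set 1 : G].
  by split=> [//|x y -> ->|x ->]; rewrite /= ?mulg1 ?invg1.
have n1 : normalizes setT [set 1 : G] by move=> m x -> _; rewrite /= conj1g.
have fg : fin_gen setT [set 1 : G].
  case/finite_seqP: fS gS => F ->{S} gS; exists F; split=> // L sL FL x _.
  suff -> : L = setT by [].
  by apply: gS; [apply/subgrp_is_subgroup | move=> y yF; apply: FL; left].
case: (tame_elementary_amenable ea (subgrpT _) s1 (@subsetT _ _) n1 fg) => [[a [b [_ _ ab]]]|p].
- by left; exists a, b => u v e; apply: ab; rewrite e mulVg.
- right; have [v|//] := polyfc_dichotomy p (erefl _) (subgrpT _).
  by case: nv; apply: virt_cyc_virtually_cyclic.
Qed.

(** * Hall's theorem and trees in groups *)

Section Hall.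
Variables A B : eqType.
Implicit Types (N : A -> seq B) (X s t : seq A).

Definition nbh N s : seq B := undup (flatten [seq N x | x <- s]).

Lemma mem_nbh N s y : (y \in nbh N s) = has (fun x => y \in N x) s.
Proof. by rewrite mem_undup; apply/flatten_mapP/hasP => -[x xs yx]; exists x. Qed.

(** If a nonempty proper part has no surplus of neighbours, it is matched first and the rest with
    the remaining neighbours; otherwise every such part has a neighbour to spare, and one vertex may
    be matched arbitrarily. [y0] serves when [X] is empty. *)
Theorem hall (y0 : B) X N : uniq X ->
  (forall s, uniq s -> {subset s <= X} -> size s <= size (nbh N s)) ->
  exists f : A -> B, (forall x, x \in X -> f x \in N x) /\ {in X &, injective f}.
Proof.
have [n] := ubnP (size X); elim: n X N => // n IH [|x X] N /=; first by exists (fun=> y0).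
rewrite ltnS => Xn /andP[xX uX] hX.
have uxX : uniq (x :: X) by rewrite /= xX.
have [[s [us sX s0 sl tight]]|loose] := pselect (exists s,
    [/\ uniq s, {subset s <= x :: X}, s <> [::], size s < size (x :: X) & size (nbh N s) <= size s]).
- have [||f1 [f1N f1i]] := IH s N _ us.
  + exact: leq_trans sl Xn.
  + by move=> u uu us'; apply: hX => // z /us' /sX.
  pose t := [seq z <- x :: X | z \notin s].
  pose N2 z := [seq y <- N z | y \notin nbh N s].
  have ut : uniq t by apply: filter_uniq.
  have disj u : {subset u <= t} -> uniq u -> uniq (s ++ u).
    move=> ut' uu; rewrite cat_uniq us uu andbT /= -all_predC; apply/allP => z /ut'.
    by rewrite mem_filter => /andP[].
  have st : size s + size t <= size (x :: X).
    rewrite -size_cat; apply: uniq_leq_size; first exact: disj.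
    by move=> z; rewrite mem_cat => /orP[/sX//|]; rewrite mem_filter => /andP[].
  have tn : size t < n.
    by apply: leq_trans Xn; move: st s0 => /=; case: (s) => //= *; lia.
  have [|f2 [f2N f2i]] := IH t N2 tn ut.
    move=> u uu ut'; rewrite -(leq_add2l (size s)) -size_cat.
    apply: (leq_trans (hX (s ++ u) (disj u ut' uu) _)).
      by move=> z; rewrite mem_cat => /orP[/sX//|/ut']; rewrite mem_filter => /andP[].
    apply: (@leq_trans (size (nbh N s ++ nbh N2 u))); last by rewrite size_cat leq_add2r.
    apply: uniq_leq_size; first exact: undup_uniq.
    move=> y; rewrite mem_cat !mem_nbh has_cat; case: (boolP (has _ s)) => //= ys.
    case/hasP => z zu yz; apply/hasP; exists z => //.
    by rewrite mem_filter yz andbT mem_nbh.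
  have cov z : z \in x :: X -> z \notin s -> z \in t by move=> zX zs; rewrite mem_filter zs.
  have f1in z : z \in s -> f1 z \in nbh N s.
    by move=> zs; rewrite mem_nbh; apply/hasP; exists z => //; exact: f1N.
  have f2out z : z \in t -> f2 z \notin nbh N s.
    by move=> /f2N; rewrite mem_filter => /andP[].
  exists (fun z => if z \in s then f1 z else f2 z); split.
    move=> z zX; case: (boolP (z \in s)) => zs; first exact: f1N.
    by have := f2N z (cov z zX zs); rewrite mem_filter => /andP[].
  move=> z z' zX zX'; case: (boolP (z \in s)) => zs; case: (boolP (z' \in s)) => zs' e.
  + exact: f1i.
  + by have := f2out z' (cov _ zX' zs'); rewrite -e f1in.
  + by have := f2out z (cov _ zX zs); rewrite e f1in.
  + by apply: f2i => //; apply: cov.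
- have [y yx] : exists y, y \in N x.
    have : 0 < size (nbh N [:: x]) by apply: (hX [:: x]) => // z; rewrite inE => /eqP->; rewrite mem_head.
    case E: (nbh N [:: x]) => [|y l] // _; exists y.
    by have : y \in nbh N [:: x]; [rewrite E mem_head | rewrite mem_nbh /= orbF].
  pose N' z := [seq w <- N z | w != y].
  have [|f [fN fi]] := IH X N' Xn uX.
    move=> s us sX; case: (s =P [::]) => [->//|s0]; rewrite -ltnS.
    apply: (@leq_trans (size (nbh N s))).
      rewrite ltnNge; apply/negP => sN; apply: loose; exists s; split=> //.
        by move=> z /sX zX; rewrite inE zX orbT.
      by rewrite ltnS; apply: uniq_leq_size.
    apply: (@leq_trans (size (y :: nbh N' s))) => //.
    apply: uniq_leq_size; first exact: undup_uniq.
    move=> w; rewrite inE !mem_nbh; case: eqVneq => //= wy /hasP[z zs wz].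
    by apply/hasP; exists z; rewrite // mem_filter wy.
  exists (fun z => if z == x then y else f z); split.
    move=> z; rewrite inE; case: eqVneq => [->//|_ /= /fN].
    by rewrite mem_filter => /andP[].
  have fy z : z \in X -> f z != y by move=> /fN; rewrite mem_filter => /andP[].
  move=> z z'; rewrite !inE; case: eqVneq => [->|zx]; case: eqVneq => [->|zx'] //= zX zX' e.
  + by have := fy z' zX'; rewrite -e eqxx.
  + by have := fy z zX; rewrite e eqxx.
  + exact: fi.
Qed.
End Hall.

(** [K] is any finite list, not assumed to generate: this expresses bounded displacement, and
    [cayley_expand] later replaces each step by a walk in the given Cayley graph. *)
Definition kadj (G : groupType) (K : seq G) : rel G :=
  fun g h => (g^-1 * h \in K) || (h^-1 * g \in K).

Lemma routable_map (T T' : eqType) (e : rel T) (e' : rel T') (th : T -> T') k C :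
  injective th -> (forall x y, e x y -> e' (th x) (th y)) ->
  routable e k C -> routable e' k C.
Proof.
move=> inj ee r U uU; have [phi [W [h1 h2 h3 h4]]] := r U uU.
exists (th \o phi), (fun v => map th (W v)); split.
- move=> i v ivU vU; have [s [ps ls sW]] := h1 i v ivU vU; exists (map th s); split.
  + by rewrite /= path_map; apply: sub_path ps => x y; apply: ee.
  + by rewrite /= last_map ls.
  + by move=> x; rewrite /= -map_cons => /mapP[y /sW ys ->]; apply: map_f.
- move=> g; have [[p <-]|none] := pselect (exists p, th p = g).
    by apply: leq_trans (h2 p); apply: sub_count => v /= /eqP/inj->.
  by rewrite (eq_count (a2 := pred0)) ?count_pred0 // => v /=; apply/eqP => e0; apply: none; exists (phi v).
- move=> g; have [[p <-]|none] := pselect (exists p, th p = g).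
    by apply: leq_trans (h3 p); apply: sub_count => v /=; rewrite mem_map.
  rewrite (eq_count (a2 := pred0)) ?count_pred0 // => v /=; apply/negP => /mapP[p _ e0].
  by apply: none; exists p.
- by under eq_bigr => v _ do rewrite size_map.
Qed.

Lemma plane_routable (G : groupType) (w t : G) : plane w t ->
  exists k C, routable (kadj [:: w; t]) k C.
Proof.
move=> [wt inj]; have [k [C r]] := grid_routable; exists k, C.
apply: (routable_map (th := fun p : nat * nat => w ^+ p.1 * t ^+ p.2)) r.
  by move=> [i j] [i' j'] /= /inj[-> ->].
have c m n : commute (w ^+ m) (t ^+ n) by apply: commuteX2.
have s1 i j : (w ^+ i * t ^+ j)^-1 * (w ^+ i.+1 * t ^+ j) = w.
  have cj : w * t ^+ j = t ^+ j * w by have := c 1%N j; rewrite expg1.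
  by rewrite expgSr -mulgA cj !gnorm.
have s2 i j : (w ^+ i * t ^+ j)^-1 * (w ^+ i * t ^+ j.+1) = t.
  by rewrite expgSr !gnorm.
move=> [i j] [i' j'] /=; rewrite /grid_adj /kadj /= !inE.
case/orP => /andP[/eqP <- /orP[]/eqP->]; rewrite ?s1 ?s2 eqxx ?orbT //.
Qed.

(** The point [phi u] occurs only on the wires of [u] and of its three children, whence 4; a wire
    has at most two points, whence 2. The embedding may depend on the depth [D]. *)
Lemma tree_routable (G : groupType) (K : seq G) :
  (forall D, exists phi : addr -> G,
    {in [pred v : addr | size v <= D] &, injective phi} /\
    forall i v, size v < D -> (phi v)^-1 * phi (i :: v) \in K) ->
  routable (kadj K) 4 2.
Proof.
move=> h U uU; have [phi [inj step]] := h (\max_(v <- U) size v).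
pose W (v : addr) := if v is i :: u then [:: phi v; phi u] else [::].
have sU v : v \in U -> size v <= \max_(v <- U) size v by move=> vU; apply: leq_bigmax_seq.
have one g : count (fun v => phi v == g) U <= 1.
  rewrite -size_filter; case E: [seq v <- U | phi v == g] => [|v [|v' s]] //.
  have fu : uniq [seq v <- U | phi v == g] by apply: filter_uniq.
  have hv u : u \in [seq v <- U | phi v == g] -> size u <= \max_(v <- U) size v /\ phi u = g.
    by rewrite mem_filter => /andP[/eqP ? /sU].
  have [sv pv] := hv v ltac:(by rewrite E mem_head).
  have [sv' pv'] := hv v' ltac:(by rewrite E !inE eqxx orbT).
  move: fu; rewrite E /= inE negb_or (inj v v') ?eqxx //.
  by rewrite pv pv'.
exists phi, W; split.
- move=> i v ivU vU; apply: conn_step; rewrite /W ?mem_head ?inE ?eqxx ?orbT //.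
  by rewrite /kadj step ?orbT //; exact: (sU _ ivU).
- by move=> g; apply: leq_trans (one g) _.
- move=> g; have [[u [su pu]]|none] := pselect (exists u, size u <= \max_(v <- U) size v /\ phi u = g).
    apply: (@leq_trans (size (u :: [seq i :: u | i <- enum 'I_3]))); last by rewrite /= size_map size_enum_ord.
    rewrite -size_filter; apply: uniq_leq_size; first exact: filter_uniq.
    move=> v; rewrite mem_filter => /andP[gW /sU sv]; case: v gW sv => // i v; rewrite /W.
    rewrite inE => /orP[/eqP e sv|].
      by rewrite (inj (i :: v) u) ?mem_head // -e pu.
    rewrite inE => /eqP e sv; rewrite inE; apply/orP; right; apply/mapP; exists i; rewrite ?mem_enum //.
    by congr (_ :: _); apply: inj; rewrite // ?inE ?e ?pu //; apply: ltnW.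
  rewrite (eq_in_count (a2 := pred0)) ?count_pred0 // => v /sU sv; apply/negP.
  case: v sv => // i v sv; rewrite /W !inE => /orP[]/eqP e; apply: none.
    by exists (i :: v).
  by exists v; split=> //; apply: ltnW.
- rewrite -sum1_size big_distrr /=; apply: leq_sum => v _; by case: v.
Qed.

(** A prefix code: it embeds the free semigroup of rank 3 into that of rank 2. *)
Definition code3 (i : 'I_3) : seq bool :=
  match val i with 0 => [:: true; true] | 1%N => [:: true; false] | _ => [:: false] end.

Fixpoint encode (v : addr) : seq bool :=
  if v is i :: u then encode u ++ code3 i else [::].

Lemma encode_inj : injective encode.
Proof.
have cE (v : addr) : encode v = flatten (map code3 (rev v)).
  by elim: v => //= i v ->; rewrite rev_cons map_rcons flatten_rcons.
have inj (s t : addr) : flatten (map code3 s) = flatten (map code3 t) -> s = t.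
  elim: s t => [|i s IH] [|j t] //=.
  - by rewrite /code3; case: (val j) => [|[|?]].
  - by rewrite /code3; case: (val i) => [|[|?]].
  - move=> e; suff [-> /IH ->] : i = j /\ flatten (map code3 s) = flatten (map code3 t) by [].
    move: e; rewrite /code3; case: i => -[|[|[|//]]] /= ?; case: j => -[|[|[|//]]] /= ? [] // e; split=> //;
    exact: val_inj.
move=> u v; rewrite !cE => /inj /(congr1 rev); by rewrite !revK.
Qed.

Lemma word_cat (G : groupType) (a b : G) u v : word a b (u ++ v) = word a b u * word a b v.
Proof. by elim: u => [|c u IH] /=; rewrite ?mul1g // IH mulgA. Qed.

Lemma free_routable (G : groupType) (a b : G) : injective (word a b) ->
  exists K : seq G, routable (kadj K) 4 2.
Proof.
move=> inj; exists [seq word a b (code3 i) | i <- enum 'I_3]; apply: tree_routable => D.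
exists (fun v => word a b (encode v)); split.
  by move=> u v _ _ /inj/encode_inj.
by move=> i v _ /=; rewrite word_cat mulKg; apply/mapP; exists i; rewrite ?mem_enum.
Qed.

(** Three distinct children for every vertex require [3 * size F] targets; the fourth [size F],
    which is at least 1, makes up for the target 1 removed in [N]. *)
Lemma expanding_routable (G : groupType) (K : seq G) :
  (forall F : seq G, uniq F -> 4 * size F <= size (undup [seq f * k | f <- F, k <- K])) ->
  routable (kadj K) 4 2.
Proof.
move=> exp; apply: tree_routable => D.
pose ball n := iter n (fun F => F ++ [seq f * k | f <- F, k <- K]) [:: 1].
pose X := [seq (f, i) | f <- undup (ball D), i <- enum 'I_3].
(* Removing 1 from the targets keeps the root out of its own orbit. *)
pose N (p : G * 'I_3) := [seq x <- [seq p.1 * k | k <- K] | x != 1].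
have uX : uniq X by apply: allpairs_uniq; rewrite ?undup_uniq ?enum_uniq // => -[? ?] [? ?].
have [|psi [psiN psii]] := @hall _ _ (1 : G) X N uX.
  move=> s us sX; pose F := undup (map fst s).
  have sF : size s <= 3 * size F.
    have -> : (3 * size F)%N = size [seq (x, i) | x <- F, i <- enum 'I_3].
      by rewrite size_allpairs size_enum_ord mulnC.
    apply: uniq_leq_size => // -[x i] xs; apply/allpairsP; exists (x, i).
    by rewrite mem_enum mem_undup; split=> //; apply/mapP; exists (x, i).
  have [s0|s0] := posnP (size F); first by apply: leq_trans sF _; rewrite s0.
  have e4 := exp F (undup_uniq _).
  have le : size (undup [seq f * k | f <- F, k <- K]) <= size (1 :: nbh N s).
    apply: uniq_leq_size; first exact: undup_uniq.
    move=> x; rewrite mem_undup => /allpairsP[[f k] /= [fF kK ->]].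
    rewrite inE mem_nbh; case: eqVneq => //= n1.
    move: fF n1; rewrite mem_undup => /mapP[[f1 i] fs /= ->] n1.
    by apply/hasP; exists (f1, i) => //; rewrite mem_filter n1 /=; apply: map_f.
  move: (leq_trans e4 le); rewrite [size (_ :: _)]/=; move: (size (nbh N s)) (size F) sF s0 => a b; lia.
pose phi := fix phi (v : addr) : G := if v is i :: u then psi (phi u, i) else 1.
exists phi.
have mono m n : m <= n -> {subset ball m <= ball n}.
  move=> /subnKC <-; elim: (n - m) => [|d IHd]; first by rewrite addn0.
  by rewrite addnS => x /IHd xb; rewrite /= mem_cat xb.
have inX u (i : 'I_3) : phi u \in ball (size u) -> size u <= D -> (phi u, i) \in X.
  by move=> ub uD; apply/allpairsP; exists (phi u, i); rewrite mem_enum mem_undup (mono _ _ uD).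
have inb v : size v <= D -> phi v \in ball (size v).
  elim: v => [|i u IH] uD; first by rewrite mem_head.
  have uD' := ltnW uD; have := psiN _ (inX u i (IH uD') uD').
  rewrite mem_filter => /andP[_ /= /mapP[k kK pk]].
  by rewrite mem_cat; apply/orP; right; apply/allpairsP; exists (phi u, k); rewrite /= pk IH.
have psiE u (i : 'I_3) : size u < D -> exists2 k, k \in K & psi (phi u, i) = phi u * k.
  move=> /ltnW uD; have := psiN _ (inX u i (inb u uD) uD).
  by rewrite mem_filter => /andP[_ /= /mapP[k kK pk]]; exists k.
have psi1 u (i : 'I_3) : size u < D -> psi (phi u, i) != 1.
  by move=> /ltnW uD; have := psiN _ (inX u i (inb u uD) uD); rewrite mem_filter => /andP[].
split; last by move=> i v vD /=; have [k kK ->] := psiE v i vD; rewrite mulKg.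
(* By injectivity of [psi], equal values have the same parent value and the same branch, and the
   value 1 of the root is never taken by [psi]. *)
move=> v; rewrite inE; elim: v => [|i u IH] [|j w] //=; rewrite inE /= => uD wD.
- by move=> e; have := psi1 w j wD; rewrite -e eqxx.
- by move=> e; have := psi1 u i uD; rewrite e eqxx.
- have uD' := ltnW uD; have wD' := ltnW wD.
  move=> e; have [e1 ->] := psii _ _ (inX u i (inb u uD') uD') (inX w j (inb w wD') wD') e.
  by rewrite (IH w).
Qed.

Local Open Scope card_scope.

(** * Addresses in the 3-regular tree *)

Lemma card_le_seq (T : choiceType) (A : set T) n : A #<= `I_n ->
  exists s : seq T, [/\ uniq s, size s <= n & forall x, A x <-> x \in s].
Proof.
move=> An; have fA : finite_set A by apply/finite_set_leP; exists n.
exists (finmap.enum_fset (fset_set A)); split; first exact: finmap.fset_uniq.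
  exact: geq_card_fset_set.
by move=> x; rewrite -[x \in finmap.enum_fset _]/(x \in fset_set A) in_fset_set //; split=> [Ax|]; [exact/mem_set | exact: set_mem].
Qed.

Lemma card_eq_seq (T : choiceType) (A : set T) n : A #= `I_n ->
  exists s : seq T, [/\ uniq s, size s = n & forall x, A x <-> x \in s].
Proof.
move=> An; have fA : finite_set A by apply/finite_setP; exists n.
exists (finmap.enum_fset (fset_set A)); split; first exact: finmap.fset_uniq.
  exact: card_fset_set.
by move=> x; rewrite -[x \in finmap.enum_fset _]/(x \in fset_set A) in_fset_set //; split=> [Ax|]; [exact/mem_set | exact: set_mem].
Qed.

Lemma seq_card_eq (T : choiceType) (A : set T) (s : seq T) : uniq s ->
  (forall x, A x <-> x \in s) -> A #= `I_(size s).
Proof.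
move=> us As; have fA : finite_set A.
  by apply/finite_seqP; exists s; apply/seteqP; split=> x /As.
have [n An] := (finite_setP A).1 fA; have [s' [us' sn As']] := card_eq_seq An.
suff -> : size s = n by [].
rewrite -sn; apply/eqP; rewrite eqn_leq; apply/andP; split; apply: uniq_leq_size => // x.
  by move=> xs; apply/As'/As.
by move=> xs; apply/As/As'.
Qed.

Lemma seq_card_le (T : choiceType) (A : set T) (s : seq T) n :
  (forall x, A x -> x \in s) -> size s <= n -> A #<= `I_n.
Proof.
move=> As sn; have fA : finite_set A.
  by apply: (@sub_finite_set _ _ [set` s]); [move=> x /As | exact: finite_seq].
have [m Am] := (finite_setP A).1 fA; have [s' [us' sm As']] := card_eq_seq Am.
rewrite (card_le_eql Am) card_le_II -sm; apply: leq_trans sn.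
by apply: uniq_leq_size => // x /As' /As.
Qed.

Section TreePaths.
Variable X : graph.
Hypothesis acyc : graph_acyclic X.

(** If the paths part at [a], their remainders join the two next vertices without meeting [a]; a
    simple path extracted from them closes to a cycle through [a]. *)
Lemma simple_path_unique (a : vertex X) p q :
  path (@adj X) a p -> uniq (a :: p) -> path (@adj X) a q -> uniq (a :: q) ->
  last a p = last a q -> p = q.
Proof.
elim: p a q => [|x p IH] a q.
  case: q => // y q _ _ _ /= /andP[anq _] e; move: anq.
  by rewrite e mem_last.
case: q => [|y q].
  by move=> _ /= /andP[anp _] _ _ e; move: anp; rewrite -e mem_last.
move=> /= /andP[ax px] /andP[anp up] /andP[ay qy] /andP[anq uq] e.
have [xy|xy] := eqVneq x y.
  rewrite -xy in qy uq e *; congr (_ :: _).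
  by apply: IH px _ qy _ e => //; case/andP: up.
exfalso; pose S := (x :: p) ++ (y :: q).
have cxy : conn (@adj X) S x y.
  apply: (@conn_trans _ _ _ _ (last x p)).
    by exists p; split=> // z zp; rewrite mem_cat zp.
  apply: conn_sym; first exact: adj_sym.
  by exists q; split=> // z zp; rewrite mem_cat zp orbT.
case: cxy => s [ps ls sS]; case/shortenP: ps ls sS => s' ps' us' ss' ls sS.
have aS : a \notin x :: s'.
  apply/negP => aS; have : a \in S.
    apply: sS; move: aS; rewrite !inE; case: (a == x) => //= /ss' ->.
    by [].
  by rewrite mem_cat (negPf anp) (negPf anq).
have := acyc (c := a :: x :: s'); rewrite /ucycle /= ax /=.
have -> : path (@adj X) x (rcons s' a) by rewrite rcons_path ps' /= ls adj_sym.
rewrite aS -[_ && uniq s']/(uniq (x :: s')) us' => /(_ isT).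
case: s' ls {ps' us' ss' aS sS} => //= e0; move: xy; by rewrite e0 eqxx.
Qed.
End TreePaths.

(** The address records, along the simple path from a root, the index of each vertex among the three
    neighbours of its predecessor. Only the root uses all three indices, so ternary branching leaves
    room. *)
Lemma tree_address (X : graph) : infinite_regular_tree 3 X ->
  exists f : vertex X -> addr, injective f /\
    forall u v, adj u v -> (exists i, f u = i :: f v) \/ (exists i, f v = i :: f u).
Proof.
move=> [inf con acyc reg].
have [r _] : exists r : vertex X, True.
  apply: contrapT => h; apply: inf; suff -> : [set: vertex X] = set0 by exact: finite_set0.
  by apply/seteqP; split=> // x _; apply: h; exists x.
have /choice[pth pthP] (v : vertex X) : exists p, [/\ path (@adj X) r p, uniq (r :: p) & last r p = v].
  have [p [pp lp]] := con r v; case/shortenP: pp lp => p' pp' up' _ lp.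
  by exists p'.
have /choice[nb nbP] (v : vertex X) : exists s : seq (vertex X), [/\ uniq s, size s = 3 & forall w, adj v w <-> w \in s].
  by have [s [us ss sP]] := card_eq_seq (reg v); exists s; split.
pose nu v w : 'I_3 := inord (index w (nb v)).
have nu_inj v w w' : adj v w -> adj v w' -> nu v w = nu v w' -> w = w'.
  have [us ss sP] := nbP v => /sP vw /sP vw' /(congr1 (@nat_of_ord 3)).
  rewrite /nu !inordK -?ss ?index_mem // => e.
  by rewrite -(nth_index w vw) e nth_index.
pose fix enc (a : vertex X) (p : seq (vertex X)) (acc : addr) {struct p} : addr :=
  if p is x :: p1 then enc x p1 (nu a x :: acc) else acc.
have encE a p x acc : enc a (rcons p x) acc = nu (last a p) x :: enc a p acc.
  by elim: p a acc => //= y p IH a acc; rewrite IH.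
have enc_inj p q : path (@adj X) r p -> path (@adj X) r q -> enc r p [::] = enc r q [::] -> p = q.
  elim/last_ind: p q => [|p x IH] q; case/lastP: q => [|q y] //.
  - by rewrite encE.
  - by rewrite encE.
  - rewrite !rcons_path !encE => /andP[pp px] /andP[pq qy] [e1 /(IH _ pp pq) e2].
    move: e1; rewrite -e2 => /nu_inj ->; rewrite ?e2 //; by rewrite -e2.
exists (fun v => enc r (pth v) [::]); split.
  move=> u v e; have [pu _ <-] := pthP u; have [pv _ <-] := pthP v.
  by congr (last r _); apply: enc_inj.
have ext u v : adj u v -> v \notin r :: pth u -> pth v = rcons (pth u) v.
  move=> uv nv; have [pu uu lu] := pthP u; have [pv vv lv] := pthP v.
  apply: (simple_path_unique acyc) pv vv _ _ _.
  - by rewrite rcons_path pu lu.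
  - by rewrite -rcons_cons rcons_uniq nv.
  - by rewrite lv last_rcons.
(* If [v] is not on the root path of [u], it extends that path. If it is, it comes right before [u],
   since a longer rest of the path would close to a cycle with the edge. *)
move=> u v uv; have [pu uu lu] := pthP u; have [pv vv lv] := pthP v.
case: (boolP (v \in r :: pth u)) => [vin|nv]; last first.
  by right; exists (nu u v); rewrite (ext u v uv nv) encE lu.
left; exists (nu v u); suff -> : pth u = rcons (pth v) u by rewrite encE lv.
case/splitPl: vin pu uu lu => p1 p2 l1.
rewrite cat_path last_cat l1 -cat_cons cat_uniq => /andP[pp1 pp2] /and3P[up1 /hasPn dj up2] lu.
have e1 : pth v = p1 by apply: (simple_path_unique acyc) pv vv pp1 up1 _; rewrite lv l1.
rewrite e1 -cats1; congr (_ ++ _).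
case: p2 pp2 dj up2 lu => [|x [|y p2]] pp2 dj up2 lu.
- by move: uv; rewrite -lu adj_irr.
- by rewrite -lu.
- exfalso.
  have vn : v \notin x :: y :: p2.
    by apply/negP => /dj; rewrite -l1 mem_last.
  have := acyc (v :: x :: y :: p2); rewrite /ucycle /cycle rcons_path pp2 cons_uniq vn up2 lu uv.
  by move=> /(_ isT).
Qed.

(** * Walks in Cayley graphs *)

Section Cayley.
Variables (G : groupType) (S : set G).
Hypothesis gS : generates S.

Let e := @adj (cayley_graph S).
Let walk (a b : G) (p : seq G) := path e a p /\ last a p = b.

Lemma walk_translate (x a b : G) p : walk a b p -> walk (x * a) (x * b) (map (fun y => x * y) p).
Proof.
move=> [pp <-]; split; last by rewrite last_map.
rewrite path_map; apply: sub_path pp => g h; rewrite /e /= /cayley_adj => /andP[gh].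
rewrite (inj_eq (mulgI x)) gh /= !invgM.
by rewrite -!mulgA !mulKg.
Qed.

Lemma cayley_walk (g : G) : exists p, walk 1 g p.
Proof.
suff E : [set g | exists p, walk 1 g p] = setT.
  by have : [set: G] g by []; rewrite -E.
apply: gS.
- apply/subgrp_is_subgroup; split=> /=.
  + by exists [::].
  + move=> x y [p [pp lp]] [q wq]; have := walk_translate x wq; rewrite mulg1 => -[pq lq].
    exists (p ++ map (fun y => x * y) q); split; first by rewrite cat_path pp lp.
    by rewrite last_cat lp.
  + move=> x [p [pp lp]].
    have : walk x 1 (rev (belast 1 p)).
      split; last by case: p lp {pp} => [<- //|y p _]; rewrite /= rev_cons last_rcons.
      by rewrite -{1}lp rev_path (eq_path (e' := e)) // => y z; rewrite /e adj_sym.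
    by move=> /(walk_translate x^-1); rewrite mulVg mulg1 => w; eexists; exact: w.
- move=> s Ss /=; have [->|s1] := eqVneq s 1; first by exists [::].
  exists [:: s]; split=> //=; rewrite andbT /e /= /cayley_adj eq_sym s1 /=.
  by apply/asboolP; left; rewrite invg1 mul1g.
Qed.

(* [B] is a finite set large enough to contain the vertices of fixed walks
   from 1 to the elements of [K] and of a nontrivial closed walk. *)
Lemma cayley_expand (K : seq G) : (exists g : G, g != 1) ->
  exists B : seq G, B != [::] /\ forall (W : seq G) (a b : G), conn (kadj K) W a b ->
    exists w, [/\ w != [::], walk a b w &
      forall x, x \in a :: w -> has (fun c => x * c^-1 \in W) B].
Proof.
move=> [g0 g01].
have /choice[pw pwP] := cayley_walk.
have [y1 y1P] : exists y, e 1 y.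
  have [pp lp] := pwP g0; case: (pw g0) pp lp => [|y p] /=.
    by move=> _ e0; rewrite e0 eqxx in g01.
  by move=> /andP[ey _] _; exists y.
pose K2 := K ++ [seq k^-1 | k <- K].
pose B := 1 :: y1 :: flatten [seq pw k | k <- K2].
exists B; split=> // W a b [s [ps ls sW]].
pose ex := fix ex (g : G) (s : seq G) {struct s} : seq G :=
  if s is h :: s' then map (fun y => g * y) (pw (g^-1 * h)) ++ ex h s' else [::].
have K2P g h : kadj K g h -> g^-1 * h \in K2.
  rewrite /kadj mem_cat => /orP[->//|hg]; apply/orP; right; apply/mapP.
  by exists (h^-1 * g) => //; rewrite invgM invgK.
have exP g s' : path (kadj K) g s' -> walk g (last g s') (ex g s') /\
   forall x, x \in ex g s' -> exists2 y, y \in g :: s' & exists2 c, c \in B & x = y * c.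
  elim: s' g => [|h s' IH] g /=; first by [].
  case/andP => gh hs; have [[p1 l1] m1] := IH h hs.
  have [p2 l2] := walk_translate g (pwP (g^-1 * h)); rewrite mulg1 mulVKg in p2 l2.
  split; first by split; rewrite ?cat_path ?last_cat l2 ?p2.
  move=> x; rewrite mem_cat => /orP[/mapP[c cp ->]|/m1[y ys [c cB ->]]].
    exists g; first exact: mem_head.
    exists c => //; rewrite !inE; apply/orP; right; apply/orP; right.
    by apply/flatten_mapP; exists (g^-1 * h) => //; exact: K2P.
  by exists y; [rewrite inE ys orbT | exists c].
have [[pe le] me] := exP a s ps.
have ay : e a (a * y1).
  by have [] := @walk_translate a 1 y1 [:: y1] (conj _ (erefl _)); rewrite /= ?y1P // mulg1 andbT.
(* The detour from [a] to [a * y1] and back keeps the walk nonempty even for equal ends: a wiring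
   may not collapse an edge. *)
exists (a * y1 :: a :: ex a s); split=> //.
  split; last by rewrite /= le.
  by rewrite /= ay pe andbT /e adj_sym.
have aW : a \in W by apply: sW; exact: mem_head.
move=> x xw; apply/hasP.
have [->|xa] := eqVneq x a; first by exists 1; rewrite ?mem_head // invg1 mulg1.
move: xw; rewrite !inE (negPf xa) /= => /orP[/eqP->|/me[y ys [c cB ->]]].
  by exists y1; rewrite ?mulgK // !inE eqxx orbT.
by exists c; rewrite // mulgK sW.
Qed.
End Cayley.

Local Close Scope group_scope.
Local Open Scope ring_scope.
Import Order.TTheory GRing.Theory Num.Theory.
Import numFieldNormedType.Exports.

(** * Amenability *)

Definition folner (G : groupType) : Prop := forall (K : seq G) (m : nat),
  exists F : seq G, [/\ uniq F, (0 < size F)%N &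
    forall g, g \in K -> (m * count (fun x => (g * x)%g \notin F) F <= size F)%N].

Section Mean.
Variables (R : realType) (G : groupType).

Definition ratio (F : seq G) (A : set G) : R :=
  (count (fun x => `[< A x >]) F)%:R / (size F)%:R.

Lemma ratio_ge0 F A : 0 <= ratio F A.
Proof. by rewrite divr_ge0. Qed.

Lemma ratio_le1 F A : ratio F A <= 1.
Proof.
rewrite /ratio; have [->|] := posnP (size F); first by rewrite invr0 mulr0.
by move=> F0; rewrite ler_pdivrMr ?ltr0n // mul1r ler_nat count_size.
Qed.

Lemma ratioU F A B : A `&` B = set0 -> ratio F (A `|` B) = ratio F A + ratio F B.
Proof.
move=> AB; rewrite /ratio -mulrDl -natrD; congr (_%:R / _).
rewrite -count_predUI [X in (_ + X)%N](eq_count (a2 := pred0)) ?count_pred0 ?addn0.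
  by apply: eq_count => x /=; rewrite asbool_or.
move=> x /=; apply/negP => /andP[/asboolP Ax /asboolP Bx].
by have : (A `&` B) x by []; rewrite AB.
Qed.

Lemma ratio_translate F A g m : uniq F -> (0 < size F)%N ->
  (m * count (fun x => (g * x)%g \notin F) F <= size F)%N ->
  (m * count (fun x => (g^-1 * x)%g \notin F) F <= size F)%N ->
  (0 < m)%N -> `|ratio F [set (g * a)%g | a in A] - ratio F A| <= m%:R^-1.
Proof.
move=> uF F0 h1 h2 m0.
have half (h : G) (A' B' : set G) : (forall x, A' x -> B' (h * x)%g) ->
  (m * count (fun x => (h * x)%g \notin F) F <= size F)%N ->
  ratio F A' - ratio F B' <= m%:R^-1.
  move=> AB hm; rewrite lerBlDr /ratio.
  have le : (count (fun x => `[< A' x >]) F <= count (fun x => (h * x)%g \notin F) F + count (fun x => `[< B' x >]) F)%N.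
    rewrite -(size_filter (fun x => `[< B' x >])).
    apply: (@leq_trans (count (fun x => (h * x)%g \notin F) F + count (fun x => `[< A' x >] && ((h * x)%g \in F)) F)%N).
      rewrite -count_predUI; apply: leq_trans (leq_addr _ _); apply: sub_count => x /= ->.
      by rewrite orNb.
    rewrite leq_add2l -size_filter -(size_map (fun x => (h * x)%g)).
    apply: uniq_leq_size.
      by rewrite map_inj_uniq ?filter_uniq //; exact: mulgI.
    move=> _ /mapP[x + ->]; rewrite !mem_filter => /andP[/andP[/asboolP Ax hx] _].
    by rewrite hx andbT; apply/asboolP/AB.
  rewrite ler_pdivrMr ?ltr0n // mulrDl mulfVK ?pnatr_eq0 -?lt0n //.
  rewrite (@le_trans _ _ ((count (fun x => (h * x)%g \notin F) F + count (fun x => `[< B' x >]) F)%:R)) ?ler_nat //.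
  rewrite natrD lerD2r mulrC ler_pdivlMr ?ltr0n // mulrC -natrM ler_nat; exact: hm.
rewrite ler_norml; apply/andP; split.
  rewrite lerNl opprB; apply: (half g) => // x Ax; by exists x.
apply: (half g^-1%g) => // _ [x Ax <-]; by rewrite mulKg.
Qed.

(** The measure is the limit of the ratios along an ultrafilter on the pairs of [K] and [m] in which
    both eventually grow; limits exist by compactness of the unit interval. Invariance uses [g] and
    [g^-1], one for each inequality. *)
Lemma folner_amenable : folner G -> amenable R G.
Proof.
move=> fol.
have /choice[F FP] (p : seq G * nat) := fol p.1 p.2.
pose base (p : seq G * nat) := [set p' : seq G * nat | {subset p.1 <= p'.1} /\ (p.2 <= p'.2)%N].
pose D := filter_from setT base.
have pD : ProperFilter D.
  apply: filter_from_proper; last by move=> p _; exists p; split.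
  apply: filter_from_filter; first by exists ([::], 0%N).
  move=> p p' _ _; exists (p.1 ++ p'.1, maxn p.2 p'.2) => // r [rs rm]; split; split.
  - by move=> x xp; apply: rs; rewrite mem_cat xp.
  - by apply: leq_trans rm; rewrite leq_maxl.
  - by move=> x xp; apply: rs; rewrite mem_cat xp orbT.
  - by apply: leq_trans rm; rewrite leq_maxr.
have [Uf [uU DU]] := ultraFilterLemma pD.
have pU : ProperFilter Uf by exact: ultra_proper.
have /choice[mu mu_cvg] (A : set G) :
    exists l : R, 0 <= l /\ (fun p => ratio (F p) A) @ Uf --> l.
  have [|l [l01 cl]] := (@segment_compact R 0 1) ((fun p => ratio (F p) A) @ Uf) _.
    by apply: (@filterE _ Uf) => p; rewrite /= in_itv /= ratio_ge0 ratio_le1.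
  exists l; split; first by move: l01; rewrite /= in_itv /= => /andP[].
  move=> V Vl; have [//|UV] := in_ultra_setVsetC ((fun p => ratio (F p) A) @^-1` V) uU.
  by have [x [/= nVx Vx]] := cl (~` V) V UV Vl.
have near_big (p0 : seq G * nat) : \forall p \near Uf, base p0 p.
  by apply: DU; exists p0.
have uniq_lim (h : seq G * nat -> R) (a b : R) : h @ Uf --> a -> h @ Uf --> b -> a = b.
  by move=> ha hb; apply: norm_cvg_unique ha hb.
exists mu; split.
- by move=> A; case: (mu_cvg A).
- apply: uniq_lim (mu_cvg setT).2 _.
  have -> : (fun p => ratio (F p) setT) = (fun=> 1).
    apply/funext => p; rewrite /ratio (eq_count (a2 := predT)); last by move=> x; apply/asboolP.
    by rewrite count_predT divff // pnatr_eq0 -lt0n; case: (FP p).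
  exact: cvg_cst.
- move=> A B AB; apply: uniq_lim (mu_cvg _).2 _.
  have -> : (fun p => ratio (F p) (A `|` B)) = (fun p => ratio (F p) A + ratio (F p) B).
    by apply/funext => p; exact: ratioU.
  by apply: cvgD; [exact: (mu_cvg A).2 | exact: (mu_cvg B).2].
- move=> g A; apply/eqP; rewrite -subr_eq0; apply/eqP.
  apply: uniq_lim (cvgB (mu_cvg _).2 (mu_cvg A).2) _.
  apply/cvgr0Pnorm_le => e e0.
  have [m me] := ltr_add_invr e0; rewrite add0r in me.
  apply: filterS (near_big ([:: g; g^-1%g], m.+1)) => p [gp mp].
  have [uF F0 hF] := FP p.
  have h y : y \in [:: g; g^-1%g] -> (m.+1 * count (fun x => (y * x)%g \notin F p) (F p) <= size (F p))%N.
    by move=> /gp /hF; apply: leq_trans; rewrite leq_mul2r mp orbT.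
  apply: le_trans (ltW me); apply: ratio_translate => //; apply: h; rewrite !inE eqxx ?orbT //.
Qed.
End Mean.

(** Bernoulli's inequality for [1 + 1/m] with exponent [3 * m], cleared of denominators. *)
Lemma expn_succ_ge m : (0 < m)%N -> (4 * m ^ (3 * m) <= m.+1 ^ (3 * m))%N.
Proof.
move=> m0; have bern n : (m ^ n * (m + n) <= m * m.+1 ^ n)%N.
  elim: n => [|n IH]; first by rewrite !expn0 addn0 mul1n muln1.
  rewrite !expnS; apply: (@leq_trans (m ^ n * (m.+1 * (m + n)))).
    by rewrite (mulnC m) -mulnA leq_mul2l; apply/orP; right; rewrite mulSn addnS mulnS; lia.
  by rewrite [X in (X <= _)%N]mulnCA [X in (_ <= X)%N]mulnCA leq_mul2l IH orbT.
have := bern (3 * m)%N; rewrite -[(m + 3 * m)%N]/(4 * m)%N.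
by rewrite mulnA mulnC leq_pmul2l // mulnC.
Qed.

(** Failure of the Folner condition gives growth by the factor [1 + 1/m] under left multiplication,
    and [3 * m] rounds raise it to 4. *)
Lemma nonamenable_expanding (R : realType) (G : groupType) : ~ amenable R G ->
  exists K : seq G, forall F : seq G, uniq F ->
    (4 * size F <= size (undup [seq (f * k)%g | f <- F, k <- K]))%N.
Proof.
move=> na.
have [K [m hK]] : exists (K : seq G) (m : nat), forall F, uniq F -> (0 < size F)%N ->
    exists2 g, g \in K & (size F < m * count (fun x => (g * x)%g \notin F) F)%N.
  apply: contrapT => h; apply: na; apply: folner_amenable => K m.
  apply: contrapT => h'; apply: h; exists K, m => F uF F0.
  apply: contrapT => h''; apply: h'; exists F; split=> // g gK.
  by rewrite leqNgt; apply/negP => lt; apply: h''; exists g.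
pose K1 := 1%g :: K.
have m0 : (0 < m)%N.
  have [//|g _] := hK [:: 1%g] isT; case: (m) => //.
pose step (F : seq G) := undup [seq (k * f)%g | k <- K1, f <- F].
have grow F : uniq F -> (m.+1 * size F <= m * size (step F))%N.
  move=> uF; have [->|F0] := posnP (size F); first by rewrite muln0.
  have [g gK lt] := hK F uF F0.
  pose E := [seq (g * x)%g | x <- F & (g * x)%g \notin F].
  have : (size (F ++ E) <= size (step F))%N.
    apply: uniq_leq_size.
      rewrite cat_uniq uF map_inj_uniq ?filter_uniq ?andbT //=; last exact: mulgI.
      by rewrite -all_predC; apply/allP => _ /mapP[x + ->]; rewrite mem_filter => /andP[].
    move=> x; rewrite mem_cat mem_undup => /orP[xF|/mapP[y + ->]].
      by apply/allpairsP; exists (1%g, x); rewrite mul1g mem_head.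
    by rewrite mem_filter => /andP[_ yF]; apply/allpairsP; exists (g, y); rewrite inE gK orbT.
  rewrite size_cat size_map size_filter => le.
  have := leq_mul (leqnn m) le; rewrite mulnDr mulSn; apply: leq_trans.
  by rewrite addnC leq_add2l ltnW.
pose kn n := iter n (fun L => [seq (k * l)%g | k <- K1, l <- L]) [:: 1%g].
pose n := (3 * m)%N.
have itU j F : uniq F -> uniq (iter j step F).
  by case: j => // j _; exact: undup_uniq.
have knS j k l : k \in K1 -> l \in kn j -> (k * l)%g \in kn j.+1.
  by move=> kK lj; rewrite /kn iterS; apply/allpairsP; exists (k, l).
have itE j F x : x \in iter j step F -> exists2 k, k \in kn j & exists2 f, f \in F & x = (k * f)%g.
  elim: j x => [|j IH] x; first by move=> xF; exists 1%g; rewrite ?mem_head //; exists x; rewrite ?mul1g.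
  rewrite iterS mem_undup => /allpairsP[[k y] [/= kK /IH[l lj [f fF ->]] ->]].
  exists (k * l)%g; last by exists f; rewrite ?mulgA.
  exact: (knS j k l kK lj).
have itS j F : uniq F -> (m.+1 ^ j * size F <= m ^ j * size (iter j step F))%N.
  move=> uF; elim: j => [|j IH] //; rewrite !expnS -mulnA.
  apply: leq_trans (leq_mul (leqnn m.+1) IH) _.
  rewrite [X in (X <= _)%N]mulnCA (mulnC m (m ^ j)%N) -mulnA leq_mul2l.
  by apply/orP; right; apply: grow; exact: itU.
(* Growth was obtained for products [k * f]; inversion turns them into right multiples. *)
exists [seq k^-1%g | k <- kn n] => F uF.
pose F' := [seq f^-1%g | f <- F].
have uF' : uniq F' by rewrite map_inj_uniq //; exact: invg_inj.
have : (4 * size F' <= size (iter n step F'))%N.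
  rewrite -(leq_pmul2l (_ : 0 < m ^ n)%N) ?expn_gt0 ?m0 //.
  apply: leq_trans (itS n F' uF'); rewrite mulnCA mulnA leq_mul2r; apply/orP; right.
  by rewrite expn_succ_ge.
rewrite size_map => /leq_trans; apply; rewrite -(size_map (fun x : G => x^-1%g)).
apply: uniq_leq_size; first by rewrite map_inj_uniq ?itU //; exact: invg_inj.
move=> _ /mapP[x /itE[k kn_k [_ /mapP[f fF ->] ->]] ->]; rewrite mem_undup.
apply/allpairsP; exists (f, k^-1%g) => /=; split=> //; first exact: map_f.
by rewrite invgM invgK.
Qed.

Theorem nonamenable_routable (R : realType) (G : groupType) : ~ amenable R G ->
  exists K : seq G, routable (kadj K) 4 2.
Proof.
by move=> /nonamenable_expanding[K hK]; exists K; exact: expanding_routable.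
Qed.

(** * Wirings from walks *)

Section Barycenter.
Variables (R : realType) (V : choiceType).
Implicit Types (u v w : V) (t : R).

Definition dirac_at v : V -> R := fun x => (x == v)%:R.

Lemma dirac_inj u v : dirac_at u = dirac_at v -> u = v.
Proof.
move=> /(congr1 (@^~ u)); rewrite /dirac_at eqxx; case: eqP => // _ /eqP.
by rewrite oner_eq0.
Qed.

Lemma barycenter0 u v : barycenter u v 0 = dirac_at u :> (V -> R).
Proof. by apply/funext => x; rewrite /barycenter subr0 mul1r mul0r addr0. Qed.

Lemma barycenter1 u v : barycenter u v 1 = dirac_at v :> (V -> R).
Proof. by apply/funext => x; rewrite /barycenter subrr mul1r mul0r add0r. Qed.

Lemma barycenterxx u t : barycenter u u t = dirac_at u.
Proof. by apply/funext => x; rewrite /barycenter -mulrDl subrK mul1r. Qed.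

Lemma barycenter_sym u v t : barycenter v u (1 - t) = barycenter u v t.
Proof. by apply/funext => x; rewrite /barycenter subKr addrC. Qed.

Lemma barycenter_l u v t : u != v -> barycenter u v t u = 1 - t.
Proof. by move=> uv; rewrite /barycenter eqxx (negPf uv) mulr0 addr0 mulr1. Qed.

Lemma barycenter_r u v t : u != v -> barycenter u v t v = t.
Proof. by move=> uv; rewrite /barycenter eqxx eq_sym (negPf uv) mulr0 add0r mulr1. Qed.

Lemma barycenter_neq0 u v t w : barycenter u v t w != 0 -> w = u \/ w = v.
Proof.
rewrite /barycenter; case: (eqVneq w u) => [->|_]; first by left.
by case: (eqVneq w v) => [->|_]; [right | rewrite !mulr0 addr0 eqxx].
Qed.

Lemma barycenter_dirac u v t w : u != v -> barycenter u v t = dirac_at w ->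
  (t = 0 /\ w = u) \/ (t = 1 /\ w = v).
Proof.
move=> uv e; have := congr1 (@^~ u) e; have := congr1 (@^~ v) e.
rewrite /= barycenter_l // barycenter_r // /dirac_at.
case: eqVneq => [->|_] tE; first by rewrite tE; right.
by rewrite tE subr0; case: eqVneq => [->|_ /eqP]; [left | rewrite oner_eq0].
Qed.

Lemma barycenter_eq u v t u' v' t' : u != v -> u' != v' -> 0 < t < 1 ->
  barycenter u v t = barycenter u' v' t' ->
  (u = u' /\ v = v' /\ t = t') \/ (u = v' /\ v = u').
Proof.
move=> uv uv' /andP[t0 t1] e.
have hu : barycenter u' v' t' u != 0 by rewrite -e barycenter_l // subr_eq0 gt_eqF.
have hv : barycenter u' v' t' v != 0 by rewrite -e barycenter_r // gt_eqF.
case: (barycenter_neq0 hu) (barycenter_neq0 hv) => eu [] ev.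
- by move: uv; rewrite eu ev eqxx.
- left; split=> //; split=> //; have := congr1 (@^~ v) e.
  by rewrite /= barycenter_r // ev barycenter_r.
- by right.
- by move: uv; rewrite eu ev eqxx.
Qed.

Fixpoint walk_at (a : V) (p : seq V) (s : R) : V -> R :=
  if p is x :: p' then if s <= 1 then barycenter a x s else walk_at x p' (s - 1)
  else dirac_at a.

Lemma walk_at0 a p : walk_at a p 0 = dirac_at a.
Proof. by case: p => //= x p; rewrite ler01 barycenter0. Qed.

Lemma walk_at_size a p : walk_at a p (size p)%:R = dirac_at (last a p).
Proof.
elim: p a => //= x p IH a; case: p IH => [|y p] IH; first by rewrite lexx barycenter1.
rewrite ifN; last by rewrite -ltNge ltr1n.
by rewrite -[X in X - 1]natr1 addrK; exact: IH.
Qed.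

Fixpoint steps (a : V) (p : seq V) : seq (V * V) :=
  if p is x :: p' then (a, x) :: steps x p' else [::].

Lemma steps_mem a p e : e \in steps a p -> (e.1 \in a :: p) && (e.2 \in a :: p).
Proof.
elim: p a => //= x p IH a; rewrite inE => /orP[/eqP->|/IH/andP[h1 h2]].
  by rewrite !inE !eqxx orbT.
by rewrite !(in_cons a) h1 h2 !orbT.
Qed.

Lemma walk_at_steps a p s : p != [::] -> 0 <= s <= (size p)%:R ->
  exists2 e, e \in steps a p & exists2 t, 0 <= t <= 1 & walk_at a p s = barycenter e.1 e.2 t.
Proof.
elim: p a s => // x p IH a s _ /= /andP[s0 sp]; case: leP => s1.
  by exists (a, x); [rewrite mem_head | exists s => //; rewrite s0].
have pn : p != [::] by case: p sp {IH} => //= sp; move: (lt_le_trans s1 sp); rewrite ltxx.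
have [|e es [t t01 wE]] := IH x (s - 1) pn.
  by rewrite subr_ge0 (ltW s1) lerBlDr -natr1 in sp *.
by exists e; [rewrite inE es orbT | exists t].
Qed.

Lemma steps_walk_at a p e t : e \in steps a p -> 0 <= t <= 1 ->
  exists2 s, 0 <= s <= (size p)%:R & walk_at a p s = barycenter e.1 e.2 t.
Proof.
elim: p a => //= x p IH a; rewrite inE => /orP[/eqP-> /= /andP[t0 t1]|/IH h /h[s /andP[s0 sp] sE]].
  by exists t; [rewrite t0 (le_trans t1) // ler1n | rewrite t1].
(* At a joint [walk_at] uses the segment that ends there, so the start of the tail is reached as the
   end of the first segment. *)
have [s00|sp0] := eqVneq s 0.
  exists 1; first by rewrite ler01 ler1n.
  by rewrite lexx barycenter1 -sE s00 walk_at0.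
exists (s + 1); first by rewrite addr_ge0 //= -natr1 lerD2r.
by rewrite ifN ?addrK // -ltNge ltrDr lt_def sp0.
Qed.
End Barycenter.

Section Realization.
Variables (R : realType) (X : graph).
Implicit Types (p q : realization R X) (u v : vertex X).

Lemma realization_eq p q : bary_coord p = bary_coord q -> p = q.
Proof.
case: p q => [c cP] [c' cP'] /= e; rewrite -e in cP' *.
by congr RealizationPoint; exact: Prop_irrelevance.
Qed.

Lemma nodeE v : bary_coord (node R v) = dirac_at R v.
Proof. by []. Qed.

Lemma node_inj : injective (@node R X).
Proof. by move=> u v /(congr1 (@bary_coord R X)); rewrite !nodeE => /dirac_inj. Qed.

Lemma adj_neq u v : adj u v -> u != v.
Proof. by apply: contraTneq => ->; rewrite adj_irr. Qed.

Lemma segment_point u v t : adj u v -> 0 <= t <= 1 ->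
  exists p, bary_coord p = barycenter u v t.
Proof.
move=> uv t01; have h : exists u0 v0 t0, [/\ (u0 == v0) || adj u0 v0, 0 <= t0 <= 1
   & barycenter u v t = barycenter u0 v0 t0] by exists u, v, t; rewrite uv orbT.
by exists (RealizationPoint h).
Qed.

Lemma realization_cases p : (exists v, p = node R v) \/
  exists u v t, [/\ adj u v, 0 < t < 1 & bary_coord p = barycenter u v t].
Proof.
have [u [v [t [uv /andP[t0 t1] pE]]]] := bary_coordP p.
have [e|ne] := eqVneq u v.
  by left; exists u; apply: realization_eq; rewrite pE -e barycenterxx.
have [e|tn0] := eqVneq t 0.
  by left; exists u; apply: realization_eq; rewrite pE e barycenter0.
have [e|tn1] := eqVneq t 1.
  by left; exists v; apply: realization_eq; rewrite pE e barycenter1.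
right; exists u, v, t; split=> //; first by move: uv; rewrite (negPf ne).
by rewrite !lt_def tn0 t0 eq_sym tn1.
Qed.

Lemma closed_edgeP u v p : adj u v ->
  closed_edge R [set u; v] p <-> exists2 t, 0 <= t <= 1 & bary_coord p = barycenter u v t.
Proof.
move=> uv; have nuv := adj_neq uv; split=> [pE|[t t01 pE] w wuv]; last first.
  apply/eqP; apply: contrapT => /negP; rewrite pE => /barycenter_neq0.
  by case=> e; apply: wuv; [left|right].
have sup w : p w != 0 -> w = u \/ w = v.
  move=> pw; apply: contrapT => h; move/eqP: pw; apply; apply: pE => -[] e; apply: h; [by left|by right].
case: (realization_cases p) => [[w e]|[a [b [t [ab t01 e]]]]].
  have : p w != 0 by rewrite e nodeE /dirac_at eqxx oner_neq0.
  case/sup => ew; rewrite e ew nodeE.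
    by exists 0; rewrite ?lexx ?ler01 // barycenter0.
  by exists 1; rewrite ?lexx ?ler01 // barycenter1.
have nab := adj_neq ab; case/andP: (t01) => t0 t1.
have /sup ha : p a != 0 by rewrite e barycenter_l // subr_eq0 gt_eqF.
have /sup hb : p b != 0 by rewrite e barycenter_r // gt_eqF.
case: ha hb => ea [] eb.
- by move: nab; rewrite ea eb eqxx.
- by exists t; rewrite ?(ltW t0) ?(ltW t1) // -ea -eb.
- exists (1 - t); first by rewrite subr_ge0 (ltW t1) gerBl (ltW t0).
  by rewrite e ea eb barycenter_sym.
- by move: nab; rewrite ea eb eqxx.
Qed.
End Realization.

Section WalkOpen.
Variables (R : realType) (Y : graph) (U : set (realization R Y)).
Hypothesis oU : realization_open U.

Let onU (c : vertex Y -> R) := exists y, bary_coord y = c /\ U y.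

Lemma walk_point a (p : seq (vertex Y)) s : path (@adj Y) a p -> 0 <= s <= (size p)%:R ->
  exists y : realization R Y, bary_coord y = walk_at a p s.
Proof.
elim: p a s => [|x p IH] a s /=; first by exists (node R a).
case/andP => ax xp /andP[s0 sp]; case: leP => s1; first by apply: segment_point; rewrite ?s0.
by apply: IH => //; rewrite subr_ge0 (ltW s1) lerBlDr -natr1 in sp *.
Qed.

(** Open sets are known only through their traces on single edges. Inside an edge a small radius
    stays on it; at the joint [s = 1] the radius on the first edge is combined with that of the tail
    at time 0. *)
Lemma walk_open a (p : seq (vertex Y)) s : path (@adj Y) a p -> 0 <= s <= (size p)%:R ->
  onU (walk_at a p s) -> exists2 eps, 0 < eps &
    forall s', 0 <= s' <= (size p)%:R -> `|s' - s| < eps -> onU (walk_at a p s').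
Proof.
elim: p a s => [|x p IH] a s.
  by move=> _ _ h; exists 1.
move=> /= /andP[ax xp] /andP[s0 sp] h.
have [V [oV VU]] := oU ax.
have seg t : 0 <= t <= 1 -> V t <-> onU (barycenter a x t).
  move=> t01; have [y yE] := segment_point ax t01.
  split=> [Vt|[y' [y'E Uy']]]; first by exists y; split=> //; apply/(VU t y).
  by apply/(VU t y').
have tail (s' : R) : 1 < s' -> s' <= (size p).+1%:R -> 0 <= s' - 1 <= (size p)%:R.
  by move=> s1; rewrite subr_ge0 (ltW s1) lerBlDr natr1.
have ball_V t : V t -> exists2 eps, 0 < eps & forall t', `|t' - t| < eps -> V t'.
  move=> Vt; have /nbhs_ballP[eps e0 be] := open_nbhs_nbhs (conj oV Vt).
  by exists eps => // t' tt'; apply: be; rewrite /ball /= distrC.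
case: (ltgtP s 1) => s1.
- move: h; rewrite (ltW s1) => h.
  have [|eps e0 he] := ball_V s; first by apply/seg; rewrite // s0 ltW.
  exists (Num.min eps (1 - s)); first by rewrite lt_min e0 subr_gt0.
  move=> s' /andP[s'0 s'p]; rewrite lt_min => /andP[h1 h2].
  have s'1 : s' <= 1 by move: h2; rewrite ltr_norml; lra.
  by rewrite s'1; apply/seg; rewrite ?s'0 //; exact: he.
- move: h; rewrite leNgt s1 /= => h.
  have [eps e0 he] := IH x (s - 1) xp (tail s s1 sp) h.
  exists (Num.min eps (s - 1)); first by rewrite lt_min e0 subr_gt0.
  move=> s' /andP[s'0 s'p]; rewrite lt_min => /andP[h1 h2].
  have s'1 : 1 < s' by move: h2; rewrite ltr_norml; lra.
  rewrite leNgt s'1 /=; apply: he; first exact: tail.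
  by rewrite opprB addrA subrK.
- move: h; rewrite s1 lexx => h.
  have [|eps1 e1 he1] := ball_V 1; first by apply/seg; rewrite ?ler01 ?lexx.
  have [||eps2 e2 he2] := IH x 0 xp.
  + by rewrite lexx ler0n.
  + by rewrite walk_at0 -(barycenter1 _ a).
  exists (Num.min eps1 eps2); first by rewrite lt_min e1.
  move=> s' /andP[s'0 s'p]; rewrite lt_min => /andP[h1 h2]; case: leP => s'1.
    by apply/seg; rewrite ?s'0 //; exact: he1.
  by apply: he2; [exact: tail | rewrite subr0].
Qed.

Lemma walk_trace_open a p : p != [::] -> path (@adj Y) a p ->
  exists V : set R, open V /\ forall t, 0 <= t <= 1 ->
    (V t <-> onU (walk_at a p (t * (size p)%:R))).
Proof.
move=> p0 ap; have L0 : 0 < (size p)%:R :> R by rewrite ltr0n; case: (p) p0.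
have tL (t : R) : 0 <= t <= 1 -> 0 <= t * (size p)%:R <= (size p)%:R.
  by case/andP => t0 t1; rewrite mulr_ge0 ?ler0n //= ler_piMl ?ler0n.
(* Only parameters [t'] in the unit interval are tested while [t] is any real number, which makes
   [V] open in the whole line. *)
pose V := [set t | exists2 eps, 0 < eps & forall t', 0 <= t' <= 1 ->
  `|t' - t| < eps -> onU (walk_at a p (t' * (size p)%:R))].
exists V; split.
  rewrite openE => t [eps e0 he]; apply/nbhs_ballP; exists (eps / 2); first exact: divr_gt0.
  move=> t1; rewrite /ball /= => tt1; exists (eps / 2); first exact: divr_gt0.
  move=> t' t'01 t't1; apply: he => //.
  have := ler_normD (t' - t1) (t1 - t); rewrite addrA subrK (distrC t1 t); lra.
move=> t t01; split=> [[eps e0 he]|h]; first by apply: he; rewrite // subrr normr0.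
have [eps e0 he] := walk_open ap (tL t t01) h.
exists (eps / (size p)%:R); first exact: divr_gt0.
move=> t' t'01 tt; apply: he; first exact: tL.
by rewrite -mulrBl normrM (gtr0_norm L0) -ltr_pdivlMr.
Qed.
End WalkOpen.

Lemma half_interior (R : realType) :
  [/\ 0 <= (2^-1 : R) <= 1, 2^-1 != 0 :> R & 1 - 2^-1 != 0 :> R].
Proof.
split; first by rewrite invr_ge0 ler0n invf_le1 ?ler1n ?ltr0n.
  by rewrite invr_eq0 pnatr_eq0.
by rewrite subr_eq0 eq_sym lt_eqF // invf_lt1 ?ltr1n ?ltr0n.
Qed.

(** * The wiring that traverses a given walk along each oriented edge *)

Section WalksWiring.
Variables (R : realType) (X Y : graph) (ori : vertex X -> vertex X -> Prop).
Variables (phi : vertex X -> vertex Y) (wlk : vertex X -> vertex X -> seq (vertex Y)).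
Hypothesis ori_total : forall u v, adj u v -> ori u v \/ ori v u.
Hypothesis ori_anti : forall u v, adj u v -> ori u v -> ori v u -> False.
Hypothesis wlk_path : forall u v, adj u v -> ori u v ->
  [/\ wlk u v != [::], path (@adj Y) (phi u) (wlk u v) & last (phi u) (wlk u v) = phi v].

(** A relation, because a node has many barycentric descriptions; [img_ex] checks that all of them
    prescribe the same image. *)
Let img (p : realization R X) (y : realization R Y) : Prop :=
  (forall v, p = node R v -> y = node R (phi v)) /\
  (forall u v t, adj u v -> ori u v -> 0 <= t <= 1 -> bary_coord p = barycenter u v t ->
    bary_coord y = walk_at (phi u) (wlk u v) (t * (size (wlk u v))%:R)).

Let tL (p : seq (vertex Y)) (t : R) : 0 <= t <= 1 -> 0 <= t * (size p)%:R <= (size p)%:R.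
Proof. by case/andP => t0 t1; rewrite mulr_ge0 ?ler0n //= ler_piMl ?ler0n. Qed.

Let img_ex p : exists y, img p y.
Proof.
case: (realization_cases p) => [[a ->]|[u0 [v0 [t0 [uv0 t01 pE]]]]].
  exists (node R (phi a)); split; first by move=> v /node_inj->.
  move=> u v t uv o t01; rewrite nodeE => /esym/(barycenter_dirac (adj_neq uv)).
  have [_ _ lw] := wlk_path uv o.
  by case=> -[-> ->]; rewrite ?mul0r ?walk_at0 ?mul1r ?walk_at_size ?lw.
have [u [v [t [uv o {}t01 {}pE]]]] : exists u v t,
    [/\ adj u v, ori u v, 0 < t < 1 & bary_coord p = barycenter u v t].
  case: (ori_total uv0) => o; first by exists u0, v0, t0.
  exists v0, u0, (1 - t0); rewrite adj_sym barycenter_sym; split=> //.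
  by move: t01; lra.
have nuv := adj_neq uv; have [w0 wp lw] := wlk_path uv o.
have t01' : 0 <= t <= 1 by case/andP: t01 => *; rewrite !ltW.
have [y yE] := walk_point wp (tL (wlk u v) t01').
exists y; split.
  move=> w e; move: pE; rewrite e nodeE => /esym/(barycenter_dirac nuv).
  by case/andP: t01 => t0' t1' -[[t0E _]|[t1E _]]; [rewrite t0E ltxx in t0'|rewrite t1E ltxx in t1'].
move=> u' v' t' uv' o' t01'' e; have nuv' := adj_neq uv'.
rewrite pE in e; case: (barycenter_eq nuv nuv' t01 e) => [[<- [<- <-]] //|[e1 e2]].
by exfalso; apply: (ori_anti uv o); rewrite e1 e2.
Qed.

Lemma wiring_exists : exists f : realization R X -> realization R Y,
  (forall v, f (node R v) = node R (phi v)) /\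
  (forall p u v t, adj u v -> ori u v -> 0 <= t <= 1 -> bary_coord p = barycenter u v t ->
    bary_coord (f p) = walk_at (phi u) (wlk u v) (t * (size (wlk u v))%:R)).
Proof.
have /choice[f fP] := img_ex; exists f; split.
  by move=> v; apply: (fP _).1.
by move=> p u v t uv o t01 pE; apply: (fP p).2.
Qed.

Variable f : realization R X -> realization R Y.
Hypothesis f_node : forall v, f (node R v) = node R (phi v).
Hypothesis f_edge : forall p u v t, adj u v -> ori u v -> 0 <= t <= 1 ->
  bary_coord p = barycenter u v t ->
  bary_coord (f p) = walk_at (phi u) (wlk u v) (t * (size (wlk u v))%:R).

Lemma f_continuous : continuous f.
Proof.
apply/continuousP => U; rewrite -[open U]/(realization_open U) => oU.
rewrite -[open _]/(realization_open _).
have main u v : adj u v -> ori u v -> exists V : set R, open V /\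
    forall t p, on_segment u v t p -> (V t <-> (f @^-1` U) p).
  move=> uv o; have [w0 wp lw] := wlk_path uv o.
  have [V [oV VP]] := walk_trace_open oU w0 wp.
  exists V; split=> // t p [t01 pE]; rewrite VP //.
  have fE := f_edge uv o t01 pE; split=> [[y [yE Uy]]|Ufp]; last by exists (f p).
  by rewrite /preimage /= (_ : f p = y) //; apply: realization_eq; rewrite fE yE.
move=> u v uv; case: (ori_total uv) => o; first exact: main.
have vu : adj v u by rewrite adj_sym.
have [V [oV VP]] := main v u vu o.
exists ((fun t => 1 - t) @^-1` V); split.
  apply: open_comp => // t _; apply: continuousB; [exact: cvg_cst | exact: cvg_id].
move=> t p [t01 pE]; apply: VP; split; first by move: t01; lra.
by rewrite pE barycenter_sym.
Qed.

Lemma f_image u v : adj u v -> ori u v ->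
  f @` closed_edge R [set u; v] =
  [set y | exists2 e, e \in steps (phi u) (wlk u v) &
    exists2 t, 0 <= t <= 1 & bary_coord y = barycenter e.1 e.2 t].
Proof.
move=> uv o; have [w0 wp lw] := wlk_path uv o.
have L0 : 0 < (size (wlk u v))%:R :> R by rewrite ltr0n; case: (wlk u v) w0.
apply/seteqP; split=> [_ [p /(closed_edgeP _ uv)[t t01 pE] <-]|y [e es [t t01 yE]]].
  have [e es [t' t'01 wE]] := walk_at_steps (phi u) w0 (tL (wlk u v) t01).
  by exists e => //; exists t' => //; rewrite (f_edge uv o t01 pE).
have [s /andP[s0 sL] sE] := steps_walk_at es t01.
have t01' : 0 <= s / (size (wlk u v))%:R <= 1.
  by rewrite divr_ge0 ?ler0n // ler_pdivrMr // mul1r.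
have [p pE] := segment_point uv t01'.
exists p; first by apply/(closed_edgeP _ uv); exists (s / (size (wlk u v))%:R).
by apply: realization_eq; rewrite (f_edge uv o t01' pE) mulfVK ?gt_eqF // sE yE.
Qed.

Lemma edges_oriented e : edges X e -> exists u v, [/\ adj u v, ori u v & e = [set u; v]].
Proof.
move=> [u [v [uv ->]]]; case: (ori_total uv) => o; first by exists u, v.
by exists v, u; rewrite adj_sym setUC.
Qed.

Lemma steps_adj a (p : seq (vertex Y)) e : path (@adj Y) a p -> e \in steps a p -> adj e.1 e.2.
Proof.
elim: p a => //= x p IH a /andP[ax xp]; rewrite inE => /orP[/eqP-> //|]; exact: IH.
Qed.

Lemma f_wiring : wiring f.
Proof.
split; first exact: f_continuous.
- by move=> v; exists (phi v).
- move=> e /edges_oriented[u [v [uv o ->]]]; have [w0 wp lw] := wlk_path uv o.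
  exists [set [set z.1; z.2] | z in [set z | z \in steps (phi u) (wlk u v)]].
    by move=> _ [z zs <-]; exists z.1, z.2; split=> //; exact: steps_adj zs.
  rewrite f_image //; apply/seteqP; split=> [y [z zs [t t01 yE]]|y [_ [z zs <-]]].
    exists [set z.1; z.2]; first by exists z.
    by apply/closed_edgeP; [exact: steps_adj zs | exists t].
  move/closed_edgeP => h; have [|t t01 yE] := h; first exact: steps_adj zs.
  by exists z => //; exists t.
Qed.

(** The midpoint of [e'] has both ends in its support, and points of the image are supported on
    vertices of the walk. Hence congestion at vertices bounds congestion on edges. *)
Lemma f_covers e' u v : adj u v -> ori u v -> edges Y e' ->
  closed_edge R e' `<=` f @` closed_edge R [set u; v] ->
  forall x, e' x -> x \in phi u :: wlk u v.
Proof.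
move=> uv o [x [y [xy ->]]] sub z zxy; have [w0 wp lw] := wlk_path uv o.
have [h01 h2 h2'] := half_interior R.
have [p pE] := segment_point xy h01.
have : closed_edge R [set x; y] p by apply/(closed_edgeP _ xy); exists 2^-1.
move=> /sub; rewrite f_image // => -[e es [t t01 pE']].
have nxy := adj_neq xy.
have pz : p z != 0.
  by case: zxy => ->; rewrite pE ?barycenter_l ?barycenter_r.
have [m1 m2] := andP (steps_mem es).
by rewrite pE' in pz; case: (barycenter_neq0 pz) => ->.
Qed.

Lemma f_range w : range f (node R w) ->
  (exists v, w = phi v) \/ exists u v, [/\ adj u v, ori u v & w \in phi u :: wlk u v].
Proof.
case=> p _ fp; case: (realization_cases p) => [[v pv]|[u0 [v0 [t0 [uv0 t01 pE0]]]]].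
  by left; exists v; apply: (@node_inj R Y); rewrite -fp pv f_node.
right; have cp : closed_edge R [set u0; v0] p.
  by apply/(closed_edgeP _ uv0); exists t0 => //; case/andP: t01 => *; rewrite !ltW.
have [u [v [uv o e]]] : exists u v, [/\ adj u v, ori u v & [set u0; v0] = [set u; v]].
  by apply: edges_oriented; exists u0, v0.
rewrite e in cp; exists u, v; split=> //; have [w0 wp lw] := wlk_path uv o.
have : (f @` closed_edge R [set u; v]) (node R w) by exists p.
rewrite f_image // => -[z zs [t t01' yE]].
have [m1 m2] := andP (steps_mem zs).
have : node R w w != 0 by rewrite nodeE /dirac_at eqxx oner_neq0.
by rewrite yE => /barycenter_neq0[] ->.
Qed.
End WalksWiring.

Theorem walks_wiring (R : realType) (k : nat) (X Y : graph)
    (ori : vertex X -> vertex X -> Prop)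
    (phi : vertex X -> vertex Y) (wlk : vertex X -> vertex X -> seq (vertex Y))
    (B : seq (vertex Y)) :
  (forall u v, adj u v -> ori u v \/ ori v u) ->
  (forall u v, adj u v -> ori u v -> ori v u -> False) ->
  (forall u v, adj u v -> ori u v ->
    [/\ wlk u v != [::], path (@adj Y) (phi u) (wlk u v) & last (phi u) (wlk u v) = phi v]) ->
  (forall v, phi v \in B) ->
  (forall u v, adj u v -> ori u v -> {subset phi u :: wlk u v <= B}) ->
  (forall w, [set v | phi v = w] #<= `I_k) ->
  (forall x, [set e | exists u v, [/\ adj u v, ori u v, e = [set u; v]
     & x \in phi u :: wlk u v]] #<= `I_k) ->
  exists f : realization R X -> realization R Y,
    coarse_wiring k f /\ exists2 m, has_volume f m & (m <= size B)%N.
Proof.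
move=> ot oa wp pB wB pk wk.
have [f [fn fe]] := wiring_exists R ot oa wp; exists f; split.
  split.
  - exact: (f_wiring ot wp fn fe).
  - move=> w; apply: card_le_trans (pk w); apply: subset_card_le => v /= h.
    by apply: (@node_inj R Y); rewrite -fn.
  - move=> e' ee'; have [x [y [_ e'E]]] := ee'; apply: card_le_trans (wk x).
    apply: subset_card_le => e [/(edges_oriented ot)[u [v [uv o ->]]] sub].
    exists u, v; split=> //; apply: (f_covers wp fe uv o ee' sub).
    by rewrite e'E; left.
have sB w : range f (node R w) -> w \in B.
  case/(f_range ot wp fn fe) => [[v ->] //|[u [v [uv o]]]]; exact: wB.
have fA : finite_set [set w : vertex Y | range f (node R w)].
  by apply: (@sub_finite_set _ _ [set` B]); [move=> w /sB | exact: finite_seq].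
have [m Am] := (finite_setP _).1 fA; exists m => //.
by rewrite -card_le_II -(card_le_eql Am); apply: (@seq_card_le _ _ B).
Qed.

(** * Wiring profiles *)

Lemma subgraph_seq (X : graph) (H : subgraph X) n : sub_vertex H #<= `I_n ->
  exists s : seq (vertex H), [/\ uniq s, (size s <= n)%N & forall v, v \in s].
Proof.
move=> Hn; have : [set: vertex H] #<= `I_n by rewrite (card_le_eql (card_setT _)).
case/card_le_seq => s [us sn sP]; exists s; split=> // v; exact/sP.
Qed.

Lemma wiring_volume_ge (R : realType) (k m : nat) (X Y : graph)
    (f : realization R X -> realization R Y) (s : seq (vertex X)) :
  uniq s -> coarse_wiring k f -> has_volume f m -> (size s <= k * m)%N.
Proof.
move=> us [[_ fn _] fk _] /card_eq_seq[t [ut <- tP]].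
have /choice[phi phiP] := fn.
have pt v : phi v \in t by apply/tP; exists (node R v); rewrite ?phiP.
have -> : size s = (\sum_(w <- t) count (fun v => phi v == w) s)%N.
  rewrite -count_sum -sum1_size; apply: eq_bigr => v _.
  rewrite (bigD1_seq (phi v)) //= eqxx big1 // => w; by rewrite eq_sym => /negPf->.
rewrite mulnC -sum1_size big_distrl /=; apply: leq_sum => w _; rewrite mul1n.
have [l [ul lk lP]] := card_le_seq (fk w).
rewrite -size_filter; apply: leq_trans lk; apply: uniq_leq_size; first exact: filter_uniq.
by move=> v; rewrite mem_filter => /andP[/eqP e _]; apply/lP; rewrite /= phiP e.
Qed.

Section Profile.
Variables (R : realType) (T3 : graph) (hT : infinite_regular_tree 3 T3).

(** Already [n] vertices without edges force volume at least [n / k]. *)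
Lemma profile_ge (k : nat) (Y : graph) : (0 < k)%N ->
  lesssim (fun n : nat => n%:R%:E : \bar R) (wiring_profile R k T3 Y).
Proof.
move=> k0; exists k => n; have [inf _ _ _] := hT.
have [A _ sA] := infinite_set_fset n inf.
pose s := take n (finmap.enum_fset A).
have ss : size s = n by rewrite size_takel.
have us : uniq s by apply: take_uniq; exact: finmap.fset_uniq.
pose H := @Subgraph T3 [set` s] (fun _ _ => false) (fun _ _ => erefl) (fun u v h => ltac:(by [])).
have Hn : sub_vertex H #<= `I_(k * n).
  by apply: (@seq_card_le _ _ s) => //; rewrite ss leq_pmull.
have lb : ((n%:R / k%:R)%:E <= min_volume R k H Y)%E.
  apply: le_ereal_inf_tmp => _ [m [f [fk fm]] <-].
  have [t [ut st tP]] : exists t : seq (vertex H), [/\ uniq t, size t = n & forall v, v \in t].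
    have E : [set: vertex H] #= `I_n.
      apply: card_eq_trans (card_setT _) _; rewrite -ss; exact: seq_card_eq.
    by have [t [ut st tP]] := card_eq_seq E; exists t; split=> // v; apply/tP.
  have := wiring_volume_ge ut fk fm; rewrite st => le.
  by rewrite lee_fin ler_pdivrMr ?ltr0n // -natrM ler_nat mulnC.
have ub : (min_volume R k H Y <= wiring_profile R k T3 Y (k * n)%N)%E.
  by apply: ereal_sup_ubound; exists H.
apply: (@le_trans _ _ (k%:R%:E * wiring_profile R k T3 Y (k * n)%N)%E); last first.
  by rewrite leeDl // lee_fin.
apply: le_trans (lee_wpmul2l _ (le_trans lb ub)); last by rewrite lee_fin.
by rewrite -EFinM lee_fin mulrC divfK // pnatr_eq0 -lt0n.
Qed.

Lemma routable_profile_le (G : groupType) (S : set G) (K : seq G) (k C : nat) :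
  generates S -> (exists g : G, g != 1%g) -> routable (kadj K) k C ->
  exists2 k', (0 < k')%N & lesssim (wiring_profile R k' T3 (cayley_graph S))
                       (fun n : nat => n%:R%:E : \bar R).
Proof.
move=> gS ng rt; have [B [B0 hB]] := cayley_expand gS K ng.
have [f [finj fadj]] := tree_address hT.
(* A walk passes [x] only if its wire contains [x * c^-1] for some [c] in [B], whence [k * size B];
   the successor makes [k'] positive. In [D], 1 accounts for the images of the vertices and
   [C * size B] for the points of the walks. *)
pose k' := (k * size B).+1; pose D := (1 + C * size B)%N.
have kk' : (k <= k')%N by rewrite leqW // leq_pmulr //; case: (B) B0.
exists k' => //; exists D => n.
suff le : (wiring_profile R k' T3 (cayley_graph S) n <= (D * n)%:R%:E)%E.
  apply: (le_trans le); apply: (@le_trans _ _ (D%:R%:E * (D * n)%:R%:E)%E); last first.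
    by rewrite leeDl // lee_fin.
  by rewrite -EFinM lee_fin -natrM ler_nat leq_pmull // /D add1n.
apply: ge_ereal_sup => _ [H Hn <-].
have [s [us sn sP]] := subgraph_seq Hn.
pose h (v : vertex H) : addr := f (val v).
have hinj : injective h by move=> u v /finj /val_inj.
have uU : uniq (map h s) by rewrite map_inj_uniq.
have [phi [W [cW mphi mW lW]]] := rt _ uU.
pose ori (u v : vertex H) := exists i, h u = i :: h v.
pose Y := cayley_graph S.
have /choice[wl wlP] (p : vertex H * vertex H) : exists w : seq G, adj p.1 p.2 -> ori p.1 p.2 ->
    [/\ w != [::], path (@adj Y) (phi (h p.1)) w, last (phi (h p.1)) w = phi (h p.2)
      & forall x, x \in phi (h p.1) :: w -> has (fun c => (x * c^-1)%g \in W (h p.1)) B].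
  have [[i e]|no] := pselect (ori p.1 p.2); last by exists [::].
  have := cW i (h p.2); rewrite -e !map_f // => /(_ isT isT) /hB [w [w0 [pw lw] wB]].
  by exists w.
pose wlk u v := wl (u, v).
pose vis := map (fun u => phi (h u)) s
  ++ [seq (y * c)%g | y <- flatten [seq W (h u) | u <- s], c <- B].
have visW u x : has (fun c => (x * c^-1)%g \in W (h u)) B -> x \in vis.
  case/hasP => c cB xW; rewrite mem_cat; apply/orP; right.
  apply/allpairsP; exists ((x * c^-1)%g, c); split=> //=; last by rewrite mulgVK.
  by apply/flatten_mapP; exists u.
have h_adj (u v : vertex H) : adj u v -> adj (val u) (val v).
  by move=> /(@sub_adjP _ H)[].
have [||||||| F [cF [m mF mle]]] := @walks_wiring R k' H Y ori (fun v => phi (h v)) wlk vis.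
- by move=> u v /h_adj /fadj[]; [left|right].
- move=> u v _ [i e] [j e']; have : size (h u) = (size (h u)).+2 by rewrite {1}e /= e'.
  lia.
- by move=> u v uv o; have [] := wlP (u, v) uv o.
- by move=> v; rewrite mem_cat; apply/orP; left; apply/mapP; exists v.
- move=> u v uv o x xw; have [_ _ _ hx] := wlP (u, v) uv o; exact: visW (hx x xw).
- move=> w; apply: (@seq_card_le _ _ [seq v <- s | phi (h v) == w]).
    by move=> v /= <-; rewrite mem_filter eqxx sP.
  rewrite size_filter -(count_map h (fun a => phi a == w)).
  exact: leq_trans (mphi w) kk'.
(* The parent is unique, so an edge is recovered from its lower end, and counting edges becomes
   counting vertices. *)
- move=> x; pose E (u : vertex H) := [set z | z = u \/ ori u z].
  apply: (@seq_card_le _ _ (map E [seq u <- s | has (fun c => (x * c^-1)%g \in W (h u)) B])).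
    move=> _ [u [v [uv o -> xw]]]; apply/mapP; exists u.
      by rewrite mem_filter sP andbT; have [_ _ _ hx] := wlP (u, v) uv o; exact: hx.
    apply/seteqP; split=> z [] zE.
    + by left.
    + by right; rewrite zE.
    + by left.
    + right; case: o zE => i e [j e']; apply: hinj.
      by move: e; rewrite e' => -[_ ->].
  rewrite size_map size_filter leqW //.
  apply: (@leq_trans (\sum_(c <- B) count (fun u => (x * c^-1)%g \in W (h u)) s)).
    rewrite -count_sum -sumn_count sumnE big_map; apply: leq_sum => u _.
    case: hasP => // -[c cB xc]; rewrite (big_rem c) //= xc; exact: leq_addr.
  rewrite mulnC -sum1_size big_distrl /=; apply: leq_sum => c _; rewrite mul1n.
  rewrite -(count_map h (fun a => (x * c^-1)%g \in W a)); exact: mW.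
apply: le_trans (_ : m%:R%:E <= _)%E; first by apply: ereal_inf_lbound; exists m => //; exists F.
rewrite lee_fin ler_nat (leq_trans mle) // size_cat size_map size_allpairs /D mulnDl mul1n.
apply: leq_add => //; rewrite mulnAC leq_mul2r; apply/orP; right.
rewrite size_flatten /shape -map_comp sumnE big_map.
by move: lW; rewrite big_map size_map => /leq_trans; apply; rewrite leq_mul2l sn orbT.
Qed.
End Profile.

Lemma nontrivial_of_not_virtually_cyclic (G : groupType) :
  ~ virtually_cyclic G -> exists g : G, g != 1%g.
Proof.
move=> nv; apply: contrapT => tr; apply: nv; apply: virt_cyc_virtually_cyclic.
have triv (g : G) : g = 1%g by apply: contrapT => /eqP g1; apply: tr; exists g.
exists 1%g; split=> //; exists [:: 1%g]; split=> // x _; exists 1%g; rewrite ?mem_head //.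
by rewrite [(_ * _)%g]triv; apply: subgrp1; exact: subgrp_cyc.
Qed.

Theorem corollary1p0p3p1 (R : realType) (G : groupType) (S : set G)
    (T3 : graph) :
  finite_set S -> generates S -> ~ virtually_cyclic G ->
  infinite_regular_tree 3 T3 ->
  (forall k : nat, (1 <= k)%N ->
     ~ simeq (wiring_profile R k T3 (cayley_graph S))
             (fun n : nat => n%:R%:E)) ->
  amenable R G /\ ~ elementary_amenable G.
Proof.
move=> fS gS nv hT nosim.
(* The equivalence is assumed to fail for every [k], so a single routing, with whatever constants it
   has, gives a contradiction. *)
have absurd (K : seq G) k C : routable (kadj K) k C -> False.
  move=> rt; have ng := nontrivial_of_not_virtually_cyclic nv.
  have [k' k0 le] := routable_profile_le R hT gS ng rt.
  by apply: (nosim k' k0); split=> //; apply: profile_ge.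
split.
  by apply: contrapT => /nonamenable_routable[K]; apply: absurd.
move=> ea; case: (elementary_amenable_dichotomy ea fS gS nv) => [[a [b inj]]|[w [t pl]]].
  by have [K] := free_routable inj; apply: absurd.
by have [k [C]] := plane_routable pl; apply: absurd.
Qed.
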